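(* Let a planar $4$-web be given by differential $1$-forms $\omega_1,\omega_2,\omega_3,\omega_4$ normalized by $\omega_1+\omega_2+\omega_3=0$, $a\omega_1+\omega_2+\omega_4=0$, with curvature function $K$ and basic invariant $a$, and let $c_0,c_1,c_2$ be the functions of $K$, $a$ and their covariant derivatives defined in the context. The $4$-web is of rank two if and only if $c_0\neq0$ and $$G_{ij}=0,\quad i,j=1,2,$$ where $$\begin{aligned} G_{11}={}&ac_0(c_{2,2}-c_{2,1})+ac_2(c_{0,1}-c_{0,2})-a(1-a)c_1c_2+(2a_2-a_1-aa_2)c_0c_2-Kc_0^2,\\ G_{12}={}&ac_0(c_{1,2}-c_{1,1})+ac_1(c_{0,1}-c_{0,2})-a(1-a)c_1^2+(2a_2-a_1-2aa_2)c_0c_1+(a_2^2+a_{12}-a_{22})c_0^2,\\ G_{21}={}&c_0(c_{2,1}-ac_{2,2})+c_2(ac_{0,2}-c_{0,1})-2a_2c_0c_2+a(1-a)c_2^2,\\ G_{22}={}&c_0(c_{1,1}-ac_{1,2})+c_1(ac_{0,2}-c_{0,1})+a(1-a)c_1c_2-a_2c_0c_1-a_2(1-a)c_0c_2+(a_{22}-K)c_0^2. \end{aligned}$$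
   Context: Everything is local (domains are shrunk as necessary; $c_0\ne0$ means nonvanishing on the domain considered, $c_0=0$ means identically zero), real and $C^\infty$. A planar $4$-web is a collection of four one-dimensional foliations of a plane domain whose directions are pairwise distinct at each point. The foliations are $\omega_i=0$, and the defining forms can always be rescaled to satisfy the normalization in the claim (one may moreover take $d\omega_3=0$); $a\neq0,1$ is the basic invariant. Rank: the dimension of the (local) solution space of the system $\lambda_1\omega_1+\lambda_2\omega_2+\lambda_3\omega_3+\lambda_4\omega_4=0$, $d(\lambda_1\omega_1)=\cdots=d(\lambda_4\omega_4)=0$ for functions $\lambda_1,\dots,\lambda_4$. Chern connection: there is a unique $1$-form $\gamma=g_1\omega_1+g_2\omega_2$ with $d\omega_i=\omega_i\wedge\gamma$ for $i=1,2,3$; $K$ is defined by $d\gamma=K\omega_1\wedge\omega_2$. Let $\partial_1,\partial_2$ be the frame dual to $\omega_1,\omega_2$. For a function $u$ of weight $k$, its covariant derivatives are $\delta_i(u)=\partial_i(u)-k\,g_i\,u$, $i=1,2$, which have weight $k+1$. They satisfy the Leibniz rule and $\delta_2\delta_1u-\delta_1\delta_2u=kKu$. The function $a$ has weight $0$ and $K$ has weight $2$. Notation: $a_i=\delta_i(a)$, $a_{11}=\delta_1\delta_1a$, $a_{12}=\delta_1\delta_2a=\delta_2\delta_1a$, $a_{22}=\delta_2\delta_2a$, $K_i=\delta_i(K)$. The symbols $a_{112}$ and $a_{122}$ denote symmetrized third covariant derivatives: $$a_{112}=\tfrac13(\delta_1\delta_1\delta_2+\delta_1\delta_2\delta_1+\delta_2\delta_1\delta_1)a,\qquad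 a_{122}=\tfrac13(\delta_1\delta_2\delta_2+\delta_2\delta_1\delta_2+\delta_2\delta_2\delta_1)a.$$ The functions $c_0,c_1,c_2$ are $$\begin{aligned} c_0={}&K+\frac{a_{11}-aa_{22}-2(1-a)a_{12}}{4a(1-a)}+\frac{(-1+2a)a_1^2-a^2a_2^2+2(1-a)^2a_1a_2}{4(1-a)^2a^2},\\ c_1={}&\frac{K_2-K_1}{4(1-a)}+\frac{(a-4)a_1+(11-20a+12a^2)a_2}{12(1-a)^2a}K+\frac{a_{112}-a_{122}}{4a(1-a)}+\frac{a_1-aa_2}{4a^2(1-a)}a_{22}\\ &+\frac{(2a-1)(a_1-aa_2)}{4(1-a)^2a^2}a_{12}-\frac{a_2^2\big((1-2a)a_1+aa_2\big)}{4(1-a)^2a^2},\\ c_2={}&\frac{aK_2-K_1}{4a(1-a)}+\frac{(1-2a)a_1-(a-2)aa_2}{4(1-a)^2a^2}K. \end{aligned}$$ Here $c_0$ has weight $2$, $c_1$ and $c_2$ have weight $3$, and $c_{j,i}=\delta_i(c_j)$ is the $i$-th covariant derivative of $c_j$. *)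

(* Defs.v *)
(* Stdlib world (concrete reals, Coquelicot).  Functions on a plane domain are
   total functions R -> R -> R of the coordinates (x, y) whose values outside
   the open domain are irrelevant: all differential operators are local. *)
From Stdlib Require Import Reals Lra List.
From Coquelicot Require Import Coquelicot.
Open Scope R_scope.

Definition scalar : Type := R -> R -> R.

Definition connected (U : R * R -> Prop) : Prop :=
  forall A B : R * R -> Prop, open A -> open B ->
    (forall p, U p -> A p \/ B p) ->
    (exists p, U p /\ A p) -> (exists p, U p /\ B p) ->
    exists p, U p /\ A p /\ B p.

Definition plane_domain (U : R * R -> Prop) : Prop :=
  open U /\ (exists p, U p) /\ connected U.

(* Pointwise ex_diff_n amounts to C^infinity only when required on an open set,
   which is how it is used below. *)
Definition smooth_at (f : scalar) (x y : R) : Prop :=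
  forall n : nat, ex_diff_n f n x y.

Definition smooth_on (U : R * R -> Prop) (f : scalar) : Prop :=
  forall x y, U (x, y) -> smooth_at f x y.

Definition vanishes_on (U : R * R -> Prop) (f : scalar) : Prop :=
  forall x y, U (x, y) -> f x y = 0.

Definition nonvanishing_on (U : R * R -> Prop) (f : scalar) : Prop :=
  forall x y, U (x, y) -> f x y <> 0.

Definition ddx (f : scalar) : scalar := fun x y => Derive (fun t => f t y) x.
Definition ddy (f : scalar) : scalar := fun x y => Derive (fun t => f x t) y.

(* The form  cdx dx + cdy dy. *)
Record form1 : Type := Form1 { cdx : scalar; cdy : scalar }.

Definition fadd (al be : form1) : form1 :=
  Form1 (fun x y => cdx al x y + cdx be x y) (fun x y => cdy al x y + cdy be x y).

Definition fscale (f : scalar) (al : form1) : form1 :=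
  Form1 (fun x y => f x y * cdx al x y) (fun x y => f x y * cdy al x y).

Definition fzero_at (al : form1) (x y : R) : Prop :=
  cdx al x y = 0 /\ cdy al x y = 0.

(* 2-forms are identified with their coefficient of dx /\ dy. *)
Definition wedge (al be : form1) : scalar :=
  fun x y => cdx al x y * cdy be x y - cdy al x y * cdx be x y.

Definition ext_d (al : form1) : scalar :=
  fun x y => ddx (cdy al) x y - ddy (cdx al) x y.

Inductive idx : Type := i1 | i2 | i3 | i4.

(* A pairwise nonzero wedge product forces each form to be nonzero and the
   four directions to be distinct. *)
Definition planar_4web (U : R * R -> Prop) (om : idx -> form1) : Prop :=
  (forall i, smooth_on U (cdx (om i)) /\ smooth_on U (cdy (om i))) /\
  (forall i j, i <> j -> nonvanishing_on U (wedge (om i) (om j))).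

Record web_data : Type := WebData {
  om : idx -> form1;
  inv_a : scalar;
  g1 : scalar;
  g2 : scalar;
  curvK : scalar }.

Definition normalized (U : R * R -> Prop) (W : web_data) : Prop :=
  smooth_on U (inv_a W) /\
  forall x y, U (x, y) ->
    fzero_at (fadd (om W i1) (fadd (om W i2) (om W i3))) x y /\
    fzero_at (fadd (fscale (inv_a W) (om W i1)) (fadd (om W i2) (om W i4))) x y.

Definition conn_form (W : web_data) : form1 :=
  fadd (fscale (g1 W) (om W i1)) (fscale (g2 W) (om W i2)).

Definition chern_connection (U : R * R -> Prop) (W : web_data) : Prop :=
  smooth_on U (g1 W) /\ smooth_on U (g2 W) /\
  forall x y, U (x, y) -> forall i, i <> i4 ->
    ext_d (om W i) x y = wedge (om W i) (conn_form W) x y.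

Definition curvature_function (U : R * R -> Prop) (W : web_data) : Prop :=
  smooth_on U (curvK W) /\
  forall x y, U (x, y) ->
    ext_d (conn_form W) x y = curvK W x y * wedge (om W i1) (om W i2) x y.

(* The frame dual to omega_1, omega_2, as components in (d/dx, d/dy). *)
Definition frame1 (W : web_data) (x y : R) : R * R :=
  (cdy (om W i2) x y / wedge (om W i1) (om W i2) x y,
   - cdx (om W i2) x y / wedge (om W i1) (om W i2) x y).

Definition frame2 (W : web_data) (x y : R) : R * R :=
  (- cdy (om W i1) x y / wedge (om W i1) (om W i2) x y,
   cdx (om W i1) x y / wedge (om W i1) (om W i2) x y).

Definition feval (al : form1) (x y : R) (v : R * R) : R :=
  cdx al x y * fst v + cdy al x y * snd v.

Lemma frame_dual (W : web_data) (x y : R) :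
  wedge (om W i1) (om W i2) x y <> 0 ->
  feval (om W i1) x y (frame1 W x y) = 1 /\
  feval (om W i2) x y (frame1 W x y) = 0 /\
  feval (om W i1) x y (frame2 W x y) = 0 /\
  feval (om W i2) x y (frame2 W x y) = 1.
Proof.
unfold feval, frame1, frame2, wedge; simpl; intros H.
repeat split; field; exact H.
Qed.

Definition differential (u : scalar) : form1 := Form1 (ddx u) (ddy u).

Definition del1 (W : web_data) (u : scalar) : scalar :=
  fun x y => feval (differential u) x y (frame1 W x y).

Definition del2 (W : web_data) (u : scalar) : scalar :=
  fun x y => feval (differential u) x y (frame2 W x y).

(* Covariant derivatives of a function u of weight k. *)
Definition cov1 (W : web_data) (k : R) (u : scalar) : scalar :=
  fun x y => del1 W u x y - k * g1 W x y * u x y.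

Definition cov2 (W : web_data) (k : R) (u : scalar) : scalar :=
  fun x y => del2 W u x y - k * g2 W x y * u x y.

Definition a_1 (W : web_data) : scalar := cov1 W 0 (inv_a W).
Definition a_2 (W : web_data) : scalar := cov2 W 0 (inv_a W).
Definition a_11 (W : web_data) : scalar := cov1 W 1 (a_1 W).
Definition a_12 (W : web_data) : scalar := cov1 W 1 (a_2 W).
Definition a_21 (W : web_data) : scalar := cov2 W 1 (a_1 W). (* = a_12 *)
Definition a_22 (W : web_data) : scalar := cov2 W 1 (a_2 W).

Definition a_112 (W : web_data) : scalar := fun x y =>
  / 3 * (cov1 W 2 (a_12 W) x y + cov1 W 2 (a_21 W) x y + cov2 W 2 (a_11 W) x y).

Definition a_122 (W : web_data) : scalar := fun x y =>
  / 3 * (cov1 W 2 (a_22 W) x y + cov2 W 2 (a_12 W) x y + cov2 W 2 (a_21 W) x y).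

Definition K_1 (W : web_data) : scalar := cov1 W 2 (curvK W).
Definition K_2 (W : web_data) : scalar := cov2 W 2 (curvK W).

Definition c0 (W : web_data) : scalar := fun x y =>
  let a := inv_a W x y in let K := curvK W x y in
  let a1 := a_1 W x y in let a2 := a_2 W x y in
  let a11 := a_11 W x y in let a12 := a_12 W x y in let a22 := a_22 W x y in
  K + (a11 - a * a22 - 2 * (1 - a) * a12) / (4 * a * (1 - a))
    + ((-1 + 2 * a) * a1 ^ 2 - a ^ 2 * a2 ^ 2 + 2 * (1 - a) ^ 2 * a1 * a2)
      / (4 * (1 - a) ^ 2 * a ^ 2).

Definition c1 (W : web_data) : scalar := fun x y =>
  let a := inv_a W x y in let K := curvK W x y in
  let K1 := K_1 W x y in let K2 := K_2 W x y in
  let a1 := a_1 W x y in let a2 := a_2 W x y in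
  let a12 := a_12 W x y in let a22 := a_22 W x y in
  let a112 := a_112 W x y in let a122 := a_122 W x y in
  (K2 - K1) / (4 * (1 - a))
    + ((a - 4) * a1 + (11 - 20 * a + 12 * a ^ 2) * a2)
      / (12 * (1 - a) ^ 2 * a) * K
    + (a112 - a122) / (4 * a * (1 - a))
    + (a1 - a * a2) / (4 * a ^ 2 * (1 - a)) * a22
    + ((2 * a - 1) * (a1 - a * a2)) / (4 * (1 - a) ^ 2 * a ^ 2) * a12
    - (a2 ^ 2 * ((1 - 2 * a) * a1 + a * a2)) / (4 * (1 - a) ^ 2 * a ^ 2).

Definition c2 (W : web_data) : scalar := fun x y =>
  let a := inv_a W x y in let K := curvK W x y in
  let K1 := K_1 W x y in let K2 := K_2 W x y in
  let a1 := a_1 W x y in let a2 := a_2 W x y in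
  (a * K2 - K1) / (4 * a * (1 - a))
    + ((1 - 2 * a) * a1 - (a - 2) * a * a2) / (4 * (1 - a) ^ 2 * a ^ 2) * K.

(* c_{j,i} = delta_i c_j. *)
Definition c0_1 (W : web_data) : scalar := cov1 W 2 (c0 W).
Definition c0_2 (W : web_data) : scalar := cov2 W 2 (c0 W).
Definition c1_1 (W : web_data) : scalar := cov1 W 3 (c1 W).
Definition c1_2 (W : web_data) : scalar := cov2 W 3 (c1 W).
Definition c2_1 (W : web_data) : scalar := cov1 W 3 (c2 W).
Definition c2_2 (W : web_data) : scalar := cov2 W 3 (c2 W).

Definition G11 (W : web_data) : scalar := fun x y =>
  let a := inv_a W x y in let K := curvK W x y in
  let a1 := a_1 W x y in let a2 := a_2 W x y in
  let C0 := c0 W x y in let C1 := c1 W x y in let C2 := c2 W x y in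
  a * C0 * (c2_2 W x y - c2_1 W x y) + a * C2 * (c0_1 W x y - c0_2 W x y)
    - a * (1 - a) * C1 * C2 + (2 * a2 - a1 - a * a2) * C0 * C2 - K * C0 ^ 2.

Definition G12 (W : web_data) : scalar := fun x y =>
  let a := inv_a W x y in
  let a1 := a_1 W x y in let a2 := a_2 W x y in
  let a12 := a_12 W x y in let a22 := a_22 W x y in
  let C0 := c0 W x y in let C1 := c1 W x y in
  a * C0 * (c1_2 W x y - c1_1 W x y) + a * C1 * (c0_1 W x y - c0_2 W x y)
    - a * (1 - a) * C1 ^ 2 + (2 * a2 - a1 - 2 * a * a2) * C0 * C1
    + (a2 ^ 2 + a12 - a22) * C0 ^ 2.

Definition G21 (W : web_data) : scalar := fun x y =>
  let a := inv_a W x y in let a2 := a_2 W x y in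
  let C0 := c0 W x y in let C2 := c2 W x y in
  C0 * (c2_1 W x y - a * c2_2 W x y) + C2 * (a * c0_2 W x y - c0_1 W x y)
    - 2 * a2 * C0 * C2 + a * (1 - a) * C2 ^ 2.

Definition G22 (W : web_data) : scalar := fun x y =>
  let a := inv_a W x y in let K := curvK W x y in
  let a2 := a_2 W x y in let a22 := a_22 W x y in
  let C0 := c0 W x y in let C1 := c1 W x y in let C2 := c2 W x y in
  C0 * (c1_1 W x y - a * c1_2 W x y) + C1 * (a * c0_2 W x y - c0_1 W x y)
    + a * (1 - a) * C1 * C2 - a2 * C0 * C1 - a2 * (1 - a) * C0 * C2
    + (a22 - K) * C0 ^ 2.

(* The solution space of the abelian relation equations is taken at the level
   of germs: a local solution at (x0, y0) lives on some neighbourhood of it,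
   and two solutions are identified when they agree near (x0, y0). *)
Definition abelian_relation_at (w : idx -> form1) (x0 y0 : R)
    (la : idx -> scalar) : Prop :=
  locally_2d (fun x y =>
    (forall i, smooth_at (la i) x y) /\
    fzero_at (fadd (fadd (fscale (la i1) (w i1)) (fscale (la i2) (w i2)))
                   (fadd (fscale (la i3) (w i3)) (fscale (la i4) (w i4)))) x y /\
    (forall i, ext_d (fscale (la i) (w i)) x y = 0)) x0 y0.

Definition lincomb (n : nat) (c : nat -> R) (s : nat -> idx -> scalar)
    (i : idx) : scalar :=
  fun x y => fold_right Rplus 0 (map (fun k => c k * s k i x y) (seq 0 n)).

(* The germs s 0, ..., s (n - 1) form a basis of the solution space. *)
Definition rank_at (w : idx -> form1) (x0 y0 : R) (n : nat) : Prop :=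
  exists s : nat -> idx -> scalar,
    (forall k, (k < n)%nat -> abelian_relation_at w x0 y0 (s k)) /\
    (forall c : nat -> R,
       locally_2d (fun x y => forall i, lincomb n c s i x y = 0) x0 y0 ->
       forall k, (k < n)%nat -> c k = 0) /\
    (forall la, abelian_relation_at w x0 y0 la ->
       exists c : nat -> R,
         locally_2d (fun x y => forall i, la i x y = lincomb n c s i x y) x0 y0).

Definition has_rank (U : R * R -> Prop) (w : idx -> form1) (n : nat) : Prop :=
  forall x y, U (x, y) -> rank_at w x y n.

(* Main.v *)
Require Import Defs.
From Stdlib Require Import Reals Lra Lia Ranalysis5.
From Coquelicot Require Import Coquelicot.
Open Scope R_scope.

(** The lambda_i have weight 1, so that gamma disappears and closedness becomes a set of equations
    on covariant derivatives. Substituting lambda_1 = u + a v and lambda_2 = u + v leaves four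
    2-forms with zero sum, hence three equations on the four first derivatives of u and v: q is the
    one left free. The commutators of u and v are then two linear equations for the two derivatives
    of q, solvable because a and 1 - a do not vanish. The integrability defect of q is four times
    the stated relation, which accounts for the denominators 4 in the c_j.

    The rank concerns germs of solutions, whereas flatness is a pointwise condition on coefficients.
    Both are served by one identity for each system: its curvature is computed for functions that
    satisfy the system at a single point. Compared with the commutator rule for a genuine solution,
    it yields a constraint on that solution; applied to functions with an arbitrary value at the
    point, it yields flatness. *)

(* Put u = lambda_3, v = lambda_4, q = delta_2 v.  The abelian relation equations and
   the integrability conditions of u and v express all covariant derivatives of
   (u, v, q) linearly in (u, v, q), so a solution germ is determined by its value at a
   point.  The integrability condition of q itself is c_0 q + c_1 v + c_2 u = 0.  If
   c_0 <> 0, eliminating q leaves a linear system for (u, v) whose curvature is the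
   matrix (G_ij) / c_0^2, and the rank is two iff it vanishes.  If c_0 = 0, the rank is
   three when c_1 = c_2 = 0 and at most one at a point where they do not both
   vanish.  Existence for flat linear systems is the Frobenius theorem. *)

(** * Smooth functions on open sets *)


Lemma open_locally_2d (V : R * R -> Prop) (x y : R) :
  open V -> V (x, y) -> locally_2d (fun u v => V (u, v)) x y.
Proof.
intros oV Vxy; apply locally_2d_locally.
apply filter_imp with (P := V); [now intros [u v] | exact (oV _ Vxy)].
Qed.

Lemma locally_2d_on_open (V : R * R -> Prop) (P : R -> R -> Prop) (x y : R) :
  open V -> V (x, y) -> (forall u v, V (u, v) -> P u v) -> locally_2d P x y.
Proof.
intros oV Vxy HP.
destruct (open_locally_2d V x y oV Vxy) as [d Hd].
exists d; intros; apply HP, Hd; assumption.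
Qed.

(** What [ex_diff_n] asks of the function itself at every positive order; its other clauses concern
    the partial derivatives. *)
Definition diff_pt (f : scalar) (x y : R) : Prop :=
  continuity_2d_pt f x y /\ ex_derive (fun t => f t y) x /\
  ex_derive (fun t => f x t) y.

Lemma smooth_diff_pt (V : R * R -> Prop) (f : scalar) (x y : R) :
  smooth_on V f -> V (x, y) -> diff_pt f x y.
Proof.
intros Hf Vxy; destruct (Hf x y Vxy 1%nat) as (Hc & Hx & Hy & _).
now split; [| split].
Qed.

Lemma smooth_ddx (V : R * R -> Prop) (f : scalar) :
  smooth_on V f -> smooth_on V (ddx f).
Proof. intros Hf x y Vxy n; apply (ex_diff_n_deriv_aux1 f n), (Hf x y Vxy (S n)). Qed.

Lemma smooth_ddy (V : R * R -> Prop) (f : scalar) :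
  smooth_on V f -> smooth_on V (ddy f).
Proof. intros Hf x y Vxy n; apply (ex_diff_n_deriv_aux2 f n), (Hf x y Vxy (S n)). Qed.

Lemma diff_pt_x (f : scalar) (x y : R) : diff_pt f x y -> ex_derive (fun t => f t y) x.
Proof. now intros (_ & Hx & _). Qed.

Lemma diff_pt_y (f : scalar) (x y : R) : diff_pt f x y -> ex_derive (fun t => f x t) y.
Proof. now intros (_ & _ & Hy). Qed.

Lemma diff_pt_ext_loc (f g : scalar) (x y : R) :
  locally_2d (fun u v => f u v = g u v) x y -> diff_pt f x y -> diff_pt g x y.
Proof.
intros E (Hc & Hx & Hy); split; [| split].
- exact (continuity_2d_pt_ext_loc _ _ _ _ E Hc).
- apply ex_derive_ext_loc with (2 := Hx).
  exact (locally_2d_1d_const_y _ _ _ E).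
- apply ex_derive_ext_loc with (2 := Hy).
  exact (locally_2d_1d_const_x _ _ _ E).
Qed.

Lemma ddx_ext_loc (f g : scalar) (x y : R) :
  locally_2d (fun u v => f u v = g u v) x y -> ddx f x y = ddx g x y.
Proof. intros E; apply Derive_ext_loc; exact (locally_2d_1d_const_y _ _ _ E). Qed.

Lemma ddy_ext_loc (f g : scalar) (x y : R) :
  locally_2d (fun u v => f u v = g u v) x y -> ddy f x y = ddy g x y.
Proof. intros E; apply Derive_ext_loc; exact (locally_2d_1d_const_x _ _ _ E). Qed.

Section Algebra.

Variable V : R * R -> Prop.
Variable S : scalar -> Prop.

(* Closure of a family of functions on V under the operations that differentiation
   commutes with; when the generators have partial derivatives in it, so has every
   member, and iterating this gives smoothness. *)
Inductive salg : scalar -> Prop :=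
| salg_gen (f : scalar) : S f -> salg f
| salg_ext (f g : scalar) :
    (forall x y, V (x, y) -> f x y = g x y) -> salg f -> salg g
| salg_const (c : R) : salg (fun _ _ => c)
| salg_add (f g : scalar) : salg f -> salg g -> salg (fun x y => f x y + g x y)
| salg_mul (f g : scalar) : salg f -> salg g -> salg (fun x y => f x y * g x y)
| salg_inv (f : scalar) :
    nonvanishing_on V f -> salg f -> salg (fun x y => / f x y).

Hypothesis oV : open V.
Hypothesis gen_diff : forall f, S f -> forall x y, V (x, y) -> diff_pt f x y.
Hypothesis gen_ddx : forall f, S f -> salg (ddx f).
Hypothesis gen_ddy : forall f, S f -> salg (ddy f).

(** The sum, product and inverse rules express partial derivatives through members and their partial
    derivatives, so the property passes from the generators to the closure. Differentiability is
    carried along because [Derive] is total and its rules require it. *)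
Lemma salg_step (f : scalar) :
  salg f ->
  (forall x y, V (x, y) -> diff_pt f x y) /\ salg (ddx f) /\ salg (ddy f).
Proof.
induction 1 as [f Sf | f g E _ IH | c | f g Hf IHf Hg IHg
               | f g Hf IHf Hg IHg | f nz Hf IHf].
- split; [| split]; auto; now apply gen_diff.
- destruct IH as (Hd & Hx & Hy).
  assert (L : forall x y, V (x, y) -> locally_2d (fun u v => f u v = g u v) x y).
  { intros; apply (locally_2d_on_open V); auto. }
  split; [| split].
  + intros x y Vxy; apply diff_pt_ext_loc with (f := f); auto.
  + apply salg_ext with (f := ddx f); [| exact Hx].
    intros; apply ddx_ext_loc; auto.
  + apply salg_ext with (f := ddy f); [| exact Hy].
    intros; apply ddy_ext_loc; auto.
- split; [| split].
  + intros x y _; split; [| split]; try apply ex_derive_const.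
    apply continuity_2d_pt_const.
  + apply salg_ext with (f := fun _ _ => 0); [| apply salg_const].
    intros; unfold ddx, ddy; symmetry; apply Derive_const.
  + apply salg_ext with (f := fun _ _ => 0); [| apply salg_const].
    intros; unfold ddx, ddy; symmetry; apply Derive_const.
- destruct IHf as (Hd & Hx & Hy), IHg as (Hd' & Hx' & Hy').
  split; [| split].
  + intros x y Vxy; destruct (Hd x y Vxy) as (? & ? & ?).
    destruct (Hd' x y Vxy) as (? & ? & ?); split; [| split].
    * now apply continuity_2d_pt_plus.
    * now apply (ex_derive_plus (fun t => f t y) (fun t => g t y)).
    * now apply (ex_derive_plus (fun t => f x t) (fun t => g x t)).
  + apply salg_ext with (2 := salg_add _ _ Hx Hx').
    intros x y Vxy; unfold ddx, ddy; symmetry.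
    apply (Derive_plus (fun t => f t y) (fun t => g t y));
      [exact (diff_pt_x _ _ _ (Hd x y Vxy)) | exact (diff_pt_x _ _ _ (Hd' x y Vxy))].
  + apply salg_ext with (2 := salg_add _ _ Hy Hy').
    intros x y Vxy; unfold ddx, ddy; symmetry.
    apply (Derive_plus (fun t => f x t) (fun t => g x t));
      [exact (diff_pt_y _ _ _ (Hd x y Vxy)) | exact (diff_pt_y _ _ _ (Hd' x y Vxy))].
- destruct IHf as (Hd & Hx & Hy), IHg as (Hd' & Hx' & Hy').
  split; [| split].
  + intros x y Vxy; destruct (Hd x y Vxy) as (? & ? & ?).
    destruct (Hd' x y Vxy) as (? & ? & ?); split; [| split].
    * now apply continuity_2d_pt_mult.
    * now apply (ex_derive_mult (fun t => f t y) (fun t => g t y)).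
    * now apply (ex_derive_mult (fun t => f x t) (fun t => g x t)).
  + apply salg_ext with
      (2 := salg_add _ _ (salg_mul _ _ Hx Hg) (salg_mul _ _ Hf Hx')).
    intros x y Vxy; unfold ddx, ddy; symmetry.
    apply (Derive_mult (fun t => f t y) (fun t => g t y));
      [exact (diff_pt_x _ _ _ (Hd x y Vxy)) | exact (diff_pt_x _ _ _ (Hd' x y Vxy))].
  + apply salg_ext with
      (2 := salg_add _ _ (salg_mul _ _ Hy Hg) (salg_mul _ _ Hf Hy')).
    intros x y Vxy; unfold ddx, ddy; symmetry.
    apply (Derive_mult (fun t => f x t) (fun t => g x t));
      [exact (diff_pt_y _ _ _ (Hd x y Vxy)) | exact (diff_pt_y _ _ _ (Hd' x y Vxy))].
- destruct IHf as (Hd & Hx & Hy).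
  assert (Hi := salg_inv _ nz Hf).
  assert (Hi2 := salg_mul _ _ (salg_const (-1)) (salg_mul _ _ Hi Hi)).
  split; [| split].
  + intros x y Vxy; destruct (Hd x y Vxy) as (? & ? & ?); split; [| split].
    * apply continuity_2d_pt_inv; auto.
    * apply (ex_derive_inv (fun t => f t y)); auto.
    * apply (ex_derive_inv (fun t => f x t)); auto.
  + apply salg_ext with (2 := salg_mul _ _ Hi2 Hx).
    intros x y Vxy; unfold ddx.
    rewrite Derive_inv; [| exact (diff_pt_x _ _ _ (Hd x y Vxy)) | now apply nz].
    field; now apply nz.
  + apply salg_ext with (2 := salg_mul _ _ Hi2 Hy).
    intros x y Vxy; unfold ddy.
    rewrite (Derive_inv (fun t => f x t));
      [| exact (diff_pt_y _ _ _ (Hd x y Vxy)) | now apply nz].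
    field; now apply nz.
Qed.

(** Each order of differentiation costs one use of [salg_step]. The generators are not assumed
    smooth, only to have derivatives in the closure: this is what later bootstraps solutions of
    linear systems. *)
Lemma salg_smooth (f : scalar) : salg f -> smooth_on V f.
Proof.
intros Hf x y Vxy n; revert f Hf.
induction n as [| n IH]; intros f Hf; destruct (salg_step f Hf) as (Hd & Hx & Hy);
  destruct (Hd x y Vxy) as (? & ? & ?); simpl; auto.
split; [auto | split; [auto | split; [auto |]]].
split; [apply (IH _ Hx) | apply (IH _ Hy)].
Qed.

End Algebra.

Lemma smooth_salg (V : R * R -> Prop) (f : scalar) :
  open V -> salg V (smooth_on V) f -> smooth_on V f.
Proof.
intros oV; apply salg_smooth; auto.
- intros g Hg x y; now apply smooth_diff_pt.
- intros g Hg; apply salg_gen, smooth_ddx, Hg.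
- intros g Hg; apply salg_gen, smooth_ddy, Hg.
Qed.

Section Closure.

Variable V : R * R -> Prop.
Hypothesis oV : open V.

Lemma smooth_ext (f g : scalar) :
  (forall x y, V (x, y) -> f x y = g x y) -> smooth_on V f -> smooth_on V g.
Proof.
intros E Hf; apply smooth_salg, salg_ext with (1 := E); auto.
now apply salg_gen.
Qed.

Lemma smooth_const (c : R) : smooth_on V (fun _ _ => c).
Proof. apply smooth_salg, salg_const; auto. Qed.

Lemma smooth_add (f g : scalar) :
  smooth_on V f -> smooth_on V g -> smooth_on V (fun x y => f x y + g x y).
Proof. intros; apply smooth_salg, salg_add; auto; now apply salg_gen. Qed.

Lemma smooth_mul (f g : scalar) :
  smooth_on V f -> smooth_on V g -> smooth_on V (fun x y => f x y * g x y).
Proof. intros; apply smooth_salg, salg_mul; auto; now apply salg_gen. Qed.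

Lemma smooth_inv (f : scalar) :
  nonvanishing_on V f -> smooth_on V f -> smooth_on V (fun x y => / f x y).
Proof. intros; apply smooth_salg, salg_inv; auto; now apply salg_gen. Qed.

Lemma smooth_opp (f : scalar) : smooth_on V f -> smooth_on V (fun x y => - f x y).
Proof.
intros Hf; apply smooth_ext with (f := fun x y => -1 * f x y); [intros; ring |].
apply smooth_mul; auto; apply smooth_const.
Qed.

Lemma smooth_sub (f g : scalar) :
  smooth_on V f -> smooth_on V g -> smooth_on V (fun x y => f x y - g x y).
Proof. intros; apply smooth_add; auto; now apply smooth_opp. Qed.

Lemma smooth_div (f g : scalar) :
  nonvanishing_on V g -> smooth_on V f -> smooth_on V g ->
  smooth_on V (fun x y => f x y / g x y).
Proof. intros; apply smooth_mul; auto; now apply smooth_inv. Qed.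

Lemma smooth_pow (f : scalar) (n : nat) :
  smooth_on V f -> smooth_on V (fun x y => f x y ^ n).
Proof.
intros Hf; induction n as [| n IH]; simpl; [apply smooth_const |].
now apply smooth_mul.
Qed.

Lemma smooth_sum (f : nat -> scalar) (n : nat) :
  (forall k, (k <= n)%nat -> smooth_on V (f k)) ->
  smooth_on V (fun x y => sum_f_R0 (fun k => f k x y) n).
Proof.
induction n as [| n IH]; intros Hf; simpl; [now apply Hf |].
apply smooth_add; [apply IH; intros; apply Hf; lia | now apply Hf].
Qed.

Lemma smooth_coord1 : smooth_on V (fun x _ => x).
Proof.
apply (salg_smooth V (fun f => f = fun x _ => x)); [auto | | | | now apply salg_gen].
- intros f -> x y _; split; [apply continuity_2d_pt_id1 | split].
  + apply ex_derive_id.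
  + apply ex_derive_const.
- intros f ->; apply salg_ext with (f := fun _ _ => 1); [| apply salg_const].
  intros; unfold ddx, ddy; symmetry; apply Derive_id.
- intros f ->; apply salg_ext with (f := fun _ _ => 0); [| apply salg_const].
  intros; unfold ddx, ddy; symmetry; apply Derive_const.
Qed.

Lemma smooth_coord2 : smooth_on V (fun _ y => y).
Proof.
apply (salg_smooth V (fun f => f = fun _ y => y)); [auto | | | | now apply salg_gen].
- intros f -> x y _; split; [apply continuity_2d_pt_id2 | split].
  + apply ex_derive_const.
  + apply ex_derive_id.
- intros f ->; apply salg_ext with (f := fun _ _ => 0); [| apply salg_const].
  intros; unfold ddx, ddy; symmetry; apply Derive_const.
- intros f ->; apply salg_ext with (f := fun _ _ => 1); [| apply salg_const].
  intros; unfold ddx, ddy; symmetry; apply Derive_id.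
Qed.

Lemma smooth_Schwarz (f : scalar) (x y : R) :
  smooth_on V f -> V (x, y) -> ddx (ddy f) x y = ddy (ddx f) x y.
Proof.
intros Hf Vxy; apply Schwarz.
- apply (locally_2d_on_open V); auto; intros u v Vuv.
  destruct (smooth_diff_pt V f u v Hf Vuv) as (_ & ? & ?).
  destruct (smooth_diff_pt V _ u v (smooth_ddx V f Hf) Vuv) as (_ & _ & ?).
  destruct (smooth_diff_pt V _ u v (smooth_ddy V f Hf) Vuv) as (_ & ? & _).
  now split; [| split].
- apply (smooth_diff_pt V (ddx (ddy f)) x y); auto.
  now apply smooth_ddx, smooth_ddy.
- apply (smooth_diff_pt V (ddy (ddx f)) x y); auto.
  now apply smooth_ddy, smooth_ddx.
Qed.

End Closure.

Lemma smooth_on_subset (V V' : R * R -> Prop) (f : scalar) :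
  (forall p, V' p -> V p) -> smooth_on V f -> smooth_on V' f.
Proof. intros HV Hf x y Vxy; apply Hf, HV, Vxy. Qed.

(** The shape of the neighbourhoods in [locally_2d]. Axis-parallel segments between its points stay
    inside, so estimates can be made in one variable at a time. *)
Definition box (x0 y0 r : R) : R * R -> Prop :=
  fun p => Rabs (fst p - x0) < r /\ Rabs (snd p - y0) < r.

Lemma open_box (x0 y0 r : R) : open (box x0 y0 r).
Proof.
intros [x y] [Hx Hy]; simpl in Hx, Hy.
assert (Hd : 0 < Rmin (r - Rabs (x - x0)) (r - Rabs (y - y0))).
{ apply Rmin_glb_lt; lra. }
exists (mkposreal _ Hd); intros [u v] [Hu Hv].
change (Rabs (u - x) < Rmin (r - Rabs (x - x0)) (r - Rabs (y - y0))) in Hu.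
change (Rabs (v - y) < Rmin (r - Rabs (x - x0)) (r - Rabs (y - y0))) in Hv.
assert (H1 := Rmin_l (r - Rabs (x - x0)) (r - Rabs (y - y0))).
assert (H2 := Rmin_r (r - Rabs (x - x0)) (r - Rabs (y - y0))).
split; simpl.
- replace (u - x0) with ((u - x) + (x - x0)) by ring.
  apply Rle_lt_trans with (1 := Rabs_triang _ _); lra.
- replace (v - y0) with ((v - y) + (y - y0)) by ring.
  apply Rle_lt_trans with (1 := Rabs_triang _ _); lra.
Qed.

Lemma box_center (x0 y0 r : R) : 0 < r -> box x0 y0 r (x0, y0).
Proof. intros Hr; split; simpl; rewrite Rminus_diag, Rabs_R0; exact Hr. Qed.

Lemma box_monotone (x0 y0 r r' : R) (p : R * R) :
  r' <= r -> box x0 y0 r' p -> box x0 y0 r p.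
Proof. intros Hr [H1 H2]; split; lra. Qed.

Lemma box_locally_2d (P : R -> R -> Prop) (x0 y0 : R) :
  locally_2d P x0 y0 <->
  exists r, 0 < r /\ forall x y, box x0 y0 r (x, y) -> P x y.
Proof.
split.
- intros [d Hd]; exists d; split; [apply cond_pos |].
  intros x y [H1 H2]; now apply Hd.
- intros (r & Hr & H); exists (mkposreal r Hr); intros; apply H; now split.
Qed.

(** * Linear ordinary differential equations *)


(** [N] is the last index: vectors have N + 1 entries, which is the source of the factor [INR (S N)]
    in the bounds. *)
Definition lin (N : nat) (A : nat -> nat -> R) (Y : nat -> R) (j : nat) : R :=
  sum_f_R0 (fun k => A j k * Y k) N.

Lemma lin_bound (N : nat) (A : nat -> nat -> R) (Y : nat -> R) (C M : R) (j : nat) :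
  (forall k, (k <= N)%nat -> Rabs (A j k) <= C) ->
  (forall k, (k <= N)%nat -> Rabs (Y k) <= M) ->
  Rabs (lin N A Y j) <= INR (S N) * C * M.
Proof.
intros HA HY; unfold lin.
apply Rle_trans with (1 := sum_f_R0_triangle _ _).
replace (INR (S N) * C * M) with (sum_f_R0 (fun _ => C * M) N)
  by (rewrite sum_cte; ring).
apply sum_Rle; intros k Hk; rewrite Rabs_mult.
apply Rmult_le_compat; auto using Rabs_pos.
Qed.

Lemma lin_minus (N : nat) (A : nat -> nat -> R) (Y Z : nat -> R) (j : nat) :
  lin N A Y j - lin N A Z j = lin N A (fun k => Y k - Z k) j.
Proof.
unfold lin; rewrite <- minus_sum; apply sum_eq; intros; ring.
Qed.

Lemma lin_ext (N : nat) (A : nat -> nat -> R) (Y Z : nat -> R) (j : nat) :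
  (forall k, (k <= N)%nat -> Y k = Z k) -> lin N A Y j = lin N A Z j.
Proof. intros E; apply sum_eq; intros; now rewrite E. Qed.

Lemma is_derive_continuity_pt (f : R -> R) (t l : R) :
  is_derive f t l -> continuity_pt f t.
Proof.
intros H; apply derivable_continuous_pt; exists l; now apply is_derive_Reals.
Qed.

Lemma is_derive_sum (f : nat -> R -> R) (d : nat -> R) (t : R) (N : nat) :
  (forall k, (k <= N)%nat -> is_derive (f k) t (d k)) ->
  is_derive (fun u => sum_f_R0 (fun k => f k u) N) t (sum_f_R0 d N).
Proof.
induction N as [| N IH]; intros H; simpl; [now apply H |].
apply (is_derive_plus (fun u => sum_f_R0 (fun k => f k u) N) (f (S N)));
  [apply IH; intros; apply H; lia | now apply H].
Qed.

Lemma interval_segment (t0 r s t c : R) :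
  Rabs (s - t0) < r -> Rabs (t - t0) < r -> Rmin s t <= c <= Rmax s t ->
  Rabs (c - t0) < r.
Proof.
intros Hs Ht [H1 H2]; apply Rabs_def2 in Hs, Ht; apply Rabs_def1;
  unfold Rmin, Rmax in *; destruct (Rle_dec s t); lra.
Qed.

Lemma interval_center (t0 r : R) : 0 < r -> Rabs (t0 - t0) < r.
Proof. intros Hr; now rewrite Rminus_diag, Rabs_R0. Qed.

Lemma lipschitz_interval (f f' : R -> R) (t0 r B : R) :
  (forall t, Rabs (t - t0) < r -> is_derive f t (f' t)) ->
  (forall t, Rabs (t - t0) < r -> Rabs (f' t) <= B) ->
  forall s t, Rabs (s - t0) < r -> Rabs (t - t0) < r ->
  Rabs (f t - f s) <= B * Rabs (t - s).
Proof.
intros Hd Hb s t Hs Ht.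
destruct (MVT_abs f f' s t) as (c & Hc & Hi).
- intros c Hc; apply is_derive_Reals, Hd.
  now apply interval_segment with (3 := Hc).
- rewrite Hc; apply Rmult_le_compat_r; [apply Rabs_pos |].
  apply Hb; now apply interval_segment with (3 := Hi).
Qed.

(** The supremum m is finite thanks to [M0] and satisfies m <= E + m / 2; the value of [M0] leaves
    no trace in the conclusion. *)
Lemma halving_bound (T : Type) (f : T -> R) (E M0 : R) :
  (forall t, f t <= M0) ->
  (forall M, (forall t, f t <= M) -> forall t, f t <= E + M / 2) ->
  forall t, f t <= 2 * E.
Proof.
intros H0 Hstep t.
destruct (completeness (fun v => exists t, v = f t)) as [m [Hub Hlub]].
- exists M0; intros v [u ->]; apply H0.
- now exists (f t), t.
- assert (Hm : m <= E + m / 2).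
  { apply Hlub; intros v [u ->]; apply Hstep; intros w; apply Hub; now exists w. }
  assert (f t <= m) by (apply Hub; now exists t); lra.
Qed.

(** With L r <= 1/2, the mean value theorem turns a common bound M into e + s r + M / 2, and
    [halving_bound] eliminates M. The factor 2 stands in for the exponential of Gronwall's
    inequality. *)
Lemma gronwall_short (N : nat) (f f' : nat -> R -> R) (t0 r L e s M0 : R) :
  0 <= s -> 0 <= L -> L * r <= / 2 ->
  (forall j t, (j <= N)%nat -> Rabs (t - t0) < r -> is_derive (f j) t (f' j t)) ->
  (forall M t j, Rabs (t - t0) < r -> (forall k, (k <= N)%nat -> Rabs (f k t) <= M) ->
     (j <= N)%nat -> Rabs (f' j t) <= L * M + s) ->
  (forall j, (j <= N)%nat -> Rabs (f j t0) <= e) ->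
  (forall j t, (j <= N)%nat -> Rabs (t - t0) < r -> Rabs (f j t) <= M0) ->
  forall j t, (j <= N)%nat -> Rabs (t - t0) < r -> Rabs (f j t) <= 2 * (e + s * r).
Proof.
intros s0 L0 HLr Hd Hb He H0 j t Hj Ht.
assert (Hr : 0 < r) by (apply Rle_lt_trans with (2 := Ht); apply Rabs_pos).
(* Index and time are paired so that a single supremum covers all components; the subtype carries
   the range conditions. *)
set (T := {p : nat * R | (fst p <= N)%nat /\ Rabs (snd p - t0) < r}).
assert (HT := fun H => halving_bound T
  (fun p => Rabs (f (fst (proj1_sig p)) (snd (proj1_sig p)))) (e + s * r) M0 H).
simpl in HT.
refine (HT _ _ (exist _ (j, t) (conj Hj Ht))); clear HT j t Hj Ht.
- intros [[j t] [Hj Ht]]; simpl in *; now apply H0.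
- intros M HM [[j t] [Hj Ht]]; simpl in *.
  assert (HM' : forall j t, (j <= N)%nat -> Rabs (t - t0) < r -> Rabs (f j t) <= M).
  { intros k u Hk Hu; exact (HM (exist _ (k, u) (conj Hk Hu))). }
  assert (M1 : 0 <= M) by (apply Rle_trans with (2 := HM' _ _ Hj Ht); apply Rabs_pos).
  assert (Hl := lipschitz_interval (f j) (f' j) t0 r (L * M + s)
    (fun t Ht => Hd j t Hj Ht)
    (fun u Hu => Hb M u j Hu (fun k Hk => HM' k u Hk Hu) Hj)
    t0 t (interval_center t0 r Hr) Ht).
  replace (f j t) with ((f j t - f j t0) + f j t0) by ring.
  apply Rle_trans with (1 := Rabs_triang _ _).
  assert (Hej := He j Hj).
  assert ((L * M + s) * Rabs (t - t0) <= (L * M + s) * r)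
    by (apply Rmult_le_compat_l; [nra | lra]).
  assert (L * r * M <= / 2 * M) by (apply Rmult_le_compat_r; lra).
  lra.
Qed.

Lemma geometric_limit (u : nat -> R) (H : R) :
  (forall m, Rabs (u (S m) - u m) <= H / 2 ^ S m) ->
  is_lim_seq u (Finite (Lim_seq u)) /\ forall m, Rabs (Lim_seq u - u m) <= H / 2 ^ m.
Proof.
intros Hu.
assert (P2 : forall m, 0 < 2 ^ m) by (intros; apply pow_lt; lra).
assert (H0 : 0 <= H).
{ assert (A := Rle_trans _ _ _ (Rabs_pos _) (Hu 0%nat)); simpl in A; lra. }
assert (Hk : forall m k, Rabs (u (k + m)%nat - u m) <= H / 2 ^ m).
{ intros m k.
  (* Subtracting the remaining tail makes the geometric sum exact, so that the induction on k
     closes. *)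
  cut (Rabs (u (k + m)%nat - u m) <= H / 2 ^ m - H / 2 ^ (k + m)).
  { assert (0 <= H / 2 ^ (k + m)); [| lra].
    apply Rmult_le_pos; [exact H0 | left; now apply Rinv_0_lt_compat]. }
  induction k as [| k IH]; simpl.
  - rewrite Rminus_diag, Rabs_R0; lra.
  - replace (u (S (k + m)) - u m)
      with ((u (S (k + m)) - u (k + m)%nat) + (u (k + m)%nat - u m)) by ring.
    apply Rle_trans with (1 := Rabs_triang _ _).
    assert (A := Hu (k + m)%nat); simpl in A.
    assert (E : H / (2 * 2 ^ (k + m)) = H / 2 ^ (k + m) / 2).
    { field; specialize (P2 (k + m)%nat); lra. }
    rewrite E in *; lra. }
assert (Hex : ex_finite_lim_seq u).
{ apply ex_lim_seq_cauchy_corr; intros eps.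
  (* H may be 0, hence H + 1 in the denominator. *)
  assert (He : 0 < eps / (2 * (H + 1)))
    by (apply Rdiv_lt_0_compat; [apply cond_pos | lra]).
  destruct (pow_lt_1_zero (/ 2)) with (2 := He) as [n0 Hn0];
    [rewrite Rabs_pos_eq; lra |].
  assert (Hb : forall n, (n0 <= n)%nat -> Rabs (u n - u n0) < eps / 2).
  { intros n Hn; replace n with ((n - n0) + n0)%nat by lia.
    apply Rle_lt_trans with (1 := Hk _ _).
    specialize (Hn0 n0 (le_n _)).
    rewrite pow_inv, Rabs_pos_eq in Hn0
      by (left; now apply Rinv_0_lt_compat).
    apply Rle_lt_trans with ((H + 1) * / 2 ^ n0).
    - apply Rmult_le_compat_r; [left; now apply Rinv_0_lt_compat | lra].
    - apply Rlt_le_trans with ((H + 1) * (eps / (2 * (H + 1)))).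
      + apply Rmult_lt_compat_l; lra.
      + right; field; lra. }
  exists n0; intros n m Hn Hm.
  replace (u n - u m) with ((u n - u n0) - (u m - u n0)) by ring.
  apply Rle_lt_trans with (Rabs (u n - u n0) + Rabs (u m - u n0)).
  - unfold Rminus at 1; rewrite <- (Rabs_Ropp (u m - u n0)); apply Rabs_triang.
  - assert (A1 := Hb n Hn); assert (A2 := Hb m Hm); lra. }
assert (Hl := Lim_seq_correct' u Hex); split; [exact Hl |].
intros m.
assert (L1 : is_lim_seq (fun k => Rabs (u (k + m)%nat - u m))
               (Rabs (Lim_seq u - u m))).
{ apply (is_lim_seq_abs _ (Finite _)).
  apply is_lim_seq_minus'; [| apply is_lim_seq_const].
  now apply is_lim_seq_incr_n. }
exact (is_lim_seq_le _ _ _ _ (Hk m) L1 (is_lim_seq_const _)).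
Qed.

Fixpoint picard (N : nat) (B : nat -> nat -> R -> R) (eta : nat -> R) (t0 : R)
    (m : nat) (j : nat) (t : R) : R :=
  match m with
  | O => eta j
  | S m => eta j +
      RInt (fun tau => lin N (fun j k => B j k tau)
                         (fun k => picard N B eta t0 m k tau) j) t0 t
  end.

(** [Lim_seq] is total; on a short interval the iterates converge geometrically and this is their
    true limit. *)
Definition ode_sol (N : nat) (B : nat -> nat -> R -> R) (eta : nat -> R) (t0 : R)
    (j : nat) (t : R) : R :=
  Lim_seq (fun m => picard N B eta t0 m j t).

Section LinearODE.

Variables (N : nat) (B : nat -> nat -> R -> R) (eta : nat -> R) (t0 r C H : R).
Hypothesis r_pos : 0 < r.
Hypothesis C_pos : 0 <= C.
Hypothesis short : INR (S N) * C * r <= / 2.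
Hypothesis B_cont : forall j k t, (j <= N)%nat -> (k <= N)%nat ->
  Rabs (t - t0) < r -> continuity_pt (B j k) t.
Hypothesis B_bound : forall j k t, (j <= N)%nat -> (k <= N)%nat ->
  Rabs (t - t0) < r -> Rabs (B j k t) <= C.
Hypothesis eta_bound : forall k, (k <= N)%nat -> Rabs (eta k) <= H.

Let rhs (Y : nat -> R -> R) (j : nat) (t : R) : R :=
  lin N (fun j k => B j k t) (fun k => Y k t) j.

Let rhs_cont (Y : nat -> R -> R) (j : nat) (t : R) :
  (forall k, (k <= N)%nat -> continuity_pt (Y k) t) ->
  (j <= N)%nat -> Rabs (t - t0) < r -> continuity_pt (rhs Y j) t.
Proof.
intros HY Hj Ht.
apply (continuity_pt_finite_SF (fun k t => B j k t * Y k t)).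
intros k Hk; apply (continuity_pt_mult (B j k) (Y k)); auto.
Qed.

Let rhs_int (Y : nat -> R -> R) (j : nat) (t : R) :
  (forall k t, (k <= N)%nat -> Rabs (t - t0) < r -> continuity_pt (Y k) t) ->
  (j <= N)%nat -> Rabs (t - t0) < r ->
  is_derive (fun t => eta j + RInt (rhs Y j) t0 t) t (rhs Y j t).
Proof.
intros HY Hj Ht.
assert (Hc : forall t, Rabs (t - t0) < r -> continuous (rhs Y j) t).
{ intros u Hu; apply continuity_pt_filterlim, rhs_cont; auto. }
replace (rhs Y j t) with (0 + rhs Y j t) by ring.
apply (is_derive_plus (fun _ => eta j) (fun t => RInt (rhs Y j) t0 t)).
- apply (is_derive_const (eta j)).
- apply (is_derive_RInt (rhs Y j) _ t0 t); [| now apply Hc].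
  assert (Hd : 0 < r - Rabs (t - t0)) by lra.
  exists (mkposreal _ Hd); intros u Hu.
  change (Rabs (u - t) < r - Rabs (t - t0)) in Hu.
  apply (RInt_correct (V := R_CompleteNormedModule)), ex_RInt_continuous.
  intros z Hz; apply Hc.
  apply interval_segment with (3 := Hz); [now apply interval_center |].
  replace (u - t0) with ((u - t) + (t - t0)) by ring.
  apply Rle_lt_trans with (1 := Rabs_triang _ _); lra.
Qed.

Let Z := picard N B eta t0.

Let Z_center (m j : nat) : Z m j t0 = eta j.
Proof.
unfold Z; destruct m; simpl; [reflexivity |].
rewrite (RInt_point (V := R_CompleteNormedModule) t0); apply Rplus_0_r.
Qed.

Let Z_cont (m : nat) : forall k t, (k <= N)%nat -> Rabs (t - t0) < r ->
  continuity_pt (Z m k) t.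
Proof.
induction m as [| m IH]; intros k t Hk Ht.
- apply continuity_pt_const; intros u v; reflexivity.
- exact (is_derive_continuity_pt _ _ _ (rhs_int (Z m) k t IH Hk Ht)).
Qed.

Let Z_derive (m j : nat) (t : R) : (j <= N)%nat -> Rabs (t - t0) < r ->
  is_derive (Z (S m) j) t (rhs (Z m) j t).
Proof. intros Hj Ht; now apply (rhs_int (Z m) j t (Z_cont m)). Qed.

(** The derivative of a difference of iterates is the linear map applied to the previous difference,
    and [short] says that integrating it at least halves the bound. *)
Let Z_step (m : nat) : forall j t, (j <= N)%nat -> Rabs (t - t0) < r ->
  Rabs (Z (S m) j t - Z m j t) <= H / 2 ^ S m.
Proof.
assert (H0 : 0 <= H) by
  (apply Rle_trans with (2 := eta_bound 0%nat (Nat.le_0_l _)); apply Rabs_pos).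
assert (Hnc : 0 <= INR (S N) * C) by (apply Rmult_le_pos; auto using pos_INR).
assert (Hfin : forall M x, 0 <= M -> Rabs (x - t0) < r ->
          INR (S N) * C * M * Rabs (x - t0) <= M / 2).
{ intros M x HM Hx.
  assert (INR (S N) * C * Rabs (x - t0) <= / 2).
  { apply Rle_trans with (2 := short); apply Rmult_le_compat_l; lra. }
  nra. }
induction m as [| m IH]; intros j t Hj Ht.
- change (Z 0 j t) with (eta j); rewrite <- (Z_center 1 j).
  apply Rle_trans with (INR (S N) * C * H * Rabs (t - t0)).
  + apply (lipschitz_interval (Z 1 j) (rhs (Z 0) j) t0 r); auto.
    * intros u Hu; apply lin_bound; auto.
    * now apply interval_center.
  + simpl; rewrite Rmult_1_r; now apply Hfin.
- assert (P2 : 0 < 2 ^ S m) by (apply pow_lt; lra).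
  assert (H2 : 0 <= H / 2 ^ S m) by
    (apply Rmult_le_pos; [auto | left; now apply Rinv_0_lt_compat]).
  apply Rle_trans with (INR (S N) * C * (H / 2 ^ S m) * Rabs (t - t0)).
  (* All iterates equal [eta] at t0, so subtracting the difference there changes nothing and the
     Lipschitz estimate from t0 applies. *)
  + replace (Z (S (S m)) j t - Z (S m) j t)
      with ((Z (S (S m)) j t - Z (S m) j t) - (Z (S (S m)) j t0 - Z (S m) j t0))
      by (rewrite !Z_center; ring).
    apply (lipschitz_interval (fun t => Z (S (S m)) j t - Z (S m) j t)
             (fun t => rhs (Z (S m)) j t - rhs (Z m) j t) t0 r); auto.
    * intros u Hu.
      apply (is_derive_minus (Z (S (S m)) j) (Z (S m) j)); auto.
    * intros u Hu; unfold rhs; rewrite lin_minus; apply lin_bound; auto.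
    * now apply interval_center.
  + replace (H / 2 ^ S (S m)) with (H / 2 ^ S m / 2); [now apply Hfin |].
    change (2 ^ S (S m)) with (2 * 2 ^ S m); field; lra.
Qed.

Let Y := ode_sol N B eta t0.

Let Z_lim (j : nat) (t : R) : (j <= N)%nat -> Rabs (t - t0) < r ->
  is_lim_seq (fun m => Z m j t) (Y j t) /\
  forall m, Rabs (Y j t - Z m j t) <= H / 2 ^ m.
Proof.
intros Hj Ht; apply (geometric_limit (fun m => Z m j t) H).
intros m; now apply Z_step.
Qed.

Let cvu (M : R) (f : nat -> R -> R) (g : R -> R) :
  (forall m t, Rabs (t - t0) < r -> Rabs (g t - f m t) <= M / 2 ^ m) ->
  CVU f g t0 (mkposreal r r_pos).
Proof.
intros Hfg eps He.
assert (HM : 0 <= M).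
{ assert (A := Rle_trans _ _ _ (Rabs_pos _)
    (Hfg 0%nat t0 (interval_center t0 r r_pos))).
  simpl in A; lra. }
assert (He' : 0 < eps / (M + 1)) by (apply Rdiv_lt_0_compat; lra).
destruct (pow_lt_1_zero (/ 2)) with (2 := He') as [n0 Hn0];
  [rewrite Rabs_pos_eq; lra |].
exists n0; intros n t Hn Ht.
apply Rle_lt_trans with (1 := Hfg n t Ht).
assert (P2 : 0 < / 2 ^ n) by (apply Rinv_0_lt_compat, pow_lt; lra).
specialize (Hn0 n Hn); rewrite pow_inv, Rabs_pos_eq in Hn0 by lra.
apply Rle_lt_trans with ((M + 1) * / 2 ^ n); [apply Rmult_le_compat_r; lra |].
apply Rlt_le_trans with ((M + 1) * (eps / (M + 1))).
- apply Rmult_lt_compat_l; lra.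
- right; field; lra.
Qed.

Let Y_cont (j : nat) (t : R) : (j <= N)%nat -> Rabs (t - t0) < r ->
  continuity_pt (Y j) t.
Proof.
intros Hj Ht.
apply (CVU_continuity (fun m => Z m j) (Y j) t0 (mkposreal r r_pos)); auto.
apply cvu with (M := H); intros m u Hu; now apply Z_lim.
Qed.

Lemma ode_sol_center (j : nat) : ode_sol N B eta t0 j t0 = eta j.
Proof.
unfold ode_sol; rewrite (Lim_seq_ext _ (fun _ => eta j)).
- now rewrite Lim_seq_const.
- intros m; apply Z_center.
Qed.

(** The limit lies within H of the zeroth iterate, the constant [eta], itself bounded by H. *)
Lemma ode_sol_bound (j : nat) (t : R) : (j <= N)%nat -> Rabs (t - t0) < r ->
  Rabs (ode_sol N B eta t0 j t) <= 2 * H.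
Proof.
intros Hj Ht; destruct (Z_lim j t Hj Ht) as [_ HL].
specialize (HL 0%nat); simpl in HL.
replace (ode_sol N B eta t0 j t) with ((Y j t - eta j) + eta j) by (unfold Y; ring).
apply Rle_trans with (1 := Rabs_triang _ _).
assert (A := eta_bound j Hj).
change (Z 0 j t) with (eta j) in HL; lra.
Qed.

(** The derivative of iterate m + 1 is the right-hand side at iterate m, which converges uniformly;
    limit and derivative may therefore be exchanged. *)
Lemma ode_sol_derive (j : nat) (t : R) : (j <= N)%nat -> Rabs (t - t0) < r ->
  is_derive (ode_sol N B eta t0 j) t
    (lin N (fun j k => B j k t) (fun k => ode_sol N B eta t0 k t) j).
Proof.
intros Hj Ht; apply is_derive_Reals.
apply (derivable_pt_lim_CVU (fun m => Z (S m) j) (fun m => rhs (Z m) j)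
         (Y j) (rhs Y j) t t0 (mkposreal r r_pos)); auto.
- intros u m Hu; apply is_derive_Reals; now apply Z_derive.
- intros u Hu; apply is_lim_seq_Reals.
  apply (is_lim_seq_incr_1 (fun m => Z m j u)); now apply Z_lim.
- apply cvu with (M := INR (S N) * C * H).
  intros m u Hu; unfold rhs; rewrite lin_minus.
  replace (INR (S N) * C * H / 2 ^ m) with (INR (S N) * C * (H / 2 ^ m))
    by (field; apply pow_nonzero; lra).
  apply lin_bound; auto.
  intros k Hk; now apply Z_lim.
Qed.

End LinearODE.

(** * Flat linear systems in the plane *)


Lemma is_derive_Rmult (f g : R -> R) (t df dg : R) :
  is_derive f t df -> is_derive g t dg ->
  is_derive (fun u => f u * g u) t (df * g t + f t * dg).
Proof.
intros Hf Hg; apply (is_derive_mult f g t df dg Hf Hg); intros; apply Rmult_comm.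
Qed.

Lemma diff_pt_is_derive_x (f : scalar) (x y : R) :
  diff_pt f x y -> is_derive (fun t => f t y) x (ddx f x y).
Proof. intros Hf; exact (Derive_correct _ _ (diff_pt_x f x y Hf)). Qed.

Lemma diff_pt_is_derive_y (f : scalar) (x y : R) :
  diff_pt f x y -> is_derive (fun t => f x t) y (ddy f x y).
Proof. intros Hf; exact (Derive_correct _ _ (diff_pt_y f x y Hf)). Qed.

(** The mean value theorem for u |-> f(u) - u f'(s), whose derivative is at most C |u - s|; the
    sharp factor 1/2 is given up. *)
Lemma taylor1_interval (f f' f'' : R -> R) (t0 r C s t : R) :
  (forall t, Rabs (t - t0) < r -> is_derive f t (f' t)) ->
  (forall t, Rabs (t - t0) < r -> is_derive f' t (f'' t)) ->
  (forall t, Rabs (t - t0) < r -> Rabs (f'' t) <= C) ->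
  Rabs (s - t0) < r -> Rabs (t - t0) < r ->
  Rabs (f t - f s - (t - s) * f' s) <= C * Rabs (t - s) * Rabs (t - s).
Proof.
intros H1 H2 HC Hs Ht.
destruct (MVT_abs (fun u => f u - u * f' s) (fun u => f' u - f' s) s t)
  as (c & Hc & Hi).
- intros c Hc; apply is_derive_Reals.
  apply (is_derive_minus f (fun u => u * f' s)).
  + apply H1; now apply interval_segment with (3 := Hc).
  + auto_derive; [exact I | ring].
- replace (f t - f s - (t - s) * f' s)
    with (f t - t * f' s - (f s - s * f' s)) by ring.
  rewrite Hc; apply Rmult_le_compat_r; [apply Rabs_pos |].
  assert (Hcr := interval_segment _ _ _ _ _ Hs Ht Hi).
  apply Rle_trans with (1 := lipschitz_interval f' f'' t0 r C H2 HC s c Hs Hcr).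
  apply Rmult_le_compat_l.
  + apply Rle_trans with (2 := HC s Hs); apply Rabs_pos.
  + destruct Hi as [Hi1 Hi2]; unfold Rmin, Rmax in *.
    destruct (Rle_dec s t); unfold Rabs; repeat destruct Rcase_abs; lra.
Qed.

Lemma locally_2d_bounded_finite (Q : nat -> R -> R -> R -> Prop) (x y : R) (n : nat) :
  (forall k C C' u v, C <= C' -> Q k C u v -> Q k C' u v) ->
  (forall k, (k <= n)%nat -> exists C, locally_2d (Q k C) x y) ->
  exists C, locally_2d (fun u v => forall k, (k <= n)%nat -> Q k C u v) x y.
Proof.
intros Qm; induction n as [| n IH]; intros HQ.
- destruct (HQ 0%nat (le_n _)) as [C HC]; exists C.
  apply locally_2d_impl with (2 := HC); apply locally_2d_forall.
  intros u v H k Hk; now replace k with 0%nat by lia.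
- destruct IH as [C HC]; [intros; apply HQ; lia |].
  destruct (HQ (S n) (le_n _)) as [C' HC']; exists (Rmax C C').
  apply locally_2d_impl with (2 := locally_2d_and _ _ _ _ HC HC').
  apply locally_2d_forall; intros u v [H H'] k Hk.
  destruct (Nat.eq_dec k (S n)) as [-> | Hne].
  + apply Qm with (2 := H'), Rmax_r.
  + apply Qm with (2 := H k ltac:(lia)), Rmax_l.
Qed.

Lemma continuous_locally_bounded (f : scalar) (x y : R) :
  continuity_2d_pt f x y ->
  exists C, locally_2d (fun u v => Rabs (f u v) <= C) x y.
Proof.
intros Hf; exists (Rabs (f x y) + 1).
apply locally_2d_impl with (2 := Hf (mkposreal 1 Rlt_0_1)).
apply locally_2d_forall; intros u v H; simpl in H.
replace (f u v) with ((f u v - f x y) + f x y) by ring.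
apply Rle_trans with (1 := Rabs_triang _ _); lra.
Qed.

Lemma matrix_locally_bounded (N : nat) (A : nat -> nat -> scalar) (x y : R) :
  (forall j k, (j <= N)%nat -> (k <= N)%nat -> continuity_2d_pt (A j k) x y) ->
  exists C, locally_2d (fun u v =>
    forall j, (j <= N)%nat -> forall k, (k <= N)%nat -> Rabs (A j k u v) <= C) x y.
Proof.
intros HA.
apply (locally_2d_bounded_finite
  (fun j C u v => forall k, (k <= N)%nat -> Rabs (A j k u v) <= C)).
- intros j C C' u v HC H k Hk; specialize (H k Hk); lra.
- intros j Hj.
  apply (locally_2d_bounded_finite (fun k C u v => Rabs (A j k u v) <= C)).
  + intros; lra.
  + intros k Hk; now apply continuous_locally_bounded, HA.
Qed.

Definition at_pt (A : nat -> nat -> scalar) (x y : R) (j k : nat) : R := A j k x y.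

(** The matrix identity A_y + A B = B_x + B A tested on vectors: equality of the mixed derivatives
    of a solution of Y_x = A Y, Y_y = B Y. *)
Definition flat (V : R * R -> Prop) (N : nat) (A B : nat -> nat -> scalar) : Prop :=
  forall x y, V (x, y) -> forall (eta : nat -> R) j, (j <= N)%nat ->
    lin N (at_pt (fun j k => ddy (A j k)) x y) eta j
      + lin N (at_pt A x y) (lin N (at_pt B x y) eta) j
    = lin N (at_pt (fun j k => ddx (B j k)) x y) eta j
      + lin N (at_pt B x y) (lin N (at_pt A x y) eta) j.

Definition solves_at (N : nat) (A B : nat -> nat -> scalar) (Y : nat -> scalar)
    (x y : R) : Prop :=
  forall j, (j <= N)%nat ->
    ddx (Y j) x y = lin N (at_pt A x y) (fun k => Y k x y) j /\
    ddy (Y j) x y = lin N (at_pt B x y) (fun k => Y k x y) j.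

Lemma salg_sum (V : R * R -> Prop) (S : scalar -> Prop) (f : nat -> scalar) (n : nat) :
  (forall k, (k <= n)%nat -> salg V S (f k)) ->
  salg V S (fun x y => sum_f_R0 (fun k => f k x y) n).
Proof.
induction n as [| n IH]; intros Hf; simpl; [now apply Hf |].
apply salg_add; [apply IH; intros; apply Hf; lia | now apply Hf].
Qed.

(** A discrete product rule. The three remainders are the increment of y, the first-order Taylor
    remainder of b and the variation of b. *)
Lemma flat_increment (n : nat) (b' b db y' y w : nat -> R) (h : R) :
  sum_f_R0 (fun k => b' k * y' k) n - sum_f_R0 (fun k => b k * y k) n
    - h * (sum_f_R0 (fun k => db k * y k) n + sum_f_R0 (fun k => b k * w k) n)
  = sum_f_R0 (fun k => b' k * (y' k - y k - h * w k)) n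
    + sum_f_R0 (fun k => (b' k - b k - h * db k) * y k) n
    + h * sum_f_R0 (fun k => (b' k - b k) * w k) n.
Proof.
induction n as [| n IH]; simpl; [ring |].
apply Rminus_diag_eq in IH; apply Rminus_diag_uniq.
rewrite <- IH; ring.
Qed.

Section Frobenius.

Variables (V : R * R -> Prop) (N : nat) (A B : nat -> nat -> scalar) (x0 y0 : R).
Hypothesis oV : open V.
Hypothesis V0 : V (x0, y0).
Hypothesis A_smooth : forall j k, (j <= N)%nat -> (k <= N)%nat -> smooth_on V (A j k).
Hypothesis B_smooth : forall j k, (j <= N)%nat -> (k <= N)%nat -> smooth_on V (B j k).

Let bounds (r C : R) : Prop :=
  forall x y, box x0 y0 r (x, y) -> forall j k, (j <= N)%nat -> (k <= N)%nat ->
    Rabs (A j k x y) <= C /\ Rabs (B j k x y) <= C /\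
    Rabs (ddx (B j k) x y) <= C /\ Rabs (ddx (ddx (B j k)) x y) <= C.

Let good_box : exists r C, 0 < r /\ 0 <= C /\ INR (S N) * C * r <= / 2 /\
  (forall p, box x0 y0 r p -> V p) /\ bounds r C.
Proof.
assert (Hc : forall F : nat -> nat -> scalar,
  (forall j k, (j <= N)%nat -> (k <= N)%nat -> smooth_on V (F j k)) ->
  exists C, locally_2d (fun u v =>
    forall j, (j <= N)%nat -> forall k, (k <= N)%nat -> Rabs (F j k u v) <= C) x0 y0).
{ intros F HF; apply matrix_locally_bounded.
  intros j k Hj Hk; apply (smooth_diff_pt V (F j k) x0 y0); auto. }
destruct (Hc A A_smooth) as [C1 H1].
destruct (Hc B B_smooth) as [C2 H2].
destruct (Hc (fun j k => ddx (B j k))) as [C3 H3].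
{ intros; apply smooth_ddx; auto. }
destruct (Hc (fun j k => ddx (ddx (B j k)))) as [C4 H4].
{ intros; do 2 apply smooth_ddx; auto. }
assert (H := locally_2d_and _ _ _ _ (locally_2d_and _ _ _ _ H1 H2)
               (locally_2d_and _ _ _ _ (locally_2d_and _ _ _ _ H3 H4)
                  (open_locally_2d V x0 y0 oV V0))).
apply box_locally_2d in H; destruct H as (r & Hr & H).
set (C := Rabs C1 + Rabs C2 + Rabs C3 + Rabs C4).
assert (P1 := Rabs_pos C1); assert (P2 := Rabs_pos C2).
assert (P3 := Rabs_pos C3); assert (P4 := Rabs_pos C4).
assert (Q1 := Rle_abs C1); assert (Q2 := Rle_abs C2).
assert (Q3 := Rle_abs C3); assert (Q4 := Rle_abs C4).
assert (HN : 0 < INR (S N)) by (apply lt_0_INR; lia).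
assert (HC0 : 0 <= C) by (unfold C; lra).
assert (HL : 0 < 2 * (INR (S N) * C + 1)) by nra.
(* The second radius makes the interval short enough for Picard iteration and [gronwall_short]; the
   added 1 covers C = 0. *)
exists (Rmin r (/ (2 * (INR (S N) * C + 1)))), C.
assert (Rl := Rmin_l r (/ (2 * (INR (S N) * C + 1)))).
assert (Rr := Rmin_r r (/ (2 * (INR (S N) * C + 1)))).
split; [apply Rmin_glb_lt; [auto | now apply Rinv_0_lt_compat] |].
split; [exact HC0 |].
split; [| split].
- apply Rle_trans with (INR (S N) * C * (/ (2 * (INR (S N) * C + 1)))).
  + apply Rmult_le_compat_l; [nra | exact Rr].
  + apply Rmult_le_reg_r with (1 := HL).
    rewrite Rmult_assoc, Rinv_l by lra; lra.
- intros [x y] Hp; apply (H x y); now apply box_monotone with (1 := Rl).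
- intros x y Hp j k Hj Hk.
  destruct (H x y) as [[G1 G2] [[G3 G4] _]];
    [now apply box_monotone with (1 := Rl) |].
  specialize (G1 j Hj k Hk); specialize (G2 j Hj k Hk).
  specialize (G3 j Hj k Hk); specialize (G4 j Hj k Hk); unfold C.
  split; [| split; [| split]]; lra.
Qed.

(** Along y = y0, and then along each vertical segment, Y solves a homogeneous linear equation with
    initial value 0, so [gronwall_short] applies with e = s = 0. *)
Lemma frobenius_unique (Y : nat -> scalar) :
  locally_2d (fun x y => (forall j, (j <= N)%nat -> diff_pt (Y j) x y) /\
                         solves_at N A B Y x y) x0 y0 ->
  (forall j, (j <= N)%nat -> Y j x0 y0 = 0) ->
  locally_2d (fun x y => forall j, (j <= N)%nat -> Y j x y = 0) x0 y0.
Proof.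
intros HY HY0.
destruct good_box as (r1 & C & r1_pos & C_pos & short & HV & Hb).
assert (HM : exists M, locally_2d (fun u v =>
                forall j, (j <= N)%nat -> Rabs (Y j u v) <= M) x0 y0).
{ apply (locally_2d_bounded_finite (fun j M u v => Rabs (Y j u v) <= M)).
  - intros; lra.
  - intros j Hj; apply continuous_locally_bounded.
    apply locally_2d_singleton in HY; now apply HY. }
destruct HM as [M HM].
assert (H := locally_2d_and _ _ _ _ HY HM).
apply box_locally_2d in H; destruct H as (r2 & r2_pos & H).
assert (Rl := Rmin_l r1 r2); assert (Rr := Rmin_r r1 r2).
set (r := Rmin r1 r2) in *.
assert (r_pos : 0 < r) by (apply Rmin_glb_lt; auto).
assert (HN : 0 <= INR (S N) * C) by (apply Rmult_le_pos; auto using pos_INR).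
assert (short' : INR (S N) * C * r <= / 2).
{ apply Rle_trans with (2 := short); apply Rmult_le_compat_l; auto. }
assert (Hb' : forall x y, box x0 y0 r (x, y) ->
  (forall j, (j <= N)%nat -> diff_pt (Y j) x y) /\ solves_at N A B Y x y /\
  (forall j, (j <= N)%nat -> Rabs (Y j x y) <= M) /\
  forall j k, (j <= N)%nat -> (k <= N)%nat ->
    Rabs (A j k x y) <= C /\ Rabs (B j k x y) <= C).
{ intros x y Hp.
  destruct (H x y) as [[G1 G2] G3]; [now apply box_monotone with (1 := Rr) |].
  split; [exact G1 | split; [exact G2 | split; [exact G3 |]]].
  intros j k Hj Hk; destruct (Hb x y) with (j := j) (k := k) as (? & ? & _); auto.
  now apply box_monotone with (1 := Rl). }
apply box_locally_2d; exists r; split; [exact r_pos |].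
assert (Hx : forall j x, (j <= N)%nat -> Rabs (x - x0) < r -> Y j x y0 = 0).
{ assert (Hin : forall x, Rabs (x - x0) < r -> box x0 y0 r (x, y0)).
  { intros x Hx; split; [exact Hx | now apply interval_center]. }
  intros j x Hj Hx.
  assert (G := gronwall_short N (fun j x => Y j x y0) (fun j x => ddx (Y j) x y0)
    x0 r (INR (S N) * C) 0 0 M (Rle_refl _) HN short').
  simpl in G.
  assert (Rabs (Y j x y0) <= 2 * (0 + 0 * r)).
  { apply G; auto.
    - intros k t Hk Ht; apply diff_pt_is_derive_x; now apply Hb'; [apply Hin |].
    - intros M' t k Ht HM' Hk; destruct (Hb' t y0 (Hin t Ht)) as (_ & Hs & _ & HAB).
      destruct (Hs k Hk) as [-> _]; rewrite Rplus_0_r; apply lin_bound; auto.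
      intros i Hi; now apply HAB.
    - intros k Hk; rewrite HY0, Rabs_R0 by auto; lra.
    - intros k t Hk Ht; now apply (Hb' t y0 (Hin t Ht)). }
  apply Rabs_eq_0, Rle_antisym; [lra | apply Rabs_pos]. }
intros x y [Hpx Hpy] j Hj; simpl in Hpx, Hpy.
assert (Hin : forall t, Rabs (t - y0) < r -> box x0 y0 r (x, t)) by now split.
assert (G := gronwall_short N (fun j t => Y j x t) (fun j t => ddy (Y j) x t)
  y0 r (INR (S N) * C) 0 0 M (Rle_refl _) HN short').
simpl in G.
assert (Rabs (Y j x y) <= 2 * (0 + 0 * r)).
{ apply G; auto.
  - intros k t Hk Ht; apply diff_pt_is_derive_y; now apply Hb'; [apply Hin |].
  - intros M' t k Ht HM' Hk; destruct (Hb' x t (Hin t Ht)) as (_ & Hs & _ & HAB).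
    destruct (Hs k Hk) as [_ ->]; rewrite Rplus_0_r; apply lin_bound; auto.
    intros i Hi; now apply HAB.
  - intros k Hk; rewrite Hx, Rabs_R0 by auto; lra.
  - intros k t Hk Ht; now apply (Hb' x t (Hin t Ht)). }
apply Rabs_eq_0, Rle_antisym; [lra | apply Rabs_pos].
Qed.

(* The solution is obtained by integrating in x along y = y0, then in y; flatness
   bounds the y-derivative of Y(x + h, y) - Y(x, y) - h (A Y)(x, y) by a multiple of
   this quantity plus O(h^2), so that it is o(h). *)
Section Existence.

Variable eta : nat -> R.
Hypothesis AB_flat : flat V N A B.

Variables r C : R.
Hypothesis r_pos : 0 < r.
Hypothesis C_pos : 0 <= C.
Hypothesis short : INR (S N) * C * r <= / 2.
Hypothesis HV : forall p, box x0 y0 r p -> V p.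
Hypothesis Hb : bounds r C.

Let H := sum_f_R0 (fun k => Rabs (eta k)) N.

Let eta_bound (k : nat) : (k <= N)%nat -> Rabs (eta k) <= H.
Proof.
intros Hk; unfold H; clear - Hk.
induction N as [| n IH]; simpl.
- replace k with 0%nat by lia; lra.
- assert (P := Rabs_pos (eta (S n))).
  destruct (Nat.eq_dec k (S n)) as [-> | Hne].
  + assert (0 <= sum_f_R0 (fun k => Rabs (eta k)) n)
      by (apply cond_pos_sum; intros; apply Rabs_pos); lra.
  + assert (A1 := IH ltac:(lia)); lra.
Qed.

Let a (j : nat) (x : R) : R := ode_sol N (fun j k x => A j k x y0) eta x0 j x.

Let Y (j : nat) : scalar := fun x y =>
  ode_sol N (fun j k y => B j k x y) (fun k => a k x) y0 j y.

Let box_mk (x y : R) : Rabs (x - x0) < r -> Rabs (y - y0) < r -> box x0 y0 r (x, y).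
Proof. now split. Qed.

Let y0_in : Rabs (y0 - y0) < r.
Proof. now apply interval_center. Qed.

Let A_diff (j k : nat) (x y : R) : (j <= N)%nat -> (k <= N)%nat ->
  Rabs (x - x0) < r -> Rabs (y - y0) < r -> diff_pt (A j k) x y.
Proof. intros; apply (smooth_diff_pt V); auto. Qed.

Let B_diff (j k : nat) (x y : R) : (j <= N)%nat -> (k <= N)%nat ->
  Rabs (x - x0) < r -> Rabs (y - y0) < r -> diff_pt (B j k) x y.
Proof. intros; apply (smooth_diff_pt V); auto. Qed.

Let A_cont (j k : nat) (x : R) : (j <= N)%nat -> (k <= N)%nat ->
  Rabs (x - x0) < r -> continuity_pt (fun x => A j k x y0) x.
Proof.
intros; apply is_derive_continuity_pt with (l := ddx (A j k) x y0).
apply diff_pt_is_derive_x; auto.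
Qed.

Let B_cont (x : R) (j k : nat) (y : R) : Rabs (x - x0) < r ->
  (j <= N)%nat -> (k <= N)%nat ->
  Rabs (y - y0) < r -> continuity_pt (fun y => B j k x y) y.
Proof.
intros; apply is_derive_continuity_pt with (l := ddy (B j k) x y).
apply diff_pt_is_derive_y; auto.
Qed.

Let a_bound (k : nat) (x : R) :
  (k <= N)%nat -> Rabs (x - x0) < r -> Rabs (a k x) <= 2 * H.
Proof.
intros Hk Hx; apply (ode_sol_bound N _ eta x0 r C H); auto.
intros i j t Hi Hj Ht; apply (Hb t y0); auto.
Qed.

Let a_derive (k : nat) (x : R) : (k <= N)%nat -> Rabs (x - x0) < r ->
  is_derive (a k) x (lin N (at_pt A x y0) (fun k => a k x) k).
Proof.
intros Hk Hx; apply (ode_sol_derive N (fun j k x => A j k x y0) eta x0 r C H); auto.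
intros i j t Hi Hj Ht; apply (Hb t y0); auto.
Qed.

Let Y_y0 (k : nat) (x : R) : Y k x y0 = a k x.
Proof. unfold Y; now rewrite ode_sol_center. Qed.

Let Y_bound (k : nat) (x y : R) : (k <= N)%nat ->
  Rabs (x - x0) < r -> Rabs (y - y0) < r -> Rabs (Y k x y) <= 4 * H.
Proof.
intros Hk Hx Hy; replace (4 * H) with (2 * (2 * H)) by ring.
apply (ode_sol_bound N _ (fun k => a k x) y0 r C (2 * H)); auto.
intros i j t Hi Hj Ht; apply (Hb x t); auto.
Qed.

Let Y_derive_y (k : nat) (x y : R) : (k <= N)%nat ->
  Rabs (x - x0) < r -> Rabs (y - y0) < r ->
  is_derive (fun t => Y k x t) y (lin N (at_pt B x y) (fun k => Y k x y) k).
Proof.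
intros Hk Hx Hy.
apply (ode_sol_derive N (fun j k y => B j k x y) (fun k => a k x) y0 r C (2 * H)); auto.
intros i j t Hi Hj Ht; apply (Hb x t); auto.
Qed.

(** The step where flatness enters: the product rule gives A_y Y + A B Y, which is traded for B_x Y
    + B A Y, the linear part in h of the variation of B Y. *)
Let AY_derive_y (j : nat) (x y : R) : (j <= N)%nat ->
  Rabs (x - x0) < r -> Rabs (y - y0) < r ->
  is_derive (fun t => lin N (at_pt A x t) (fun k => Y k x t) j) y
    (lin N (at_pt (fun j k => ddx (B j k)) x y) (fun k => Y k x y) j
     + lin N (at_pt B x y) (lin N (at_pt A x y) (fun k => Y k x y)) j).
Proof.
intros Hj Hx Hy; rewrite <- (AB_flat x y); auto.
unfold lin at 2 3; rewrite <- plus_sum.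
apply (is_derive_sum (fun k t => A j k x t * Y k x t)).
intros k Hk; apply (is_derive_Rmult (fun t => A j k x t) (fun t => Y k x t)).
- apply diff_pt_is_derive_y; auto.
- apply Y_derive_y; auto.
Qed.

Let increment (x h : R) (j : nat) (t : R) : R :=
  Y j (x + h) t - Y j x t - h * lin N (at_pt A x t) (fun k => Y k x t) j.

Let H_pos : 0 <= H.
Proof.
apply Rle_trans with (2 := eta_bound 0%nat (Nat.le_0_l _)); apply Rabs_pos.
Qed.

Let L_pos : 0 <= INR (S N) * C.
Proof. apply Rmult_le_pos; auto using pos_INR. Qed.

(** The coefficient of h^2 in the y-derivative of the increment: the Taylor remainder of B against
    Y, plus the variation of B against A Y, with Y bounded by 4 H. *)
Let kappa := INR (S N) * C * (4 * H) + INR (S N) * C * (INR (S N) * C * (4 * H)).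

Let increment_bound (x h e : R) (j : nat) (y : R) : (j <= N)%nat ->
  Rabs (x - x0) < r -> Rabs (x + h - x0) < r -> Rabs (y - y0) < r ->
  (forall k, (k <= N)%nat -> Rabs (increment x h k y0) <= e) ->
  Rabs (increment x h j y) <= 2 * (e + Rabs h * Rabs h * kappa * r).
Proof.
intros Hj Hx Hxh Hy He.
assert (AYb : forall k t, (k <= N)%nat -> Rabs (t - y0) < r ->
  Rabs (lin N (at_pt A x t) (fun k => Y k x t) k) <= INR (S N) * C * (4 * H)).
{ intros k t Hk Ht; apply lin_bound; auto.
  intros i Hi; apply (Hb x t); auto. }
refine (gronwall_short N (increment x h)
  (fun j t => lin N (at_pt B (x + h) t) (fun k => Y k (x + h) t) j
     - lin N (at_pt B x t) (fun k => Y k x t) j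
     - h * (lin N (at_pt (fun j k => ddx (B j k)) x t) (fun k => Y k x t) j
            + lin N (at_pt B x t) (lin N (at_pt A x t) (fun k => Y k x t)) j))
  y0 r (INR (S N) * C) e (Rabs h * Rabs h * kappa)
  (* A crude bound on the increment, which makes its supremum finite. *)
  (4 * H + 4 * H + Rabs h * (INR (S N) * C * (4 * H)))
  _ L_pos short _ _ He _ j y Hj Hy).
- unfold kappa; apply Rmult_le_pos; [apply Rmult_le_pos; apply Rabs_pos |].
  assert (0 <= INR (S N) * C * (4 * H)) by (apply Rmult_le_pos; lra).
  assert (0 <= INR (S N) * C * (INR (S N) * C * (4 * H)))
    by (apply Rmult_le_pos; lra).
  lra.
- intros k t Hk Ht; unfold increment.
  apply (is_derive_minus (fun t => Y k (x + h) t - Y k x t)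
           (fun t => h * lin N (at_pt A x t) (fun k => Y k x t) k)).
  + apply (is_derive_minus (fun t => Y k (x + h) t) (fun t => Y k x t));
      apply Y_derive_y; auto.
  + apply (is_derive_scal (fun t => lin N (at_pt A x t) (fun k => Y k x t) k) t h).
    apply AY_derive_y; auto.
- intros M t k Ht HM Hk.
  (* The three summands are bounded by [B1], [B2], [B3]: the first is linear in the increment
     itself, the other two are of order h^2. *)
  assert (F := flat_increment N (at_pt B (x + h) t k) (at_pt B x t k)
    (at_pt (fun j k => ddx (B j k)) x t k)
    (fun k => Y k (x + h) t) (fun k => Y k x t)
    (lin N (at_pt A x t) (fun k => Y k x t)) h).
  unfold lin at 1 2 3 4; rewrite F; clear F.
  apply Rle_trans with (1 := Rabs_triang _ _).
  assert (B1 : Rabs (sum_f_R0 (fun i => at_pt B (x + h) t k i *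
      (Y i (x + h) t - Y i x t
        - h * lin N (at_pt A x t) (fun k => Y k x t) i)) N) <= INR (S N) * C * M).
  { apply (lin_bound N (at_pt B (x + h) t) (fun i => increment x h i t)); auto.
    intros i Hi; apply (Hb (x + h) t); auto. }
  assert (B2 : Rabs (sum_f_R0 (fun i => (at_pt B (x + h) t k i - at_pt B x t k i
      - h * at_pt (fun j k => ddx (B j k)) x t k i) * Y i x t) N)
      <= INR (S N) * (C * Rabs h * Rabs h) * (4 * H)).
  { apply (lin_bound N (fun k i => at_pt B (x + h) t k i - at_pt B x t k i
      - h * at_pt (fun j k => ddx (B j k)) x t k i) (fun i => Y i x t)); auto.
    intros i Hi; unfold at_pt.
    replace h with (x + h - x) at 2 3 4 by ring.
    apply (taylor1_interval (fun s => B k i s t) (fun s => ddx (B k i) s t)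
             (fun s => ddx (ddx (B k i)) s t) x0 r C x (x + h)); auto.
    - intros s Hs; apply diff_pt_is_derive_x; auto.
    - intros s Hs; apply diff_pt_is_derive_x, (smooth_diff_pt V); auto.
      apply smooth_ddx; auto.
    - intros s Hs; apply (Hb s t); auto. }
  assert (B3 : Rabs (sum_f_R0 (fun i => (at_pt B (x + h) t k i - at_pt B x t k i)
      * lin N (at_pt A x t) (fun k => Y k x t) i) N)
      <= INR (S N) * (C * Rabs h) * (INR (S N) * C * (4 * H))).
  { apply (lin_bound N (fun k i => at_pt B (x + h) t k i - at_pt B x t k i)); auto.
    intros i Hi; unfold at_pt.
    replace h with (x + h - x) at 2 by ring.
    apply (lipschitz_interval (fun s => B k i s t) (fun s => ddx (B k i) s t) x0 r);
      auto.
    - intros s Hs; apply diff_pt_is_derive_x; auto.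
    - intros s Hs; apply (Hb s t); auto. }
  assert (T := Rabs_triang
    (sum_f_R0 (fun i => at_pt B (x + h) t k i *
      (Y i (x + h) t - Y i x t
        - h * lin N (at_pt A x t) (fun k => Y k x t) i)) N)
    (sum_f_R0 (fun i => (at_pt B (x + h) t k i - at_pt B x t k i
      - h * at_pt (fun j k => ddx (B j k)) x t k i) * Y i x t) N)).
  rewrite Rabs_mult.
  assert (B3' := Rmult_le_compat_l _ _ _ (Rabs_pos h) B3).
  unfold kappa; lra.
- intros k t Hk Ht; unfold increment.
  assert (Y1 := Y_bound k (x + h) t Hk Hxh Ht).
  assert (Y2 := Y_bound k x t Hk Hx Ht).
  assert (Y3 := Rmult_le_compat_l _ _ _ (Rabs_pos h) (AYb k t Hk Ht)).
  rewrite <- Rabs_mult in Y3.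
  apply Rle_trans with (1 := Rabs_triang _ _); rewrite Rabs_Ropp.
  assert (T := Rabs_triang (Y k (x + h) t) (- Y k x t)); rewrite Rabs_Ropp in T.
  unfold Rminus at 1; lra.
Qed.

Let Y_derive_x (j : nat) (x y : R) : (j <= N)%nat ->
  Rabs (x - x0) < r -> Rabs (y - y0) < r ->
  is_derive (fun t => Y j t y) x (lin N (at_pt A x y) (fun k => Y k x y) j).
Proof.
intros Hj Hx Hy; apply is_derive_Reals; intros eps Heps.
(* On y = y0 the increment is o(h) because the initial curve [a] solves the equation in x. The 8
   leaves room for the factor 2 of [increment_bound] and for the h^2 term. *)
assert (Hinit : exists d : posreal, forall k, (k <= N)%nat -> forall h,
          Rabs h < d -> Rabs (increment x h k y0) <= eps / 8 * Rabs h).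
{ assert (P : forall k, (k <= N)%nat -> exists d : posreal, forall h,
            Rabs h < d -> Rabs (increment x h k y0) <= eps / 8 * Rabs h).
  { intros k Hk; assert (D := a_derive k x Hk Hx).
    apply is_derive_Reals in D.
    destruct (D (eps / 8)) as [d Hd]; [lra |].
    exists d; intros h Hh.
    destruct (Req_dec h 0) as [-> | hne].
    - unfold increment; rewrite Rplus_0_r, Rmult_0_l, Rminus_diag, Rminus_0_r, Rabs_R0.
      lra.
    - specialize (Hd h hne Hh).
      replace (increment x h k y0) with
        (((a k (x + h) - a k x) / h - lin N (at_pt A x y0) (fun k => a k x) k) * h).
      + rewrite Rabs_mult; apply Rmult_le_compat_r; [apply Rabs_pos | lra].
      + unfold increment; rewrite !Y_y0.
        rewrite (lin_ext N _ (fun k => Y k x y0) (fun k => a k x))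
          by (intros; apply Y_y0).
        field; exact hne. }
  revert P; generalize N; intros n P; induction n as [| n IH].
  - destruct (P 0%nat (le_n _)) as [d Hd]; exists d.
    intros k Hk; now replace k with 0%nat by lia.
  - destruct IH as [d Hd]; [intros; apply P; lia |].
    destruct (P (S n) (le_n _)) as [d' Hd'].
    assert (Hm : 0 < Rmin d d') by (apply Rmin_glb_lt; apply cond_pos).
    exists (mkposreal _ Hm); simpl; intros k Hk h Hh.
    assert (M1 := Rmin_l d d'); assert (M2 := Rmin_r d d').
    destruct (Nat.eq_dec k (S n)) as [-> | Hne].
    + apply Hd'; lra.
    + apply Hd; [lia | lra]. }
destruct Hinit as [d Hd].
assert (kappa_pos : 0 <= kappa).
{ unfold kappa.
  assert (0 <= INR (S N) * C * (4 * H)) by (apply Rmult_le_pos; lra).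
  assert (0 <= INR (S N) * C * (INR (S N) * C * (4 * H)))
    by (apply Rmult_le_pos; lra).
  lra. }
assert (kr_pos : 0 <= kappa * r) by (apply Rmult_le_pos; lra).
assert (Hden : 0 < 8 * (kappa * r + 1)) by lra.
(* Ensures |h| kappa r <= eps / 8, so that the whole bound is at most (eps / 2) |h|. *)
set (d2 := eps / (8 * (kappa * r + 1))).
assert (d2_pos : 0 < d2) by (apply Rdiv_lt_0_compat; auto).
assert (d3_pos : 0 < r - Rabs (x - x0)) by lra.
assert (Hm : 0 < Rmin d (Rmin d2 (r - Rabs (x - x0)))).
{ apply Rmin_glb_lt; [apply cond_pos | now apply Rmin_glb_lt]. }
exists (mkposreal _ Hm); simpl; intros h hne Hh.
assert (M1 := Rmin_l d (Rmin d2 (r - Rabs (x - x0)))).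
assert (M2 := Rmin_r d (Rmin d2 (r - Rabs (x - x0)))).
assert (M3 := Rmin_l d2 (r - Rabs (x - x0))).
assert (M4 := Rmin_r d2 (r - Rabs (x - x0))).
assert (Hxh : Rabs (x + h - x0) < r).
{ replace (x + h - x0) with (h + (x - x0)) by ring.
  apply Rle_lt_trans with (1 := Rabs_triang _ _); lra. }
assert (I := increment_bound x h (eps / 8 * Rabs h) j y Hj Hx Hxh Hy
  (fun k Hk => Hd k Hk h ltac:(lra))).
replace ((Y j (x + h) y - Y j x y) / h - lin N (at_pt A x y) (fun k => Y k x y) j)
  with (increment x h j y / h) by (unfold increment; field; exact hne).
assert (h_pos : 0 < Rabs h) by now apply Rabs_pos_lt.
unfold Rdiv; rewrite Rabs_mult, Rabs_inv.
apply Rmult_lt_reg_r with (1 := h_pos).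
rewrite Rmult_assoc, Rinv_l, Rmult_1_r by lra.
apply Rle_lt_trans with (1 := I).
assert (K : Rabs h * (kappa * r) <= eps / 8).
{ apply Rle_trans with (d2 * (kappa * r + 1)).
  - apply Rmult_le_compat; lra.
  - right; unfold d2; field; lra. }
assert (Rabs h * (Rabs h * (kappa * r)) <= Rabs h * (eps / 8))
  by (apply Rmult_le_compat_l; lra).
assert (0 < eps * Rabs h) by (apply Rmult_lt_0_compat; auto).
lra.
Qed.

Let Y_solves (x y : R) : box x0 y0 r (x, y) -> solves_at N A B Y x y.
Proof.
intros [Hx Hy] j Hj; split; apply is_derive_unique;
  [apply Y_derive_x | apply Y_derive_y]; auto.
Qed.

(** Both partial derivatives are bounded by the same K on the box, so Y is Lipschitz there. *)
Let Y_cont (j : nat) (x y : R) : (j <= N)%nat -> box x0 y0 r (x, y) ->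
  continuity_2d_pt (Y j) x y.
Proof.
intros Hj [Hx Hy] eps; simpl in Hx, Hy.
set (K := INR (S N) * C * (4 * H)).
assert (K_pos : 0 <= K) by (apply Rmult_le_pos; lra).
assert (e_pos := cond_pos eps).
assert (d1 : 0 < eps / (2 * (K + 1))) by (apply Rdiv_lt_0_compat; lra).
assert (Hd : 0 < Rmin (eps / (2 * (K + 1)))
  (Rmin (r - Rabs (x - x0)) (r - Rabs (y - y0)))).
{ apply Rmin_glb_lt; [exact d1 | apply Rmin_glb_lt; lra]. }
exists (mkposreal _ Hd); simpl; intros u v Hu Hv.
assert (M1 := Rmin_l (eps / (2 * (K + 1)))
  (Rmin (r - Rabs (x - x0)) (r - Rabs (y - y0)))).
assert (M2 := Rmin_r (eps / (2 * (K + 1)))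
  (Rmin (r - Rabs (x - x0)) (r - Rabs (y - y0)))).
assert (M3 := Rmin_l (r - Rabs (x - x0)) (r - Rabs (y - y0))).
assert (M4 := Rmin_r (r - Rabs (x - x0)) (r - Rabs (y - y0))).
assert (Hu0 : Rabs (u - x0) < r).
{ replace (u - x0) with ((u - x) + (x - x0)) by ring.
  apply Rle_lt_trans with (1 := Rabs_triang _ _); lra. }
assert (Hv0 : Rabs (v - y0) < r).
{ replace (v - y0) with ((v - y) + (y - y0)) by ring.
  apply Rle_lt_trans with (1 := Rabs_triang _ _); lra. }
assert (L1 : Rabs (Y j u v - Y j x v) <= K * Rabs (u - x)).
{ apply (lipschitz_interval (fun s => Y j s v)
    (fun s => lin N (at_pt A s v) (fun k => Y k s v) j) x0 r); auto.
  intros s Hs; apply lin_bound; auto.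
  intros k Hk; apply (Hb s v); auto. }
assert (L2 : Rabs (Y j x v - Y j x y) <= K * Rabs (v - y)).
{ apply (lipschitz_interval (fun s => Y j x s)
    (fun s => lin N (at_pt B x s) (fun k => Y k x s) j) y0 r); auto.
  intros s Hs; apply lin_bound; auto.
  intros k Hk; apply (Hb x s); auto. }
replace (Y j u v - Y j x y) with ((Y j u v - Y j x v) + (Y j x v - Y j x y)) by ring.
apply Rle_lt_trans with (1 := Rabs_triang _ _).
assert (E : (K + 1) * (eps / (2 * (K + 1))) = eps / 2) by (field; lra).
assert (K * Rabs (u - x) <= K * (eps / (2 * (K + 1)))) by (apply Rmult_le_compat_l; lra).
assert (K * Rabs (v - y) <= K * (eps / (2 * (K + 1)))) by (apply Rmult_le_compat_l; lra).
lra.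
Qed.

(** The components of Y are added to the smooth functions as generators; their derivatives are
    linear combinations of themselves with smooth coefficients, so the closure is stable under
    differentiation. *)
Let Y_smooth (j : nat) : (j <= N)%nat -> smooth_on (box x0 y0 r) (Y j).
Proof.
intros Hj.
set (gen := fun f : scalar => smooth_on (box x0 y0 r) f \/
                              exists k, (k <= N)%nat /\ f = Y k).
assert (Hlin : forall M : nat -> nat -> scalar,
  (forall j k, (j <= N)%nat -> (k <= N)%nat -> smooth_on V (M j k)) ->
  forall k, (k <= N)%nat ->
  salg (box x0 y0 r) gen (fun x y => lin N (at_pt M x y) (fun k => Y k x y) k)).
{ intros M HM k Hk; unfold lin, at_pt.
  apply (salg_sum (box x0 y0 r) gen (fun i x y => M k i x y * Y i x y)).
  intros i Hi; apply salg_mul; apply salg_gen.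
  - left; apply (smooth_on_subset V); auto.
  - right; now exists i. }
apply (salg_smooth (box x0 y0 r) gen).
- apply open_box.
- intros f [Hf | [k [Hk ->]]] x y Hxy; [now apply smooth_diff_pt with (1 := Hf) |].
  split; [now apply Y_cont | split].
  + eexists; apply Y_derive_x; auto; apply Hxy.
  + eexists; apply Y_derive_y; auto; apply Hxy.
- intros f [Hf | [k [Hk ->]]].
  + apply salg_gen; left; now apply smooth_ddx.
  + apply salg_ext with (2 := Hlin A A_smooth k Hk).
    intros x y Hxy; symmetry; now apply Y_solves.
- intros f [Hf | [k [Hk ->]]].
  + apply salg_gen; left; now apply smooth_ddy.
  + apply salg_ext with (2 := Hlin B B_smooth k Hk).
    intros x y Hxy; symmetry; now apply Y_solves.
- apply salg_gen; right; now exists j.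
Qed.

Lemma frobenius_exists_box :
  (forall j, (j <= N)%nat -> smooth_on (box x0 y0 r) (Y j)) /\
  (forall j, (j <= N)%nat -> Y j x0 y0 = eta j) /\
  (forall x y, box x0 y0 r (x, y) -> solves_at N A B Y x y).
Proof.
split; [exact Y_smooth | split; [| exact Y_solves]].
intros j Hj; rewrite Y_y0; apply ode_sol_center.
Qed.

End Existence.

Lemma frobenius_exists (eta : nat -> R) : flat V N A B ->
  exists (Y : nat -> scalar) (r : R), 0 < r /\
    (forall p, box x0 y0 r p -> V p) /\
    (forall j, (j <= N)%nat -> smooth_on (box x0 y0 r) (Y j)) /\
    (forall j, (j <= N)%nat -> Y j x0 y0 = eta j) /\
    (forall x y, box x0 y0 r (x, y) -> solves_at N A B Y x y).
Proof.
intros AB_flat.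
destruct good_box as (r & C & r_pos & C_pos & short & HV & Hb).
eexists; exists r; split; [exact r_pos | split; [exact HV |]].
exact (frobenius_exists_box eta AB_flat r C r_pos C_pos short HV Hb).
Qed.

End Frobenius.

(** * The Chern connection *)


(** Relational, unlike [ddx] and [ddy]: differentiability travels with the values, and the rules
    below compose without side conditions on it. *)
Definition pder (f : scalar) (x y dx dy : R) : Prop :=
  is_derive (fun t => f t y) x dx /\ is_derive (fun t => f x t) y dy.

Lemma pder_ddx (f : scalar) (x y dx dy : R) : pder f x y dx dy -> ddx f x y = dx.
Proof. intros [H _]; now apply is_derive_unique. Qed.

Lemma pder_ddy (f : scalar) (x y dx dy : R) : pder f x y dx dy -> ddy f x y = dy.
Proof. intros [_ H]; now apply is_derive_unique. Qed.

Lemma diff_pt_pder (f : scalar) (x y : R) :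
  diff_pt f x y -> pder f x y (ddx f x y) (ddy f x y).
Proof. split; [now apply diff_pt_is_derive_x | now apply diff_pt_is_derive_y]. Qed.

Lemma smooth_pder (V : R * R -> Prop) (f : scalar) (x y : R) :
  smooth_on V f -> V (x, y) -> pder f x y (ddx f x y) (ddy f x y).
Proof. intros Hf Vxy; now apply diff_pt_pder, (smooth_diff_pt V). Qed.

Lemma pder_const (c x y : R) : pder (fun _ _ => c) x y 0 0.
Proof. split; apply (is_derive_const c). Qed.

Lemma pder_add (f g : scalar) (x y fx fy gx gy : R) :
  pder f x y fx fy -> pder g x y gx gy ->
  pder (fun x y => f x y + g x y) x y (fx + gx) (fy + gy).
Proof.
intros [H1 H2] [H3 H4]; split.
- exact (is_derive_plus (fun t => f t y) (fun t => g t y) _ _ _ H1 H3).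
- exact (is_derive_plus (fun t => f x t) (fun t => g x t) _ _ _ H2 H4).
Qed.

Lemma pder_mul (f g : scalar) (x y fx fy gx gy : R) :
  pder f x y fx fy -> pder g x y gx gy ->
  pder (fun x y => f x y * g x y) x y
    (fx * g x y + f x y * gx) (fy * g x y + f x y * gy).
Proof.
intros [H1 H2] [H3 H4]; split.
- exact (is_derive_Rmult (fun t => f t y) (fun t => g t y) _ _ _ H1 H3).
- exact (is_derive_Rmult (fun t => f x t) (fun t => g x t) _ _ _ H2 H4).
Qed.

Lemma pder_inv (f : scalar) (x y fx fy : R) :
  f x y <> 0 -> pder f x y fx fy ->
  pder (fun x y => / f x y) x y (- fx / f x y ^ 2) (- fy / f x y ^ 2).
Proof.
intros nz [H1 H2]; split.
- exact (is_derive_inv (fun t => f t y) _ _ H1 nz).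
- exact (is_derive_inv (fun t => f x t) _ _ H2 nz).
Qed.

Section Chern.

Variables (U : R * R -> Prop) (W : web_data).
Hypothesis oU : open U.
Hypothesis web : planar_4web U (om W).
Hypothesis chern : chern_connection U W.
Hypothesis curv : curvature_function U W.

Let p := cdx (om W i1).
Let q := cdy (om W i1).
Let r := cdx (om W i2).
Let s := cdy (om W i2).

Lemma wedge12_neq0 (x y : R) : U (x, y) -> wedge (om W i1) (om W i2) x y <> 0.
Proof. intros Uxy; destruct web as [_ H]; apply H; [discriminate | exact Uxy]. Qed.

Let p_smooth : smooth_on U p. Proof. apply web. Qed.
Let q_smooth : smooth_on U q. Proof. apply web. Qed.
Let r_smooth : smooth_on U r. Proof. apply web. Qed.
Let s_smooth : smooth_on U s. Proof. apply web. Qed.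

Lemma g1_smooth : smooth_on U (g1 W). Proof. apply chern. Qed.
Lemma g2_smooth : smooth_on U (g2 W). Proof. apply chern. Qed.

(** In omega_1 /\ gamma only g_2 survives, in omega_2 /\ gamma only - g_1. *)
Lemma structure_equations (x y : R) : U (x, y) ->
  ddx q x y - ddy p x y = g2 W x y * (p x y * s x y - q x y * r x y) /\
  ddx s x y - ddy r x y = - g1 W x y * (p x y * s x y - q x y * r x y).
Proof.
intros Uxy; destruct chern as (_ & _ & H).
assert (E1 := H x y Uxy i1 ltac:(discriminate)).
assert (E2 := H x y Uxy i2 ltac:(discriminate)).
unfold ext_d, wedge, conn_form in E1, E2; simpl in E1, E2.
fold p q r s in E1, E2; rewrite E1, E2; split; ring.
Qed.

Lemma curvature_equation (x y : R) : U (x, y) ->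
  curvK W x y * (p x y * s x y - q x y * r x y)
  = (ddx (g1 W) x y * q x y + g1 W x y * ddx q x y
     + (ddx (g2 W) x y * s x y + g2 W x y * ddx s x y))
    - (ddy (g1 W) x y * p x y + g1 W x y * ddy p x y
       + (ddy (g2 W) x y * r x y + g2 W x y * ddy r x y)).
Proof.
intros Uxy; destruct curv as [_ H]; specialize (H x y Uxy).
unfold ext_d, wedge, conn_form in H; simpl in H; fold p q r s in H.
rewrite <- H.
assert (G1 := smooth_pder U _ x y g1_smooth Uxy).
assert (G2 := smooth_pder U _ x y g2_smooth Uxy).
assert (P1 := smooth_pder U _ x y p_smooth Uxy).
assert (P2 := smooth_pder U _ x y q_smooth Uxy).
assert (P3 := smooth_pder U _ x y r_smooth Uxy).
assert (P4 := smooth_pder U _ x y s_smooth Uxy).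
rewrite (pder_ddx _ _ _ _ _ (pder_add _ _ _ _ _ _ _ _
  (pder_mul _ _ _ _ _ _ _ _ G1 P2) (pder_mul _ _ _ _ _ _ _ _ G2 P4))).
rewrite (pder_ddy _ _ _ _ _ (pder_add _ _ _ _ _ _ _ _
  (pder_mul _ _ _ _ _ _ _ _ G1 P1) (pder_mul _ _ _ _ _ _ _ _ G2 P3))).
reflexivity.
Qed.

Lemma cov1E (k : R) (f : scalar) (x y : R) :
  cov1 W k f x y
  = (ddx f x y * s x y - ddy f x y * r x y) / (p x y * s x y - q x y * r x y)
    - k * g1 W x y * f x y.
Proof.
unfold cov1, del1, feval, frame1, wedge; simpl; fold p q r s; unfold Rdiv; ring.
Qed.

Lemma cov2E (k : R) (f : scalar) (x y : R) :
  cov2 W k f x y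
  = (ddy f x y * p x y - ddx f x y * q x y) / (p x y * s x y - q x y * r x y)
    - k * g2 W x y * f x y.
Proof.
unfold cov2, del2, feval, frame2, wedge; simpl; fold p q r s; unfold Rdiv; ring.
Qed.

(* The components of F1 omega_1 + F2 omega_2 + k Y gamma, which is dY when the
   covariant derivatives of Y, of weight k, are F1 and F2. *)
Definition coframe_dx (k : R) (F1 F2 Y : scalar) : scalar := fun x y =>
  cdx (om W i1) x y * (F1 x y + k * g1 W x y * Y x y)
  + cdx (om W i2) x y * (F2 x y + k * g2 W x y * Y x y).

Definition coframe_dy (k : R) (F1 F2 Y : scalar) : scalar := fun x y =>
  cdy (om W i1) x y * (F1 x y + k * g1 W x y * Y x y)
  + cdy (om W i2) x y * (F2 x y + k * g2 W x y * Y x y).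

Lemma cov_coframe (k : R) (F1 F2 Y : scalar) (x y : R) : U (x, y) ->
  (cov1 W k Y x y = F1 x y /\ cov2 W k Y x y = F2 x y) <->
  (ddx Y x y = coframe_dx k F1 F2 Y x y /\ ddy Y x y = coframe_dy k F1 F2 Y x y).
Proof.
intros Uxy; assert (nz := wedge12_neq0 x y Uxy); unfold wedge in nz.
unfold coframe_dx, coframe_dy; rewrite cov1E, cov2E; fold p q r s in nz |- *.
split; intros [E1 E2].
- rewrite <- E1, <- E2; split; field; exact nz.
- rewrite E1, E2; split; field; exact nz.
Qed.

(** In d(F1 omega_1 + F2 omega_2 + k Y gamma), the gamma terms of d omega_i and of k dY /\ gamma
    cancel against those of dF_i when F_i has weight k + 1; d gamma supplies the K term. Only dY at
    the point itself is involved, so Y need satisfy its equations there alone. *)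
Lemma coframe_curl (k : R) (F1 F2 Y : scalar) (x y : R) : U (x, y) ->
  diff_pt F1 x y -> diff_pt F2 x y -> diff_pt Y x y ->
  cov1 W k Y x y = F1 x y -> cov2 W k Y x y = F2 x y ->
  ddx (coframe_dy k F1 F2 Y) x y - ddy (coframe_dx k F1 F2 Y) x y
  = (cov1 W (k + 1) F2 x y - cov2 W (k + 1) F1 x y + k * curvK W x y * Y x y)
    * wedge (om W i1) (om W i2) x y.
Proof.
intros Uxy dF1 dF2 dY E1 E2.
assert (nz := wedge12_neq0 x y Uxy); unfold wedge in nz |- *.
apply diff_pt_pder in dF1, dF2, dY.
assert (G1 := smooth_pder U _ x y g1_smooth Uxy).
assert (G2 := smooth_pder U _ x y g2_smooth Uxy).
assert (P1 := smooth_pder U _ x y p_smooth Uxy).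
assert (P2 := smooth_pder U _ x y q_smooth Uxy).
assert (P3 := smooth_pder U _ x y r_smooth Uxy).
assert (P4 := smooth_pder U _ x y s_smooth Uxy).
assert (T1 := pder_add _ _ _ _ _ _ _ _ dF1
  (pder_mul _ _ _ _ _ _ _ _ (pder_mul _ _ _ _ _ _ _ _ (pder_const k x y) G1) dY)).
assert (T2 := pder_add _ _ _ _ _ _ _ _ dF2
  (pder_mul _ _ _ _ _ _ _ _ (pder_mul _ _ _ _ _ _ _ _ (pder_const k x y) G2) dY)).
unfold coframe_dx, coframe_dy; fold p q r s in nz |- *.
rewrite (pder_ddx _ _ _ _ _ (pder_add _ _ _ _ _ _ _ _
  (pder_mul _ _ _ _ _ _ _ _ P2 T1) (pder_mul _ _ _ _ _ _ _ _ P4 T2))).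
rewrite (pder_ddy _ _ _ _ _ (pder_add _ _ _ _ _ _ _ _
  (pder_mul _ _ _ _ _ _ _ _ P1 T1) (pder_mul _ _ _ _ _ _ _ _ P3 T2))).
destruct (structure_equations x y Uxy) as [S1 S2].
assert (HK := curvature_equation x y Uxy).
rewrite cov1E in E1 |- *; rewrite cov2E in E2 |- *; rewrite <- E1, <- E2.
(* The curvature equation determines only the product of K with the coefficient of omega_1 /\
   omega_2. *)
assert (EK : curvK W x y = (curvK W x y * (p x y * s x y - q x y * r x y))
          / (p x y * s x y - q x y * r x y)) by (field; exact nz).
rewrite EK, HK; clear EK HK.
replace (ddx q x y) with
  (ddy p x y + g2 W x y * (p x y * s x y - q x y * r x y)) by lra.
replace (ddx s x y) with
  (ddy r x y + - g1 W x y * (p x y * s x y - q x y * r x y)) by lra.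
field; exact nz.
Qed.

Lemma cov1_smooth (V : R * R -> Prop) (k : R) (f : scalar) :
  open V -> (forall z, V z -> U z) -> smooth_on V f -> smooth_on V (cov1 W k f).
Proof.
intros oV VU Hf.
assert (sub := fun f => smooth_on_subset U V f VU).
assert (nz : nonvanishing_on V (fun x y => p x y * s x y - q x y * r x y)).
{ intros x y Vxy; apply wedge12_neq0, VU, Vxy. }
apply (smooth_ext V oV) with (1 := fun x y _ => eq_sym (cov1E k f x y)).
assert (G := sub _ g1_smooth).
repeat first [apply smooth_sub | apply smooth_div | apply smooth_mul]; auto;
  first [now apply smooth_ddx | now apply smooth_ddy | now apply smooth_const].
Qed.

Lemma cov2_smooth (V : R * R -> Prop) (k : R) (f : scalar) :
  open V -> (forall z, V z -> U z) -> smooth_on V f -> smooth_on V (cov2 W k f).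
Proof.
intros oV VU Hf.
assert (sub := fun f => smooth_on_subset U V f VU).
assert (nz : nonvanishing_on V (fun x y => p x y * s x y - q x y * r x y)).
{ intros x y Vxy; apply wedge12_neq0, VU, Vxy. }
apply (smooth_ext V oV) with (1 := fun x y _ => eq_sym (cov2E k f x y)).
assert (G := sub _ g2_smooth).
repeat first [apply smooth_sub | apply smooth_div | apply smooth_mul]; auto;
  first [now apply smooth_ddx | now apply smooth_ddy | now apply smooth_const].
Qed.

(** When F1 and F2 are the covariant derivatives of f, the form of [coframe_curl] is df, whose curl
    vanishes by Schwarz. *)
Lemma cov_commutator (V : R * R -> Prop) (k l : R) (f : scalar) (x y : R) :
  open V -> (forall z, V z -> U z) -> smooth_on V f -> V (x, y) -> l = k + 1 ->
  cov2 W l (cov1 W k f) x y - cov1 W l (cov2 W k f) x y = k * curvK W x y * f x y.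
Proof.
intros oV VU Hf Vxy ->.
assert (Uxy := VU _ Vxy).
assert (D1 := smooth_diff_pt V _ x y (cov1_smooth V k f oV VU Hf) Vxy).
assert (D2 := smooth_diff_pt V _ x y (cov2_smooth V k f oV VU Hf) Vxy).
assert (D := smooth_diff_pt V _ x y Hf Vxy).
assert (C := coframe_curl k _ _ _ x y Uxy D1 D2 D eq_refl eq_refl).
assert (Hcf : forall u v, V (u, v) ->
  ddx f u v = coframe_dx k (cov1 W k f) (cov2 W k f) f u v /\
  ddy f u v = coframe_dy k (cov1 W k f) (cov2 W k f) f u v).
{ intros u v Vuv; apply cov_coframe; auto. }
rewrite <- (ddx_ext_loc (ddy f)), <- (ddy_ext_loc (ddx f)) in C.
- rewrite (smooth_Schwarz V oV f x y Hf Vxy), Rminus_diag in C.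
  symmetry in C; apply Rmult_integral in C.
  destruct C as [C | C]; [lra |].
  now apply wedge12_neq0 in C.
- apply (locally_2d_on_open V); auto; intros u v Vuv; now apply Hcf.
- apply (locally_2d_on_open V); auto; intros u v Vuv; now apply Hcf.
Qed.

Definition cov_solves_at (N : nat) (k : nat -> R) (M1 M2 : nat -> nat -> scalar)
    (Y : nat -> scalar) (x y : R) : Prop :=
  forall j, (j <= N)%nat ->
    cov1 W (k j) (Y j) x y = lin N (at_pt M1 x y) (fun i => Y i x y) j /\
    cov2 W (k j) (Y j) x y = lin N (at_pt M2 x y) (fun i => Y i x y) j.

(* Y ranges over functions solving the system to first order at one point only, which
   makes this a condition on the coefficients alone. *)
Definition cov_flat (V : R * R -> Prop) (N : nat) (k : nat -> R)
    (M1 M2 : nat -> nat -> scalar) : Prop :=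
  forall (Y : nat -> scalar) x y, V (x, y) ->
    (forall j, (j <= N)%nat -> smooth_on V (Y j)) ->
    cov_solves_at N k M1 M2 Y x y ->
    forall j, (j <= N)%nat ->
      cov2 W (k j + 1) (fun x y => lin N (at_pt M1 x y) (fun i => Y i x y) j) x y
      - cov1 W (k j + 1) (fun x y => lin N (at_pt M2 x y) (fun i => Y i x y) j) x y
      = k j * curvK W x y * Y j x y.

Section CovariantSystem.

Variables (V : R * R -> Prop) (N : nat) (k : nat -> R) (M1 M2 : nat -> nat -> scalar).
Hypothesis oV : open V.
Hypothesis VU : forall z, V z -> U z.
Hypothesis M1_smooth :
  forall i j, (i <= N)%nat -> (j <= N)%nat -> smooth_on V (M1 i j).
Hypothesis M2_smooth :
  forall i j, (i <= N)%nat -> (j <= N)%nat -> smooth_on V (M2 i j).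

Let diag (i j : nat) (c : R) : R := if Nat.eqb i j then c else 0.

(** The dx-part of the system in coordinates; the weight term k Y gamma contributes to the
    diagonal. *)
Let A (i j : nat) : scalar := fun x y =>
  p x y * (M1 i j x y + diag i j (k i) * g1 W x y)
  + r x y * (M2 i j x y + diag i j (k i) * g2 W x y).

Let B (i j : nat) : scalar := fun x y =>
  q x y * (M1 i j x y + diag i j (k i) * g1 W x y)
  + s x y * (M2 i j x y + diag i j (k i) * g2 W x y).

Let sub (f : scalar) : smooth_on U f -> smooth_on V f.
Proof. exact (smooth_on_subset U V f VU). Qed.

Let A_smooth (i j : nat) : (i <= N)%nat -> (j <= N)%nat -> smooth_on V (A i j).
Proof.
intros Hi Hj; assert (G1 := sub _ g1_smooth); assert (G2 := sub _ g2_smooth).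
repeat first [apply smooth_add | apply smooth_mul]; auto; now apply smooth_const.
Qed.

Let B_smooth (i j : nat) : (i <= N)%nat -> (j <= N)%nat -> smooth_on V (B i j).
Proof.
intros Hi Hj; assert (G1 := sub _ g1_smooth); assert (G2 := sub _ g2_smooth).
repeat first [apply smooth_add | apply smooth_mul]; auto; now apply smooth_const.
Qed.

Let lin_coframe (P Q g h : R) (m1 m2 : nat -> nat -> R) (eta : nat -> R) (j : nat) :
  (j <= N)%nat ->
  lin N (fun i l => P * (m1 i l + diag i l (k i) * g)
                    + Q * (m2 i l + diag i l (k i) * h)) eta j
  = P * (lin N m1 eta j + k j * g * eta j) + Q * (lin N m2 eta j + k j * h * eta j).
Proof.
intros Hj; unfold lin.
assert (D : forall n, sum_f_R0 (fun l => diag j l (k j) * eta l) n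
            = if Nat.leb j n then k j * eta j else 0).
{ unfold diag; clear; induction n as [| n IH].
  - simpl; destruct j; simpl; ring.
  - rewrite tech5, IH; destruct (Nat.eqb_spec j (S n)) as [-> | Hne].
    + rewrite (proj2 (Nat.leb_gt (S n) n)), Nat.leb_refl by lia; ring.
    + destruct (Nat.leb_spec j n).
      * rewrite (proj2 (Nat.leb_le j (S n))) by lia; ring.
      * rewrite (proj2 (Nat.leb_gt j (S n))) by lia; ring. }
specialize (D N); rewrite (proj2 (Nat.leb_le j N) Hj) in D.
replace (k j * g * eta j) with (g * (k j * eta j)) by ring.
replace (k j * h * eta j) with (h * (k j * eta j)) by ring.
rewrite <- D; clear; induction N as [| n IH]; simpl; [ring |].
apply Rminus_diag_eq in IH; apply Rminus_diag_uniq; rewrite <- IH; ring.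
Qed.

Let rhs (M : nat -> nat -> scalar) (Y : nat -> scalar) (j : nat) : scalar :=
  fun x y => lin N (at_pt M x y) (fun i => Y i x y) j.

Let lin_A (Y : nat -> scalar) (j : nat) (x y : R) : (j <= N)%nat ->
  rhs A Y j x y = coframe_dx (k j) (rhs M1 Y j) (rhs M2 Y j) (Y j) x y.
Proof. intros Hj; now apply lin_coframe. Qed.

Let lin_B (Y : nat -> scalar) (j : nat) (x y : R) : (j <= N)%nat ->
  rhs B Y j x y = coframe_dy (k j) (rhs M1 Y j) (rhs M2 Y j) (Y j) x y.
Proof. intros Hj; now apply lin_coframe. Qed.

Let cov_solves_iff (Y : nat -> scalar) (x y : R) : U (x, y) ->
  cov_solves_at N k M1 M2 Y x y <-> solves_at N A B Y x y.
Proof.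
intros Uxy.
split; intros HS j Hj; specialize (HS j Hj).
- change (ddx (Y j) x y = rhs A Y j x y /\ ddy (Y j) x y = rhs B Y j x y).
  rewrite lin_A, lin_B by exact Hj; now apply cov_coframe.
- change (ddx (Y j) x y = rhs A Y j x y /\ ddy (Y j) x y = rhs B Y j x y) in HS.
  rewrite lin_A, lin_B in HS by exact Hj; now apply cov_coframe in HS.
Qed.

Let rhs_smooth (M : nat -> nat -> scalar) (Y : nat -> scalar) (j : nat) :
  (forall i j, (i <= N)%nat -> (j <= N)%nat -> smooth_on V (M i j)) ->
  (forall j, (j <= N)%nat -> smooth_on V (Y j)) -> (j <= N)%nat ->
  smooth_on V (rhs M Y j).
Proof.
intros HM HY Hj.
apply (smooth_sum V oV (fun i x y => M j i x y * Y i x y)).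
intros i Hi; apply smooth_mul; auto.
Qed.

Let cov_flat_flat : cov_flat V N k M1 M2 -> flat V N A B.
Proof.
intros HF x y Vxy eta j Hj.
(* Affine, with value [eta] and the gradient that the system prescribes at (x, y): a solution to
   first order there, as [cov_flat] requires. *)
set (Y := fun (i : nat) (u v : R) => eta i
  + lin N (at_pt A x y) eta i * (u - x) + lin N (at_pt B x y) eta i * (v - y)).
assert (HY : forall i, Y i x y = eta i) by (intros; unfold Y; ring).
assert (YV : forall i, smooth_on V (Y i)).
{ intros i; unfold Y.
  repeat first [apply smooth_add | apply smooth_sub | apply smooth_mul]; auto;
    first [now apply smooth_const | now apply smooth_coord1
           | now apply smooth_coord2]. }
assert (Yder : forall i, pder (Y i) x y
          (lin N (at_pt A x y) eta i) (lin N (at_pt B x y) eta i)).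
{ intros i; unfold Y; split; auto_derive; auto; ring. }
assert (HS : solves_at N A B Y x y).
{ intros i Hi.
  rewrite (pder_ddx _ _ _ _ _ (Yder i)), (pder_ddy _ _ _ _ _ (Yder i)).
  split; apply lin_ext; intros; now rewrite HY. }
apply cov_solves_iff in HS; [| auto].
assert (C := HF Y x y Vxy (fun i _ => YV i) HS j Hj).
destruct (HS j Hj) as [E1 E2].
assert (D1 := smooth_diff_pt V _ x y
  (rhs_smooth M1 Y j M1_smooth (fun i _ => YV i) Hj) Vxy).
assert (D2 := smooth_diff_pt V _ x y
  (rhs_smooth M2 Y j M2_smooth (fun i _ => YV i) Hj) Vxy).
assert (D := smooth_diff_pt V _ x y (YV j) Vxy).
assert (R := coframe_curl (k j) (rhs M1 Y j) (rhs M2 Y j) (Y j) x y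
               (VU _ Vxy) D1 D2 D E1 E2).
unfold rhs in R at 5 6.
replace (_ - _ + _) with 0 in R by lra.
rewrite Rmult_0_l in R.
rewrite <- (ddx_ext_loc (rhs B Y j)), <- (ddy_ext_loc (rhs A Y j)) in R;
  try (apply locally_2d_forall; intros; first [now apply lin_A | now apply lin_B]).
assert (dM : forall M,
  (forall i j, (i <= N)%nat -> (j <= N)%nat -> smooth_on V (M i j)) ->
  ddx (rhs M Y j) x y = lin N (at_pt (fun i l => ddx (M i l)) x y) eta j
        + lin N (at_pt M x y) (lin N (at_pt A x y) eta) j /\
  ddy (rhs M Y j) x y = lin N (at_pt (fun i l => ddy (M i l)) x y) eta j
        + lin N (at_pt M x y) (lin N (at_pt B x y) eta) j).
{ intros M HM; unfold lin at 1 2 4 5; rewrite <- !plus_sum.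
  split; apply is_derive_unique.
  - apply (is_derive_sum (fun i t => M j i t y * Y i t y)).
    intros i Hi; rewrite <- (HY i).
    apply (is_derive_Rmult (fun t => M j i t y) (fun t => Y i t y)); [| apply Yder].
    apply diff_pt_is_derive_x, (smooth_diff_pt V); auto.
  - apply (is_derive_sum (fun i t => M j i x t * Y i x t)).
    intros i Hi; rewrite <- (HY i).
    apply (is_derive_Rmult (fun t => M j i x t) (fun t => Y i x t)); [| apply Yder].
    apply diff_pt_is_derive_y, (smooth_diff_pt V); auto. }
destruct (dM A A_smooth) as [_ EA]; destruct (dM B B_smooth) as [EB _].
rewrite EA, EB in R; lra.
Qed.

Lemma cov_frobenius_exists (x0 y0 : R) (eta : nat -> R) :
  V (x0, y0) -> cov_flat V N k M1 M2 ->
  exists (Y : nat -> scalar) (rho : R), 0 < rho /\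
    (forall z, box x0 y0 rho z -> V z) /\
    (forall j, (j <= N)%nat -> smooth_on (box x0 y0 rho) (Y j)) /\
    (forall j, (j <= N)%nat -> Y j x0 y0 = eta j) /\
    (forall x y, box x0 y0 rho (x, y) -> cov_solves_at N k M1 M2 Y x y).
Proof.
intros V0 HF.
destruct (frobenius_exists V N A B x0 y0 oV V0 A_smooth B_smooth eta
            (cov_flat_flat HF)) as (Y & rho & Hr & HV & HY & H0 & HS).
exists Y, rho; split; [exact Hr | split; [exact HV | split; [exact HY |]]].
split; [exact H0 |]; intros x y Hxy; apply cov_solves_iff; auto.
Qed.

Lemma cov_frobenius_unique (x0 y0 : R) (Y : nat -> scalar) :
  V (x0, y0) ->
  locally_2d (fun x y => (forall j, (j <= N)%nat -> diff_pt (Y j) x y) /\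
                         cov_solves_at N k M1 M2 Y x y) x0 y0 ->
  (forall j, (j <= N)%nat -> Y j x0 y0 = 0) ->
  locally_2d (fun x y => forall j, (j <= N)%nat -> Y j x y = 0) x0 y0.
Proof.
intros V0 HY HY0.
apply (frobenius_unique V N A B x0 y0 oV V0 A_smooth B_smooth Y); [| exact HY0].
assert (H := locally_2d_and _ _ _ _ HY (open_locally_2d V x0 y0 oV V0)).
apply locally_2d_impl with (2 := H); apply locally_2d_forall.
intros x y [[H1 H2] Vxy]; split; [exact H1 |].
apply cov_solves_iff; auto.
Qed.

End CovariantSystem.

End Chern.

(** * Abelian relations *)


(** The covariant analogue of [pder]; in the rules below weights add under products, which makes the
    connection terms cancel. *)
Definition cder (W : web_data) (k : R) (f : scalar) (x y d1 d2 : R) : Prop :=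
  (exists fx fy, pder f x y fx fy) /\ cov1 W k f x y = d1 /\ cov2 W k f x y = d2.

Lemma pder_cov (W : web_data) (k : R) (f : scalar) (x y fx fy : R) :
  pder f x y fx fy ->
  cov1 W k f x y = fx * fst (frame1 W x y) + fy * snd (frame1 W x y)
                   - k * g1 W x y * f x y /\
  cov2 W k f x y = fx * fst (frame2 W x y) + fy * snd (frame2 W x y)
                   - k * g2 W x y * f x y.
Proof.
intros H; unfold cov1, cov2, del1, del2, feval, Defs.differential.
cbn [cdx cdy]; now rewrite (pder_ddx _ _ _ _ _ H), (pder_ddy _ _ _ _ _ H).
Qed.

Lemma pder_cder (W : web_data) (k : R) (f : scalar) (x y fx fy : R) :
  pder f x y fx fy ->
  cder W k f x y
    (fx * fst (frame1 W x y) + fy * snd (frame1 W x y) - k * g1 W x y * f x y)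
    (fx * fst (frame2 W x y) + fy * snd (frame2 W x y) - k * g2 W x y * f x y).
Proof. intros H; split; [now exists fx, fy | now apply pder_cov]. Qed.

Lemma cder_eq (W : web_data) (k k' : R) (f : scalar) (x y d1 d2 d1' d2' : R) :
  cder W k f x y d1 d2 -> k = k' -> d1 = d1' -> d2 = d2' ->
  cder W k' f x y d1' d2'.
Proof. now intros H <- <- <-. Qed.

Lemma cder_weight (W : web_data) (k k' : R) (f : scalar) (x y d1 d2 : R) :
  cder W k f x y d1 d2 -> k = k' -> cder W k' f x y d1 d2.
Proof. now intros H <-. Qed.

Lemma cder_const (W : web_data) (k c x y : R) :
  k = 0 -> cder W k (fun _ _ => c) x y 0 0.
Proof.
intros ->; apply cder_eq with (1 := pder_cder W 0 _ x y 0 0 (pder_const c x y)); ring.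
Qed.

(** Unlike other constants, 0 is admissible in every weight; zero coefficients of the systems rely
    on this. *)
Lemma cder_zero (W : web_data) (k x y : R) : cder W k (fun _ _ => 0) x y 0 0.
Proof.
apply cder_eq with (1 := pder_cder W k _ x y 0 0 (pder_const 0 x y)); ring.
Qed.

Lemma cder_add (W : web_data) (k : R) (f g : scalar) (x y d1 d2 e1 e2 : R) :
  cder W k f x y d1 d2 -> cder W k g x y e1 e2 ->
  cder W k (fun x y => f x y + g x y) x y (d1 + e1) (d2 + e2).
Proof.
intros ((fx & fy & Hf) & <- & <-) ((gx & gy & Hg) & <- & <-).
destruct (pder_cov W k _ _ _ _ _ Hf) as [-> ->].
destruct (pder_cov W k _ _ _ _ _ Hg) as [-> ->].
apply cder_eq with (1 := pder_cder W k _ x y _ _ (pder_add _ _ _ _ _ _ _ _ Hf Hg));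
  ring.
Qed.

Lemma cder_mul (W : web_data) (k l m : R) (f g : scalar) (x y d1 d2 e1 e2 : R) :
  cder W k f x y d1 d2 -> cder W l g x y e1 e2 -> k + l = m ->
  cder W m (fun x y => f x y * g x y) x y
    (d1 * g x y + f x y * e1) (d2 * g x y + f x y * e2).
Proof.
intros ((fx & fy & Hf) & <- & <-) ((gx & gy & Hg) & <- & <-) <-.
destruct (pder_cov W k _ _ _ _ _ Hf) as [-> ->].
destruct (pder_cov W l _ _ _ _ _ Hg) as [-> ->].
apply cder_eq with
  (1 := pder_cder W (k + l) _ x y _ _ (pder_mul _ _ _ _ _ _ _ _ Hf Hg)); ring.
Qed.

Lemma cder_opp (W : web_data) (k : R) (f : scalar) (x y d1 d2 : R) :
  cder W k f x y d1 d2 -> cder W k (fun x y => - f x y) x y (- d1) (- d2).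
Proof.
intros ((fx & fy & Hf) & <- & <-); destruct (pder_cov W k _ _ _ _ _ Hf) as [-> ->].
assert (P : pder (fun x y => - f x y) x y (- fx) (- fy)).
{ destruct Hf as [H1 H2]; split.
  - exact (is_derive_opp (fun t => f t y) _ _ H1).
  - exact (is_derive_opp (fun t => f x t) _ _ H2). }
apply cder_eq with (1 := pder_cder W k _ x y _ _ P); ring.
Qed.

Lemma cder_sub (W : web_data) (k : R) (f g : scalar) (x y d1 d2 e1 e2 : R) :
  cder W k f x y d1 d2 -> cder W k g x y e1 e2 ->
  cder W k (fun x y => f x y - g x y) x y (d1 - e1) (d2 - e2).
Proof. intros Hf Hg; apply cder_add; [exact Hf | now apply cder_opp]. Qed.

Lemma cder_inv (W : web_data) (k m : R) (f : scalar) (x y d1 d2 : R) :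
  cder W k f x y d1 d2 -> f x y <> 0 -> - k = m ->
  cder W m (fun x y => / f x y) x y (- d1 / f x y ^ 2) (- d2 / f x y ^ 2).
Proof.
intros ((fx & fy & Hf) & <- & <-) nz <-.
destruct (pder_cov W k _ _ _ _ _ Hf) as [-> ->].
apply cder_eq with (1 := pder_cder W (- k) _ x y _ _ (pder_inv _ _ _ _ _ nz Hf));
  field; exact nz.
Qed.

Lemma cder_div (W : web_data) (k l m : R) (f g : scalar) (x y d1 d2 e1 e2 : R) :
  cder W k f x y d1 d2 -> cder W l g x y e1 e2 -> g x y <> 0 -> k - l = m ->
  cder W m (fun x y => f x y / g x y) x y
    ((d1 * g x y - f x y * e1) / g x y ^ 2) ((d2 * g x y - f x y * e2) / g x y ^ 2).
Proof.
intros Hf Hg nz <-.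
apply cder_eq with (1 := cder_mul W _ _ _ _ _ _ _ _ _ _ _ Hf
  (cder_inv W _ _ _ _ _ _ _ Hg nz eq_refl) eq_refl); [ring | |]; field; exact nz.
Qed.

Lemma cder_ext_loc (W : web_data) (k : R) (f g : scalar) (x y d1 d2 : R) :
  locally_2d (fun u v => f u v = g u v) x y ->
  cder W k f x y d1 d2 -> cder W k g x y d1 d2.
Proof.
intros E ((fx & fy & H1 & H2) & <- & <-); split.
- exists fx, fy; split.
  + apply is_derive_ext_loc with (2 := H1); exact (locally_2d_1d_const_y _ _ _ E).
  + apply is_derive_ext_loc with (2 := H2); exact (locally_2d_1d_const_x _ _ _ E).
- unfold cov1, cov2, del1, del2, feval, Defs.differential; cbn [cdx cdy].
  rewrite (ddx_ext_loc _ _ _ _ E), (ddy_ext_loc _ _ _ _ E).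
  now rewrite (locally_2d_singleton _ _ _ E).
Qed.

Lemma smooth_cder (W : web_data) (V : R * R -> Prop) (k : R) (f : scalar) (x y : R) :
  smooth_on V f -> V (x, y) -> cder W k f x y (cov1 W k f x y) (cov2 W k f x y).
Proof.
intros Hf Vxy; split; [| now split].
eexists; eexists; now apply (smooth_pder V).
Qed.

(** Used on goals whose derivatives are existential variables: unification computes them, and [lra]
    checks the weights. *)
Ltac cder_solve :=
  match goal with
  | H : cder ?W ?k ?f ?x ?y ?d1 ?d2 |- cder ?W _ _ ?x ?y _ _ =>
      solve [refine (cder_weight _ _ _ _ _ _ _ _ H _); first [reflexivity | lra]]
  | |- cder _ _ (fun x y => - _) _ _ _ _ => eapply cder_opp; cder_solve
  | |- cder _ _ (fun x y => _ + _) _ _ _ _ => eapply cder_add; cder_solve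
  | |- cder _ _ (fun x y => _ - _) _ _ _ _ => eapply cder_sub; cder_solve
  | |- cder _ _ (fun x y => _ * _) _ _ _ _ =>
      eapply cder_mul; [cder_solve | cder_solve | first [reflexivity | lra]]
  | |- cder _ _ (fun x y => _ / _) _ _ _ _ =>
      eapply cder_div; [cder_solve | cder_solve | assumption
                       | first [reflexivity | lra]]
  | |- cder _ _ (fun x y => 0) _ _ _ _ => apply cder_zero
  | |- cder _ _ (fun x y => _) _ _ _ _ =>
      eapply cder_const; first [reflexivity | lra]
  end.

Ltac cov_expand :=
  match goal with |- cov2 ?W ?m ?F ?x ?y - cov1 ?W ?m ?G ?x ?y = _ =>
    let DF := fresh in let DG := fresh in
    eassert (DF : cder W m F x y _ _) by cder_solve;
    eassert (DG : cder W m G x y _ _) by cder_solve;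
    rewrite (proj2 (proj2 DF)), (proj1 (proj2 DG)); clear DF DG
  end.

Section Web.

Variables (U : R * R -> Prop) (W : web_data).
Hypothesis oU : open U.
Hypothesis web : planar_4web U (om W).
Hypothesis norm : normalized U W.
Hypothesis chern : chern_connection U W.
Hypothesis curv : curvature_function U W.

(** a = 0 would make omega_4 parallel to omega_2, and a = 1 would make it parallel to omega_3. *)
Lemma inv_a_neq (x y : R) : U (x, y) -> inv_a W x y <> 0 /\ 1 - inv_a W x y <> 0.
Proof.
intros Uxy; destruct norm as [_ Hn]; destruct (Hn x y Uxy) as [[N1 N2] [N3 N4]].
destruct web as [_ Hw].
assert (W1 := Hw i2 i4 ltac:(discriminate) x y Uxy).
assert (W2 := Hw i3 i4 ltac:(discriminate) x y Uxy).
unfold wedge, fadd, fscale in *; simpl in *.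
replace (cdx (om W i4) x y) with
  (- (inv_a W x y * cdx (om W i1) x y + cdx (om W i2) x y)) in * by lra.
replace (cdy (om W i4) x y) with
  (- (inv_a W x y * cdy (om W i1) x y + cdy (om W i2) x y)) in * by lra.
replace (cdx (om W i3) x y) with
  (- (cdx (om W i1) x y + cdx (om W i2) x y)) in * by lra.
replace (cdy (om W i3) x y) with
  (- (cdy (om W i1) x y + cdy (om W i2) x y)) in * by lra.
split; intros E; [apply W1 | apply W2].
- rewrite E; ring.
- replace (inv_a W x y) with 1 by lra; ring.
Qed.

Let sm1 (k : R) (f : scalar) : smooth_on U f -> smooth_on U (cov1 W k f).
Proof. apply (cov1_smooth U W web chern U); auto. Qed.

Let sm2 (k : R) (f : scalar) : smooth_on U f -> smooth_on U (cov2 W k f).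
Proof. apply (cov2_smooth U W web chern U); auto. Qed.

Let commut (k l : R) (f : scalar) (x y : R) : smooth_on U f -> U (x, y) -> l = k + 1 ->
  cov2 W l (cov1 W k f) x y - cov1 W l (cov2 W k f) x y = k * curvK W x y * f x y.
Proof. intros; apply (cov_commutator U W web chern curv U); auto. Qed.

(** * The basic invariant, its derivatives and the smoothness of the c_j *)

Lemma a_smooth : smooth_on U (inv_a W). Proof. apply norm. Qed.
Lemma K_smooth : smooth_on U (curvK W). Proof. apply curv. Qed.
Lemma a_1_smooth : smooth_on U (a_1 W). Proof. exact (sm1 _ _ a_smooth). Qed.
Lemma a_2_smooth : smooth_on U (a_2 W). Proof. exact (sm2 _ _ a_smooth). Qed.
Lemma a_11_smooth : smooth_on U (a_11 W). Proof. exact (sm1 _ _ a_1_smooth). Qed.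
Lemma a_12_smooth : smooth_on U (a_12 W). Proof. exact (sm1 _ _ a_2_smooth). Qed.
Lemma a_21_smooth : smooth_on U (a_21 W). Proof. exact (sm2 _ _ a_1_smooth). Qed.
Lemma a_22_smooth : smooth_on U (a_22 W). Proof. exact (sm2 _ _ a_2_smooth). Qed.

Lemma a_21E (x y : R) : U (x, y) -> a_21 W x y = a_12 W x y.
Proof.
intros Uxy; unfold a_21, a_12, a_1, a_2.
assert (C := commut 0 1 _ x y a_smooth Uxy ltac:(lra)); lra.
Qed.

Lemma cov_a_21 (k : R) (x y : R) : U (x, y) ->
  cov1 W k (a_21 W) x y = cov1 W k (a_12 W) x y /\
  cov2 W k (a_21 W) x y = cov2 W k (a_12 W) x y.
Proof.
intros Uxy.
assert (L : locally_2d (fun u v => a_12 W u v = a_21 W u v) x y).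
{ apply (locally_2d_on_open U); auto; intros; now rewrite a_21E. }
destruct (cder_ext_loc W k _ _ x y _ _ L (smooth_cder W U k _ x y a_12_smooth Uxy))
  as (_ & -> & ->); now split.
Qed.

(** Two of the three derivatives averaged in [a_112] coincide; the third exceeds them by K a_1, the
    commutator on [a_1], of weight 1. *)
Lemma a_112E (x y : R) : U (x, y) ->
  a_112 W x y = cov1 W 2 (a_12 W) x y + curvK W x y * a_1 W x y / 3.
Proof.
intros Uxy; unfold a_112; destruct (cov_a_21 2 x y Uxy) as [-> _].
assert (C := commut 1 2 _ x y a_1_smooth Uxy ltac:(lra)).
fold (a_11 W) (a_21 W) in C; destruct (cov_a_21 2 x y Uxy) as [E _].
rewrite E in C.
replace (cov2 W 2 (a_11 W) x y) with
  (cov1 W 2 (a_12 W) x y + curvK W x y * a_1 W x y) by lra.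
field.
Qed.

Lemma cov1_a_22 (x y : R) : U (x, y) ->
  cov1 W 2 (a_22 W) x y = cov2 W 2 (a_12 W) x y - curvK W x y * a_2 W x y.
Proof.
intros Uxy.
assert (C := commut 1 2 _ x y a_2_smooth Uxy ltac:(lra)).
fold (a_12 W) (a_22 W) in C; lra.
Qed.

Lemma a_122E (x y : R) : U (x, y) ->
  a_122 W x y = cov2 W 2 (a_12 W) x y - curvK W x y * a_2 W x y / 3.
Proof.
intros Uxy; unfold a_122; destruct (cov_a_21 2 x y Uxy) as [_ ->].
rewrite (cov1_a_22 x y Uxy); field.
Qed.

Ltac smooth_solve :=
  repeat first
    [ assumption
    | simple apply sm1
    | simple apply sm2
    | apply smooth_const; assumption
    | apply smooth_add; [assumption | |]
    | apply smooth_sub; [assumption | |]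
    | apply smooth_div; [assumption | | |]
    | apply smooth_mul; [assumption | |]
    | apply smooth_pow; [assumption |]
    | apply smooth_opp; [assumption |] ].

Lemma a_112_smooth : smooth_on U (a_112 W).
Proof.
assert (S11 := a_11_smooth); assert (S12 := a_12_smooth); assert (S21 := a_21_smooth).
unfold a_112; smooth_solve.
Qed.

Lemma a_122_smooth : smooth_on U (a_122 W).
Proof.
assert (S22 := a_22_smooth); assert (S12 := a_12_smooth); assert (S21 := a_21_smooth).
unfold a_122; smooth_solve.
Qed.

Ltac nonvanishing_solve :=
  let x := fresh "x" in let y := fresh "y" in let H := fresh in
  intros x y H; destruct (inv_a_neq x y H);
  repeat first [apply Rmult_integral_contrapositive_currified | apply pow_nonzero];
  first [assumption | lra].

Lemma c0_smooth : smooth_on U (c0 W).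
Proof.
assert (S := a_smooth); assert (SK := K_smooth).
assert (S1 := a_1_smooth); assert (S2 := a_2_smooth).
assert (S11 := a_11_smooth); assert (S12 := a_12_smooth); assert (S22 := a_22_smooth).
unfold c0; smooth_solve; nonvanishing_solve.
Qed.

Lemma c1_smooth : smooth_on U (Defs.c1 W).
Proof.
assert (S := a_smooth); assert (SK := K_smooth).
assert (S1 := a_1_smooth); assert (S2 := a_2_smooth).
assert (S12 := a_12_smooth); assert (S22 := a_22_smooth).
assert (S112 := a_112_smooth); assert (S122 := a_122_smooth).
assert (K1 : smooth_on U (K_1 W)) by exact (sm1 _ _ SK).
assert (K2 : smooth_on U (K_2 W)) by exact (sm2 _ _ SK).
unfold Defs.c1; smooth_solve; nonvanishing_solve.
Qed.

Lemma c2_smooth : smooth_on U (c2 W).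
Proof.
assert (S := a_smooth); assert (SK := K_smooth).
assert (S1 := a_1_smooth); assert (S2 := a_2_smooth).
assert (K1 : smooth_on U (K_1 W)) by exact (sm1 _ _ SK).
assert (K2 : smooth_on U (K_2 W)) by exact (sm2 _ _ SK).
unfold c2; smooth_solve; nonvanishing_solve.
Qed.

(* Unknowns u, v, q with u = lambda_3, v = lambda_4 and q = delta_2 v: the abelian
   relation equations say delta_1 u = delta_2 u = - delta_1 v = - a q - a_2 v, and the
   integrability conditions of u and v determine the derivatives of q. *)
Definition sys3_1 (j k : nat) : scalar :=
  match j, k with
  | 0%nat, 1%nat => fun x y => - a_2 W x y
  | 0%nat, 2%nat => fun x y => - inv_a W x y
  | 1%nat, 1%nat => fun x y => a_2 W x y
  | 1%nat, 2%nat => fun x y => inv_a W x y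
  | 2%nat, 0%nat => fun x y => - curvK W x y / (1 - inv_a W x y)
  | 2%nat, 1%nat => fun x y =>
      (a_12 W x y + a_2 W x y * a_2 W x y - curvK W x y) / (1 - inv_a W x y)
  | 2%nat, 2%nat => fun x y =>
      (a_1 W x y + inv_a W x y * a_2 W x y) / (1 - inv_a W x y)
  | _, _ => fun _ _ => 0
  end.

Definition sys3_2 (j k : nat) : scalar :=
  match j, k with
  | 0%nat, 1%nat => fun x y => - a_2 W x y
  | 0%nat, 2%nat => fun x y => - inv_a W x y
  | 1%nat, 2%nat => fun x y => 1
  | 2%nat, 0%nat => fun x y => - curvK W x y / (1 - inv_a W x y) / inv_a W x y
  | 2%nat, 1%nat => fun x y =>
      ((a_12 W x y + a_2 W x y * a_2 W x y - curvK W x y) / (1 - inv_a W x y)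
       + curvK W x y - a_22 W x y) / inv_a W x y
  | 2%nat, 2%nat => fun x y =>
      ((a_1 W x y + inv_a W x y * a_2 W x y) / (1 - inv_a W x y)
       - 2 * a_2 W x y) / inv_a W x y
  | _, _ => fun _ _ => 0
  end.

(** The coefficients lambda_i have weight 1 and q is a covariant derivative of one of them. *)
Definition weight3 (j : nat) : R := match j with 2%nat => 2 | _ => 1 end.

(* The system induced on u, v by c_0 q + c_1 v + c_2 u = 0. *)
Definition sys2_1 (j k : nat) : scalar :=
  match j, k with
  | 0%nat, 0%nat => fun x y => inv_a W x y * c2 W x y / c0 W x y
  | 0%nat, 1%nat => fun x y => inv_a W x y * Defs.c1 W x y / c0 W x y - a_2 W x y
  | 1%nat, 0%nat => fun x y => - (inv_a W x y * c2 W x y / c0 W x y)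
  | 1%nat, 1%nat => fun x y => a_2 W x y - inv_a W x y * Defs.c1 W x y / c0 W x y
  | _, _ => fun _ _ => 0
  end.

Definition sys2_2 (j k : nat) : scalar :=
  match j, k with
  | 0%nat, 0%nat => fun x y => inv_a W x y * c2 W x y / c0 W x y
  | 0%nat, 1%nat => fun x y => inv_a W x y * Defs.c1 W x y / c0 W x y - a_2 W x y
  | 1%nat, 0%nat => fun x y => - (c2 W x y / c0 W x y)
  | 1%nat, 1%nat => fun x y => - (Defs.c1 W x y / c0 W x y)
  | _, _ => fun _ _ => 0
  end.

Lemma sys3_smooth (j k : nat) : smooth_on U (sys3_1 j k) /\ smooth_on U (sys3_2 j k).
Proof.
assert (S := a_smooth); assert (SK := K_smooth).
assert (S1 := a_1_smooth); assert (S2 := a_2_smooth).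
assert (S12 := a_12_smooth); assert (S22 := a_22_smooth).
destruct j as [| [| [| j]]]; destruct k as [| [| [| k]]]; simpl; split;
  smooth_solve; nonvanishing_solve.
Qed.

Lemma sys2_smooth (j k : nat) : nonvanishing_on U (c0 W) ->
  smooth_on U (sys2_1 j k) /\ smooth_on U (sys2_2 j k).
Proof.
intros nz; assert (S := a_smooth); assert (S2 := a_2_smooth).
assert (C0 := c0_smooth); assert (C1 := c1_smooth); assert (C2 := c2_smooth).
destruct j as [| [| j]]; destruct k as [| [| k]]; simpl; split; smooth_solve.
Qed.

(** The rows of u and v have no defect, since the rows of q were obtained by solving exactly these
    two conditions. The row of q produces c_0, c_1, c_2, once all third derivatives of a are reduced
    to those of [a_12]. *)
Lemma sys3_curvature (V : R * R -> Prop) (Y : nat -> scalar) (x y : R) :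
  (forall z, V z -> U z) -> V (x, y) ->
  (forall j, (j <= 2)%nat -> smooth_on V (Y j)) ->
  cov_solves_at W 2 weight3 sys3_1 sys3_2 Y x y ->
  forall j, (j <= 2)%nat ->
    cov2 W (weight3 j + 1)
      (fun x y => lin 2 (at_pt sys3_1 x y) (fun i => Y i x y) j) x y
    - cov1 W (weight3 j + 1)
        (fun x y => lin 2 (at_pt sys3_2 x y) (fun i => Y i x y) j) x y
    = weight3 j * curvK W x y * Y j x y
      - (if Nat.eqb j 2 then 4 * (c0 W x y * Y 2%nat x y + Defs.c1 W x y * Y 1%nat x y
                                  + c2 W x y * Y 0%nat x y) else 0).
Proof.
intros VU Vxy HY HS j Hj; assert (Uxy := VU _ Vxy).
destruct (inv_a_neq x y Uxy) as [nz nz1].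
assert (Da : cder W 0 (inv_a W) x y (a_1 W x y) (a_2 W x y))
  by exact (smooth_cder W U 0 _ x y a_smooth Uxy).
assert (Da1 : cder W 1 (a_1 W) x y (a_11 W x y) (a_12 W x y)).
{ rewrite <- (a_21E x y Uxy); exact (smooth_cder W U 1 _ x y a_1_smooth Uxy). }
assert (Da2 : cder W 1 (a_2 W) x y (a_12 W x y) (a_22 W x y))
  by exact (smooth_cder W U 1 _ x y a_2_smooth Uxy).
assert (Da12 := smooth_cder W U 2 _ x y a_12_smooth Uxy).
assert (Da22 := smooth_cder W U 2 _ x y a_22_smooth Uxy).
rewrite (cov1_a_22 x y Uxy) in Da22.
assert (DK : cder W 2 (curvK W) x y (K_1 W x y) (K_2 W x y))
  by exact (smooth_cder W U 2 _ x y K_smooth Uxy).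
assert (D0 := smooth_cder W V 1 _ x y (HY 0%nat ltac:(lia)) Vxy).
assert (D1 := smooth_cder W V 1 _ x y (HY 1%nat ltac:(lia)) Vxy).
assert (D2 := smooth_cder W V 2 _ x y (HY 2%nat ltac:(lia)) Vxy).
destruct (HS 0%nat ltac:(lia)) as [E01 E02].
destruct (HS 1%nat ltac:(lia)) as [E11 E12].
destruct (HS 2%nat ltac:(lia)) as [E21 E22].
unfold lin, at_pt in E01, E02, E11, E12, E21, E22.
simpl in E01, E02, E11, E12, E21, E22.
rewrite E01, E02 in D0; rewrite E11, E12 in D1; rewrite E21, E22 in D2.
clear E01 E02 E11 E12 E21 E22 HS.
unfold lin, at_pt; destruct j as [| [| [| j]]]; [| | | lia]; simpl.
- cov_expand; clear - nz nz1; field; auto.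
- cov_expand; clear - nz nz1; field; auto.
- cov_expand.
  unfold c0, Defs.c1, c2; cbv zeta; rewrite (a_112E x y Uxy), (a_122E x y Uxy).
  clear - nz nz1.
  generalize dependent (inv_a W x y); intros.
  field; auto.
Qed.

(** The origin of the G_ij: they are the numerators of the curvature matrix of the reduced system,
    the square of c_0 coming from the derivatives of c_1 / c_0 and c_2 / c_0. *)
Lemma sys2_curvature (V : R * R -> Prop) (Y : nat -> scalar) (x y : R) :
  (forall z, V z -> U z) -> V (x, y) -> c0 W x y <> 0 ->
  (forall j, (j <= 1)%nat -> smooth_on V (Y j)) ->
  cov_solves_at W 1 (fun _ => 1) sys2_1 sys2_2 Y x y ->
  forall j, (j <= 1)%nat ->
    cov2 W (1 + 1) (fun x y => lin 1 (at_pt sys2_1 x y) (fun i => Y i x y) j) x y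
    - cov1 W (1 + 1) (fun x y => lin 1 (at_pt sys2_2 x y) (fun i => Y i x y) j) x y
    = 1 * curvK W x y * Y j x y
      + (if Nat.eqb j 0
         then G11 W x y * Y 0%nat x y + G12 W x y * Y 1%nat x y
         else G21 W x y * Y 0%nat x y + G22 W x y * Y 1%nat x y) / c0 W x y ^ 2.
Proof.
intros VU Vxy nz0 HY HS j Hj; assert (Uxy := VU _ Vxy).
assert (Da : cder W 0 (inv_a W) x y (a_1 W x y) (a_2 W x y))
  by exact (smooth_cder W U 0 _ x y a_smooth Uxy).
assert (Da2 : cder W 1 (a_2 W) x y (a_12 W x y) (a_22 W x y))
  by exact (smooth_cder W U 1 _ x y a_2_smooth Uxy).
assert (Dc0 : cder W 2 (c0 W) x y (c0_1 W x y) (c0_2 W x y))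
  by exact (smooth_cder W U 2 _ x y c0_smooth Uxy).
assert (Dc1 : cder W 3 (Defs.c1 W) x y (c1_1 W x y) (c1_2 W x y))
  by exact (smooth_cder W U 3 _ x y c1_smooth Uxy).
assert (Dc2 : cder W 3 (c2 W) x y (c2_1 W x y) (c2_2 W x y))
  by exact (smooth_cder W U 3 _ x y c2_smooth Uxy).
assert (D0 := smooth_cder W V 1 _ x y (HY 0%nat ltac:(lia)) Vxy).
assert (D1 := smooth_cder W V 1 _ x y (HY 1%nat ltac:(lia)) Vxy).
destruct (HS 0%nat ltac:(lia)) as [E01 E02].
destruct (HS 1%nat ltac:(lia)) as [E11 E12].
unfold lin, at_pt in E01, E02, E11, E12.
simpl in E01, E02, E11, E12.
rewrite E01, E02 in D0; rewrite E11, E12 in D1.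
clear E01 E02 E11 E12 HS.
unfold lin, at_pt; destruct j as [| [| j]]; [| | lia]; simpl;
  cov_expand; unfold G11, G12, G21, G22; cbv zeta; clear - nz0;
  generalize dependent (c0 W x y); intros; field; auto.
Qed.

(** * Abelian relations and the linear system *)

Let w (x y : R) : R := wedge (om W i1) (om W i2) x y.

(** Weight 1 is what absorbs gamma: d(f omega_i) = (df + f' gamma) /\ omega_i with f' = - f. The
    last two forms are expanded as - (omega_1 + omega_2) and - (a omega_1 + omega_2), and
    differentiating a yields the a_2 term. *)
Lemma closed_forms (V : R * R -> Prop) (f : scalar) (x y : R) :
  (forall z, V z -> U z) -> V (x, y) -> smooth_on V f ->
  ext_d (fscale f (om W i1)) x y = - w x y * cov2 W 1 f x y /\
  ext_d (fscale f (om W i2)) x y = w x y * cov1 W 1 f x y /\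
  ext_d (fscale f (om W i3)) x y = w x y * (cov2 W 1 f x y - cov1 W 1 f x y) /\
  ext_d (fscale f (om W i4)) x y
  = w x y * (inv_a W x y * cov2 W 1 f x y + a_2 W x y * f x y - cov1 W 1 f x y).
Proof.
intros VU Vxy Hf; assert (Uxy := VU _ Vxy).
assert (nz := wedge12_neq0 U W web x y Uxy).
assert (P := smooth_pder V f x y Hf Vxy).
assert (PA := smooth_pder U _ x y a_smooth Uxy).
assert (S := proj1 web).
assert (P1 := smooth_pder U _ x y (proj1 (S i1)) Uxy).
assert (Q1 := smooth_pder U _ x y (proj2 (S i1)) Uxy).
assert (P2 := smooth_pder U _ x y (proj1 (S i2)) Uxy).
assert (Q2 := smooth_pder U _ x y (proj2 (S i2)) Uxy).
(* The normalization is needed on a neighbourhood, because it is going to be differentiated. *)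
assert (L3 : locally_2d (fun u v =>
  -1 * (cdx (om W i1) u v + cdx (om W i2) u v) = cdx (om W i3) u v /\
  -1 * (cdy (om W i1) u v + cdy (om W i2) u v) = cdy (om W i3) u v /\
  -1 * (inv_a W u v * cdx (om W i1) u v + cdx (om W i2) u v) = cdx (om W i4) u v /\
  -1 * (inv_a W u v * cdy (om W i1) u v + cdy (om W i2) u v) = cdy (om W i4) u v) x y).
{ apply (locally_2d_on_open U); auto; intros u v Huv.
  destruct norm as [_ Hn]; destruct (Hn u v Huv) as [[N1 N2] [N3 N4]].
  unfold fadd, fscale in *; simpl in *.
  split; [lra | split; [lra | split; lra]]. }
destruct (structure_equations U W chern x y Uxy) as [S1 S2].
apply (Rplus_eq_compat_r (ddy (cdx (om W i1)) x y)) in S1.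
apply (Rplus_eq_compat_r (ddy (cdx (om W i2)) x y)) in S2.
unfold Rminus in S1 at 1, S2 at 1; rewrite Rplus_assoc, Rplus_opp_l, Rplus_0_r in S1, S2.
rewrite S1 in Q1; rewrite S2 in Q2.
assert (EA : a_2 W x y = cov2 W 0 (inv_a W) x y) by reflexivity.
rewrite cov2E in EA.
unfold w, ext_d, fscale; cbn [cdx cdy]; rewrite cov1E, cov2E.
unfold wedge in *.
assert (M := fun g gx gy (Pg : pder g x y gx gy) => pder_mul f g x y _ _ gx gy P Pg).
split; [| split; [| split]].
- rewrite (pder_ddx _ _ _ _ _ (M _ _ _ Q1)), (pder_ddy _ _ _ _ _ (M _ _ _ P1)).
  field; exact nz.
- rewrite (pder_ddx _ _ _ _ _ (M _ _ _ Q2)), (pder_ddy _ _ _ _ _ (M _ _ _ P2)).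
  field; exact nz.
- rewrite <- (ddx_ext_loc (fun x y => f x y *
    (-1 * (cdy (om W i1) x y + cdy (om W i2) x y)))).
  2: { apply locally_2d_impl with (2 := L3), locally_2d_forall.
       intros u v (_ & -> & _); reflexivity. }
  rewrite <- (ddy_ext_loc (fun x y => f x y *
    (-1 * (cdx (om W i1) x y + cdx (om W i2) x y)))).
  2: { apply locally_2d_impl with (2 := L3), locally_2d_forall.
       intros u v (-> & _); reflexivity. }
  rewrite (pder_ddx _ _ _ _ _ (M _ _ _ (pder_mul _ _ _ _ _ _ _ _
    (pder_const (-1) x y) (pder_add _ _ _ _ _ _ _ _ Q1 Q2)))).
  rewrite (pder_ddy _ _ _ _ _ (M _ _ _ (pder_mul _ _ _ _ _ _ _ _
    (pder_const (-1) x y) (pder_add _ _ _ _ _ _ _ _ P1 P2)))).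
  field; exact nz.
- rewrite <- (ddx_ext_loc (fun x y => f x y *
    (-1 * (inv_a W x y * cdy (om W i1) x y + cdy (om W i2) x y)))).
  2: { apply locally_2d_impl with (2 := L3), locally_2d_forall.
       intros u v (_ & _ & _ & ->); reflexivity. }
  rewrite <- (ddy_ext_loc (fun x y => f x y *
    (-1 * (inv_a W x y * cdx (om W i1) x y + cdx (om W i2) x y)))).
  2: { apply locally_2d_impl with (2 := L3), locally_2d_forall.
       intros u v (_ & _ & -> & _); reflexivity. }
  rewrite (pder_ddx _ _ _ _ _ (M _ _ _ (pder_mul _ _ _ _ _ _ _ _
    (pder_const (-1) x y) (pder_add _ _ _ _ _ _ _ _
      (pder_mul _ _ _ _ _ _ _ _ PA Q1) Q2)))).
  rewrite (pder_ddy _ _ _ _ _ (M _ _ _ (pder_mul _ _ _ _ _ _ _ _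
    (pder_const (-1) x y) (pder_add _ _ _ _ _ _ _ _
      (pder_mul _ _ _ _ _ _ _ _ PA P1) P2)))).
  rewrite EA.
  field; exact nz.
Qed.

(** The data (u, v, q) of a relation, indexed as in the linear system; only j = 0, 1, 2 matter. *)
Definition jet3 (la : idx -> scalar) (j : nat) : scalar :=
  match j with
  | 0%nat => la i3
  | 1%nat => la i4
  | _ => cov2 W 1 (la i4)
  end.

Let cov1_loc (V : R * R -> Prop) (k : R) (f g : scalar) (x y : R) :
  open V -> V (x, y) -> (forall u v, V (u, v) -> f u v = g u v) ->
  cov1 W k f x y = cov1 W k g x y.
Proof.
intros oV Vxy E; unfold cov1, del1, feval, Defs.differential; cbn [cdx cdy].
assert (L : locally_2d (fun u v => f u v = g u v) x y)
  by now apply (locally_2d_on_open V).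
now rewrite (ddx_ext_loc _ _ _ _ L), (ddy_ext_loc _ _ _ _ L), E.
Qed.

Let cov2_loc (V : R * R -> Prop) (k : R) (f g : scalar) (x y : R) :
  open V -> V (x, y) -> (forall u v, V (u, v) -> f u v = g u v) ->
  cov2 W k f x y = cov2 W k g x y.
Proof.
intros oV Vxy E; unfold cov2, del2, feval, Defs.differential; cbn [cdx cdy].
assert (L : locally_2d (fun u v => f u v = g u v) x y)
  by now apply (locally_2d_on_open V).
now rewrite (ddx_ext_loc _ _ _ _ L), (ddy_ext_loc _ _ _ _ L), E.
Qed.

(* A genuine solution satisfies the integrability condition by the commutator rule. *)
Lemma cov_solves_commutator (V : R * R -> Prop) (N : nat) (k : nat -> R)
    (M1 M2 : nat -> nat -> scalar) (Y : nat -> scalar) (x y : R) (j : nat) :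
  open V -> (forall z, V z -> U z) -> V (x, y) -> (j <= N)%nat -> smooth_on V (Y j) ->
  (forall u v, V (u, v) -> cov_solves_at W N k M1 M2 Y u v) ->
  cov2 W (k j + 1) (fun x y => lin N (at_pt M1 x y) (fun i => Y i x y) j) x y
  - cov1 W (k j + 1) (fun x y => lin N (at_pt M2 x y) (fun i => Y i x y) j) x y
  = k j * curvK W x y * Y j x y.
Proof.
intros oV VU Vxy Hj HY HS.
rewrite <- (cov_commutator U W web chern curv V (k j) (k j + 1) (Y j) x y)
  by auto.
apply (f_equal2 Rminus); [apply (cov2_loc V) | apply (cov1_loc V)]; auto;
  intros u v Huv; symmetry; now apply (HS u v Huv j Hj).
Qed.

Let linear_relation (l1 l2 l3 l4 : R) (x y : R) : U (x, y) ->
  (l1 * cdx (om W i1) x y + l2 * cdx (om W i2) x y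
   + (l3 * cdx (om W i3) x y + l4 * cdx (om W i4) x y) = 0 /\
   l1 * cdy (om W i1) x y + l2 * cdy (om W i2) x y
   + (l3 * cdy (om W i3) x y + l4 * cdy (om W i4) x y) = 0) <->
  (l1 = l3 + inv_a W x y * l4 /\ l2 = l3 + l4).
Proof.
intros Uxy; assert (nz := wedge12_neq0 U W web x y Uxy); unfold wedge in nz.
destruct norm as [_ Hn]; destruct (Hn x y Uxy) as [[N1 N2] [N3 N4]].
unfold fadd, fscale in N1, N2, N3, N4; simpl in N1, N2, N3, N4.
replace (cdx (om W i4) x y) with
  (- (inv_a W x y * cdx (om W i1) x y + cdx (om W i2) x y)) by lra.
replace (cdy (om W i4) x y) with
  (- (inv_a W x y * cdy (om W i1) x y + cdy (om W i2) x y)) by lra.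
replace (cdx (om W i3) x y) with
  (- (cdx (om W i1) x y + cdx (om W i2) x y)) by lra.
replace (cdy (om W i3) x y) with
  (- (cdy (om W i1) x y + cdy (om W i2) x y)) by lra.
set (p := cdx (om W i1) x y) in *; set (q := cdy (om W i1) x y) in *.
set (r := cdx (om W i2) x y) in *; set (s := cdy (om W i2) x y) in *.
split.
- intros [E1 E2].
  assert (F1 : (p * s - q * r) * (l1 - l3 - inv_a W x y * l4) = 0).
  { replace ((p * s - q * r) * (l1 - l3 - inv_a W x y * l4)) with
     (s * (l1 * p + l2 * r + (l3 * - (p + r) + l4 * - (inv_a W x y * p + r)))
      - r * (l1 * q + l2 * s + (l3 * - (q + s) + l4 * - (inv_a W x y * q + s))))
      by ring.
    rewrite E1, E2; ring. }
  assert (F2 : (p * s - q * r) * (l2 - l3 - l4) = 0).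
  { replace ((p * s - q * r) * (l2 - l3 - l4)) with
     (p * (l1 * q + l2 * s + (l3 * - (q + s) + l4 * - (inv_a W x y * q + s)))
      - q * (l1 * p + l2 * r + (l3 * - (p + r) + l4 * - (inv_a W x y * p + r))))
      by ring.
    rewrite E1, E2; ring. }
  apply Rmult_integral in F1, F2.
  destruct F1 as [F1 | F1]; [lra |]; destruct F2 as [F2 | F2]; [lra |].
  split; lra.
- intros [-> ->]; split; ring.
Qed.

(** Closedness of the forms [i2], [i3], [i4] gives the derivatives of u and v in terms of [P] and
    [q]; the commutators of u and v then give those of q. *)
Lemma abelian_jet (la : idx -> scalar) (x0 y0 : R) :
  U (x0, y0) -> abelian_relation_at (om W) x0 y0 la ->
  exists rho, 0 < rho /\ (forall z, box x0 y0 rho z -> U z) /\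
    (forall i, smooth_on (box x0 y0 rho) (la i)) /\
    forall x y, box x0 y0 rho (x, y) ->
      la i1 x y = la i3 x y + inv_a W x y * la i4 x y /\
      la i2 x y = la i3 x y + la i4 x y /\
      cov_solves_at W 2 weight3 sys3_1 sys3_2 (jet3 la) x y.
Proof.
intros U0 HA.
assert (H := locally_2d_and _ _ _ _ HA (open_locally_2d U x0 y0 oU U0)).
apply box_locally_2d in H; destruct H as (rho & Hr & H).
set (V := box x0 y0 rho) in *.
assert (oV : open V) by apply open_box.
assert (VU : forall z, V z -> U z) by (intros [x y] Hz; now apply (H x y Hz)).
assert (Hs : forall i, smooth_on V (la i)) by (intros i x y Hxy; now apply (H x y Hxy)).
exists rho; split; [exact Hr | split; [exact VU | split; [exact Hs |]]].
assert (HL : forall x y, V (x, y) -> la i1 x y = la i3 x y + inv_a W x y * la i4 x y /\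
          la i2 x y = la i3 x y + la i4 x y).
{ intros x y Hxy; apply (linear_relation _ _ _ _ x y (VU _ Hxy)).
  now apply (H x y Hxy). }
set (u := la i3) in *; set (v := la i4) in *; set (q := cov2 W 1 v).
assert (Hq : smooth_on V q)
  by exact (cov2_smooth U W web chern V 1 v oV VU (Hs i4)).
set (P := fun x y => - (inv_a W x y * q x y + a_2 W x y * v x y)).
assert (H1 : forall x y, V (x, y) ->
  cov1 W 1 u x y = P x y /\ cov2 W 1 u x y = P x y /\ cov1 W 1 v x y = - P x y).
{ intros x y Hxy; assert (Uxy := VU _ Hxy).
  assert (nz : w x y <> 0) by (apply (wedge12_neq0 U W web); auto).
  assert (HE := proj2 (proj2 (proj1 (H x y Hxy)))).
  assert (C2 := proj1 (proj2 (closed_forms V _ x y VU Hxy (Hs i2)))).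
  assert (C3 := proj1 (proj2 (proj2 (closed_forms V _ x y VU Hxy (Hs i3))))).
  assert (C4 := proj2 (proj2 (proj2 (closed_forms V _ x y VU Hxy (Hs i4))))).
  rewrite (HE i2) in C2; rewrite (HE i3) in C3; rewrite (HE i4) in C4.
  symmetry in C2, C3, C4; apply Rmult_integral in C2, C3, C4.
  destruct C2 as [C2 | C2]; [contradiction |].
  destruct C3 as [C3 | C3]; [contradiction |].
  destruct C4 as [C4 | C4]; [contradiction |].
  rewrite (cov1_loc V 1 (la i2) (fun x y => u x y + v x y)) in C2; auto;
    [| intros; now apply HL].
  assert (Du := smooth_cder W V 1 u x y (Hs i3) Hxy).
  assert (Dv := smooth_cder W V 1 v x y (Hs i4) Hxy).
  rewrite (proj1 (proj2 (cder_add _ _ _ _ _ _ _ _ _ _ Du Dv))) in C2.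
  unfold P, q; fold u v in C3, C4; split; [| split]; lra. }
intros x y Hxy; destruct (HL x y Hxy) as [HL1 HL2].
split; [exact HL1 | split; [exact HL2 |]].
assert (Uxy := VU _ Hxy); destruct (inv_a_neq x y Uxy) as [nz nz1].
destruct (H1 x y Hxy) as (E1 & E2 & E3).
assert (Da : cder W 0 (inv_a W) x y (a_1 W x y) (a_2 W x y))
  by exact (smooth_cder W U 0 _ x y a_smooth Uxy).
assert (Da2 : cder W 1 (a_2 W) x y (a_12 W x y) (a_22 W x y))
  by exact (smooth_cder W U 1 _ x y a_2_smooth Uxy).
assert (Dv := smooth_cder W V 1 v x y (Hs i4) Hxy).
assert (Dq := smooth_cder W V 2 q x y Hq Hxy).
fold q in Dv; rewrite E3 in Dv; change (cov2 W 1 v x y) with (q x y) in Dv.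
eassert (DP : cder W 2 P x y _ _) by (unfold P; cder_solve).
assert (Cu := cov_commutator U W web chern curv V 1 2 u x y oV VU (Hs i3) Hxy ltac:(lra)).
assert (Cv := cov_commutator U W web chern curv V 1 2 v x y oV VU (Hs i4) Hxy ltac:(lra)).
rewrite (cov2_loc V 2 (cov1 W 1 u) P), (cov1_loc V 2 (cov2 W 1 u) P) in Cu; auto;
  [| intros; now apply H1 | intros; now apply H1].
rewrite (cov2_loc V 2 (cov1 W 1 v) (fun x y => - P x y)) in Cv; auto;
  [| intros; now apply H1].
fold q in Cv.
rewrite (proj2 (proj2 (cder_opp _ _ _ _ _ _ _ DP))) in Cv.
rewrite (proj1 (proj2 DP)), (proj2 (proj2 DP)) in Cu.
(* The sum of the two commutators eliminates delta_2 [P], hence delta_2 q; [Eq2] is the commutator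
   of v alone. *)
assert (Eq1 : (1 - inv_a W x y) * cov1 W 2 q x y =
  (a_12 W x y + a_2 W x y * a_2 W x y - curvK W x y) * v x y
  - curvK W x y * u x y + (a_1 W x y + inv_a W x y * a_2 W x y) * q x y).
{ unfold P in Cu, Cv; lra. }
assert (Eq2 : inv_a W x y * cov2 W 2 q x y =
  cov1 W 2 q x y + (curvK W x y - a_22 W x y) * v x y - 2 * a_2 W x y * q x y).
{ unfold P in Cu, Cv; lra. }
assert (Eq1' : cov1 W 2 q x y =
  ((a_12 W x y + a_2 W x y * a_2 W x y - curvK W x y) * v x y
  - curvK W x y * u x y + (a_1 W x y + inv_a W x y * a_2 W x y) * q x y)
  / (1 - inv_a W x y)) by (rewrite <- Eq1; field; exact nz1).
assert (Eq2' : cov2 W 2 q x y =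
  (cov1 W 2 q x y + (curvK W x y - a_22 W x y) * v x y - 2 * a_2 W x y * q x y)
  / inv_a W x y) by (rewrite <- Eq2; field; exact nz).
intros j Hj; unfold lin, at_pt; destruct j as [| [| [| j]]]; [| | | lia];
  simpl; fold u v q.
- rewrite E1, E2; unfold P; split; ring.
- rewrite E3; change (cov2 W 1 v x y) with (q x y); unfold P; split; ring.
- rewrite Eq2', Eq1'; split; field; auto.
Qed.

Definition rel_of (u v : scalar) (i : idx) : scalar :=
  match i with
  | i1 => fun x y => u x y + inv_a W x y * v x y
  | i2 => fun x y => u x y + v x y
  | i3 => u
  | i4 => v
  end.

Lemma rel_of_abelian (V : R * R -> Prop) (u v : scalar) (x0 y0 : R) :
  open V -> (forall z, V z -> U z) -> V (x0, y0) -> smooth_on V u -> smooth_on V v ->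
  (forall x y, V (x, y) ->
     let p := - (inv_a W x y * cov2 W 1 v x y + a_2 W x y * v x y) in
     cov1 W 1 u x y = p /\ cov2 W 1 u x y = p /\ cov1 W 1 v x y = - p) ->
  abelian_relation_at (om W) x0 y0 (rel_of u v).
Proof.
intros oV VU V0 Hu Hv HE; apply (locally_2d_on_open V); auto; intros x y Hxy.
assert (Uxy := VU _ Hxy).
assert (Ha := smooth_on_subset U V _ VU a_smooth).
assert (Hs : forall i, smooth_on V (rel_of u v i)).
{ intros []; simpl; auto; repeat first [apply smooth_add | apply smooth_mul]; auto. }
split; [intros i; now apply Hs | split].
- now apply linear_relation.
- destruct (HE x y Hxy) as (E1 & E2 & E3).
  assert (Da : cder W 0 (inv_a W) x y (a_1 W x y) (a_2 W x y))
    by exact (smooth_cder W U 0 _ x y a_smooth Uxy).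
  assert (Du := smooth_cder W V 1 u x y Hu Hxy).
  assert (Dv := smooth_cder W V 1 v x y Hv Hxy).
  intros i; destruct (closed_forms V _ x y VU Hxy (Hs i)) as (F1 & F2 & F3 & F4).
  destruct i.
  + rewrite F1; simpl.
    eassert (D : cder W 1 (fun x y => u x y + inv_a W x y * v x y) x y _ _)
      by cder_solve.
    rewrite (proj2 (proj2 D)), E2; ring.
  + rewrite F2; simpl.
    eassert (D : cder W 1 (fun x y => u x y + v x y) x y _ _) by cder_solve.
    rewrite (proj1 (proj2 D)), E1, E3; ring.
  + rewrite F3; simpl; rewrite E1, E2; ring.
  + rewrite F4; simpl; rewrite E3; ring.
Qed.

Let jet3_smooth (V : R * R -> Prop) (la : idx -> scalar) (j : nat) :
  open V -> (forall z, V z -> U z) -> (forall i, smooth_on V (la i)) ->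
  smooth_on V (jet3 la j).
Proof.
intros oV VU Hs; destruct j as [| [| j]]; simpl; auto.
apply (cov2_smooth U W web chern); auto.
Qed.

Lemma abelian_relation_c (la : idx -> scalar) (x0 y0 : R) :
  U (x0, y0) -> abelian_relation_at (om W) x0 y0 la ->
  locally_2d (fun x y => c0 W x y * jet3 la 2 x y + Defs.c1 W x y * jet3 la 1 x y
                         + c2 W x y * jet3 la 0 x y = 0) x0 y0.
Proof.
intros U0 HA; destruct (abelian_jet la x0 y0 U0 HA) as (rho & Hr & VU & Hs & HJ).
apply box_locally_2d; exists rho; split; [exact Hr |].
intros x y Hxy; set (V := box x0 y0 rho) in *.
assert (oV : open V) by apply open_box.
assert (HY : forall j, (j <= 2)%nat -> smooth_on V (jet3 la j)) by auto.
assert (HS : forall u v, V (u, v) ->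
          cov_solves_at W 2 weight3 sys3_1 sys3_2 (jet3 la) u v)
  by (intros; now apply HJ).
assert (C := sys3_curvature V (jet3 la) x y VU Hxy HY (HS x y Hxy) 2%nat (le_n 2)).
rewrite (cov_solves_commutator V 2 weight3 sys3_1 sys3_2 (jet3 la) x y 2) in C by auto.
change (Nat.eqb 2 2) with true in C; cbv iota in C; lra.
Qed.

(** Injectivity of the jet at a point on solution germs, which reduces questions of dimension to
    linear algebra in dimension three. *)
Lemma abelian_zero (la : idx -> scalar) (x0 y0 : R) :
  U (x0, y0) -> abelian_relation_at (om W) x0 y0 la ->
  (forall j, (j <= 2)%nat -> jet3 la j x0 y0 = 0) ->
  locally_2d (fun x y => forall i, la i x y = 0) x0 y0.
Proof.
intros U0 HA H0; destruct (abelian_jet la x0 y0 U0 HA) as (rho & Hr & VU & Hs & HJ).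
assert (oV := open_box x0 y0 rho); assert (V0 := box_center x0 y0 rho Hr).
assert (Z : locally_2d (fun x y => forall j, (j <= 2)%nat -> jet3 la j x y = 0) x0 y0).
{ apply (cov_frobenius_unique U W web chern U 2 weight3 sys3_1 sys3_2); auto.
  - intros; apply sys3_smooth.
  - intros; apply sys3_smooth.
  - apply (locally_2d_on_open (box x0 y0 rho)); auto.
    intros x y Hxy; split; [| now apply HJ].
    intros j _; apply (smooth_diff_pt (box x0 y0 rho)); auto. }
assert (B := locally_2d_on_open _ _ x0 y0 oV V0 HJ).
apply locally_2d_impl with (2 := locally_2d_and _ _ _ _ Z B), locally_2d_forall.
intros x y [Hz (E1 & E2 & _)].
assert (Z0 := Hz 0%nat ltac:(lia)); assert (Z1 := Hz 1%nat ltac:(lia)).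
simpl in Z0, Z1; intros []; auto; rewrite ?E1, ?E2, ?Z0, ?Z1; ring.
Qed.

(** * Linear combinations of abelian relations *)

Definition comb (al be : R) (la mu : idx -> scalar) (i : idx) : scalar :=
  fun x y => al * la i x y + be * mu i x y.

Lemma abelian_comb (al be : R) (la mu : idx -> scalar) (x0 y0 : R) :
  U (x0, y0) -> abelian_relation_at (om W) x0 y0 la ->
  abelian_relation_at (om W) x0 y0 mu ->
  abelian_relation_at (om W) x0 y0 (comb al be la mu).
Proof.
intros U0 HA HB.
assert (H := locally_2d_and _ _ _ _ (locally_2d_and _ _ _ _ HA HB)
               (open_locally_2d U x0 y0 oU U0)).
apply box_locally_2d in H; destruct H as (rho & Hr & H).
set (V := box x0 y0 rho) in *.
assert (oV : open V) by apply open_box.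
assert (Hla : forall i, smooth_on V (la i)) by (intros i x y Hxy; now apply (H x y Hxy)).
assert (Hmu : forall i, smooth_on V (mu i)) by (intros i x y Hxy; now apply (H x y Hxy)).
assert (Hc : forall i, smooth_on V (comb al be la mu i)).
{ intros i; unfold comb; apply smooth_add; auto; apply smooth_mul; auto;
    now apply smooth_const. }
apply box_locally_2d; exists rho; split; [exact Hr |]; intros x y Hxy.
destruct (H x y Hxy) as [[(_ & La & Ea) (_ & Lb & Eb)] Uxy].
split; [intros i; now apply Hc | split].
- destruct La as [A1 A2]; destruct Lb as [B1 B2].
  unfold fzero_at, fadd, fscale in *; simpl in *; unfold comb; split.
  + match type of A1 with ?a = 0 => match type of B1 with ?b = 0 =>
      transitivity (al * a + be * b); [ring | rewrite A1, B1; ring] end end.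
  + match type of A2 with ?a = 0 => match type of B2 with ?b = 0 =>
      transitivity (al * a + be * b); [ring | rewrite A2, B2; ring] end end.
- intros i.
  assert (P := smooth_pder V _ x y (Hla i) Hxy).
  assert (Q := smooth_pder V _ x y (Hmu i) Hxy).
  assert (Rx := smooth_pder U _ x y (proj1 (proj1 web i)) Uxy).
  assert (Ry := smooth_pder U _ x y (proj2 (proj1 web i)) Uxy).
  assert (PQ := pder_add _ _ _ _ _ _ _ _
    (pder_mul _ _ _ _ _ _ _ _ (pder_const al x y) P)
    (pder_mul _ _ _ _ _ _ _ _ (pder_const be x y) Q)).
  specialize (Ea i); specialize (Eb i); unfold ext_d, fscale in *; cbn [cdx cdy] in *.
  rewrite (pder_ddx _ _ _ _ _ (pder_mul _ _ _ _ _ _ _ _ P Ry)) in Ea.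
  rewrite (pder_ddy _ _ _ _ _ (pder_mul _ _ _ _ _ _ _ _ P Rx)) in Ea.
  rewrite (pder_ddx _ _ _ _ _ (pder_mul _ _ _ _ _ _ _ _ Q Ry)) in Eb.
  rewrite (pder_ddy _ _ _ _ _ (pder_mul _ _ _ _ _ _ _ _ Q Rx)) in Eb.
  unfold comb; rewrite (pder_ddx _ _ _ _ _ (pder_mul _ _ _ _ _ _ _ _ PQ Ry)).
  rewrite (pder_ddy _ _ _ _ _ (pder_mul _ _ _ _ _ _ _ _ PQ Rx)).
  match type of Ea with ?a = 0 => match type of Eb with ?b = 0 =>
    transitivity (al * a + be * b); [ring | rewrite Ea, Eb; ring] end end.
Qed.

Lemma jet3_comb (al be : R) (la mu : idx -> scalar) (x0 y0 : R) (j : nat) :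
  U (x0, y0) -> abelian_relation_at (om W) x0 y0 la ->
  abelian_relation_at (om W) x0 y0 mu ->
  jet3 (comb al be la mu) j x0 y0 = al * jet3 la j x0 y0 + be * jet3 mu j x0 y0.
Proof.
intros U0 HA HB; destruct j as [| [| j]]; [reflexivity | reflexivity |]; simpl.
assert (S : forall nu, abelian_relation_at (om W) x0 y0 nu ->
          cder W 1 (nu i4) x0 y0 (cov1 W 1 (nu i4) x0 y0) (cov2 W 1 (nu i4) x0 y0)).
{ intros nu Hnu; destruct (abelian_jet nu x0 y0 U0 Hnu) as (rho & Hr & _ & Hs & _).
  exact (smooth_cder W _ 1 _ x0 y0 (Hs i4) (box_center x0 y0 rho Hr)). }
assert (Da := S la HA); assert (Db := S mu HB).
assert (D := cder_add _ _ _ _ _ _ _ _ _ _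
  (cder_mul _ 0 1 1 _ _ _ _ _ _ _ _ (cder_const W 0 al x0 y0 eq_refl) Da ltac:(lra))
  (cder_mul _ 0 1 1 _ _ _ _ _ _ _ _ (cder_const W 0 be x0 y0 eq_refl) Db ltac:(lra))).
unfold comb; rewrite (proj2 (proj2 D)); ring.
Qed.

Lemma jet3_local (la mu : idx -> scalar) (x0 y0 : R) (j : nat) :
  locally_2d (fun x y => forall i, la i x y = mu i x y) x0 y0 ->
  jet3 la j x0 y0 = jet3 mu j x0 y0.
Proof.
intros L; assert (L0 := locally_2d_singleton _ _ _ L).
destruct j as [| [| j]]; simpl; [apply L0 | apply L0 |].
apply box_locally_2d in L; destruct L as (rho & Hr & HL).
apply (cov2_loc (box x0 y0 rho)); [apply open_box | now apply box_center |].
intros u v Huv; now apply HL.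
Qed.

Lemma lincomb2 (c : nat -> R) (s : nat -> idx -> scalar) (i : idx) (x y : R) :
  lincomb 2 c s i x y = comb (c 0%nat) (c 1%nat) (s 0%nat) (s 1%nat) i x y.
Proof. unfold lincomb, comb; simpl; ring. Qed.

(** * Abelian relations with prescribed initial values *)

Lemma abelian_of_sys3 (eta : nat -> R) (x0 y0 : R) :
  U (x0, y0) -> cov_flat W U 2 weight3 sys3_1 sys3_2 ->
  exists la, abelian_relation_at (om W) x0 y0 la /\
    forall j, (j <= 2)%nat -> jet3 la j x0 y0 = eta j.
Proof.
intros U0 HF.
destruct (cov_frobenius_exists U W web chern curv U 2 weight3 sys3_1 sys3_2 oU
  (fun z Hz => Hz) (fun i j _ _ => proj1 (sys3_smooth i j))
  (fun i j _ _ => proj2 (sys3_smooth i j)) x0 y0 eta U0 HF)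
  as (Y & rho & Hr & VU & HY & H0 & HS).
assert (V0 := box_center x0 y0 rho Hr).
assert (E : forall x y, box x0 y0 rho (x, y) ->
  cov1 W 1 (Y 0%nat) x y = - (inv_a W x y * Y 2%nat x y + a_2 W x y * Y 1%nat x y) /\
  cov2 W 1 (Y 0%nat) x y = - (inv_a W x y * Y 2%nat x y + a_2 W x y * Y 1%nat x y) /\
  cov1 W 1 (Y 1%nat) x y = inv_a W x y * Y 2%nat x y + a_2 W x y * Y 1%nat x y /\
  cov2 W 1 (Y 1%nat) x y = Y 2%nat x y).
{ intros x y Hxy.
  destruct (HS x y Hxy 0%nat ltac:(lia)) as [A1 A2].
  destruct (HS x y Hxy 1%nat ltac:(lia)) as [B1 B2].
  unfold lin, at_pt in A1, A2, B1, B2; simpl in A1, A2, B1, B2.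
  rewrite A1, A2, B1, B2; split; [ring | split; [ring | split; ring]]. }
exists (rel_of (Y 0%nat) (Y 1%nat)); split.
- apply (rel_of_abelian (box x0 y0 rho)); auto using open_box.
  intros x y Hxy; cbv zeta; destruct (E x y Hxy) as (-> & -> & -> & ->).
  split; [| split]; ring.
- intros j Hj; destruct j as [| [| [| j]]]; [| | | lia]; simpl.
  + apply H0; lia.
  + apply H0; lia.
  + destruct (E x0 y0 V0) as (_ & _ & _ & ->); apply H0; lia.
Qed.

Lemma abelian_of_sys2 (eta : nat -> R) (x0 y0 : R) :
  nonvanishing_on U (c0 W) ->
  U (x0, y0) -> cov_flat W U 1 (fun _ => 1) sys2_1 sys2_2 ->
  exists la, abelian_relation_at (om W) x0 y0 la /\
    forall j, (j <= 1)%nat -> jet3 la j x0 y0 = eta j.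
Proof.
intros nz0 U0 HF.
destruct (cov_frobenius_exists U W web chern curv U 1 (fun _ => 1) sys2_1 sys2_2 oU
  (fun z Hz => Hz) (fun i j _ _ => proj1 (sys2_smooth i j nz0))
  (fun i j _ _ => proj2 (sys2_smooth i j nz0)) x0 y0 eta U0 HF)
  as (Y & rho & Hr & VU & HY & H0 & HS).
exists (rel_of (Y 0%nat) (Y 1%nat)); split.
- apply (rel_of_abelian (box x0 y0 rho)); auto using open_box, box_center.
  intros x y Hxy; cbv zeta; assert (N0 := nz0 x y (VU _ Hxy)).
  destruct (HS x y Hxy 0%nat ltac:(lia)) as [A1 A2].
  destruct (HS x y Hxy 1%nat ltac:(lia)) as [B1 B2].
  unfold lin, at_pt in A1, A2, B1, B2; simpl in A1, A2, B1, B2.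
  rewrite A1, A2, B1, B2; split; [| split]; field; exact N0.
- intros j Hj; destruct j as [| [| j]]; [| | lia]; apply H0; lia.
Qed.

(** * The rank *)

Lemma rank2_independent (s : nat -> idx -> scalar) (x0 y0 al be : R) :
  U (x0, y0) ->
  (forall k, (k < 2)%nat -> abelian_relation_at (om W) x0 y0 (s k)) ->
  (forall c : nat -> R,
     locally_2d (fun x y => forall i, lincomb 2 c s i x y = 0) x0 y0 ->
     forall k, (k < 2)%nat -> c k = 0) ->
  (forall j, (j <= 2)%nat ->
     al * jet3 (s 0%nat) j x0 y0 + be * jet3 (s 1%nat) j x0 y0 = 0) ->
  al = 0 /\ be = 0.
Proof.
intros U0 Hs Hind HJ.
assert (A0 := Hs 0%nat ltac:(lia)); assert (A1 := Hs 1%nat ltac:(lia)).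
set (c := fun k : nat => match k with 0%nat => al | _ => be end).
assert (Z : locally_2d (fun x y => forall i, lincomb 2 c s i x y = 0) x0 y0).
{ assert (Z := abelian_zero _ x0 y0 U0 (abelian_comb al be _ _ x0 y0 U0 A0 A1)).
  apply locally_2d_impl with (2 := Z (fun j Hj =>
    eq_trans (jet3_comb al be _ _ x0 y0 j U0 A0 A1) (HJ j Hj))).
  apply locally_2d_forall; intros x y E i; rewrite lincomb2; apply E. }
split; [exact (Hind c Z 0%nat ltac:(lia)) | exact (Hind c Z 1%nat ltac:(lia))].
Qed.

Lemma rank2_of_G :
  nonvanishing_on U (c0 W) ->
  vanishes_on U (G11 W) -> vanishes_on U (G12 W) ->
  vanishes_on U (G21 W) -> vanishes_on U (G22 W) ->
  has_rank U (om W) 2.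
Proof.
intros nz0 H11 H12 H21 H22 x0 y0 U0.
assert (HF : cov_flat W U 1 (fun _ => 1) sys2_1 sys2_2).
{ intros Y x y Uxy HY HS j Hj.
  rewrite (sys2_curvature U Y x y (fun z Hz => Hz) Uxy (nz0 x y Uxy) HY HS j Hj).
  rewrite H11, H12, H21, H22 by exact Uxy.
  destruct (Nat.eqb j 0); field; now apply nz0. }
destruct (abelian_of_sys2 (fun j => if Nat.eqb j 0 then 1 else 0) x0 y0 nz0 U0 HF)
  as (s0 & A0 & J0).
destruct (abelian_of_sys2 (fun j => if Nat.eqb j 0 then 0 else 1) x0 y0 nz0 U0 HF)
  as (s1 & A1 & J1).
assert (J00 := J0 0%nat ltac:(lia)); assert (J01 := J0 1%nat ltac:(lia)).
assert (J10 := J1 0%nat ltac:(lia)); assert (J11 := J1 1%nat ltac:(lia)).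
simpl in J00, J01, J10, J11.
exists (fun k => match k with 0%nat => s0 | _ => s1 end).
split; [| split].
- intros [| k] _; assumption.
- intros c Hc k Hk.
  assert (L := locally_2d_singleton _ _ _ Hc).
  assert (L3 := L i3); assert (L4 := L i4); rewrite lincomb2 in L3, L4.
  unfold comb in L3, L4; rewrite J00, J10 in L3; rewrite J01, J11 in L4.
  destruct k as [| [| k]]; [lra | lra | lia].
- intros la HA.
  (* [s0] and [s1] have (u, v) equal to (1, 0) and (0, 1) at the point, so these are the only
     possible coefficients. *)
  exists (fun k => match k with 0%nat => la i3 x0 y0 | _ => la i4 x0 y0 end).
  set (mu := comb (la i3 x0 y0) (la i4 x0 y0) s0 s1).
  assert (Amu : abelian_relation_at (om W) x0 y0 mu) by now apply abelian_comb.
  assert (Ad : abelian_relation_at (om W) x0 y0 (comb 1 (-1) la mu))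
    by now apply abelian_comb.
  assert (D0 : jet3 (comb 1 (-1) la mu) 0 x0 y0 = 0).
  { unfold mu, jet3, comb; rewrite J00, J10; ring. }
  assert (D1 : jet3 (comb 1 (-1) la mu) 1 x0 y0 = 0).
  { unfold mu, jet3, comb; rewrite J01, J11; ring. }
  (* With u = v = 0 at the point, the relation reduces to c_0 q = 0. *)
  assert (D2 : jet3 (comb 1 (-1) la mu) 2 x0 y0 = 0).
  { assert (C := locally_2d_singleton _ _ _ (abelian_relation_c _ x0 y0 U0 Ad)).
    cbv beta in C; rewrite D0, D1 in C.
    apply Rmult_eq_reg_l with (c0 W x0 y0); [lra | now apply nz0]. }
  assert (Z := abelian_zero _ x0 y0 U0 Ad).
  apply locally_2d_impl with (2 := Z
    ltac:(intros [| [| [| j]]] Hj; [| | | lia]; assumption)).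
  apply locally_2d_forall; intros x y E i; rewrite lincomb2.
  specialize (E i); unfold comb at 1 in E; fold mu; lra.
Qed.

Lemma rank2_G :
  nonvanishing_on U (c0 W) -> has_rank U (om W) 2 ->
  vanishes_on U (G11 W) /\ vanishes_on U (G12 W) /\
  vanishes_on U (G21 W) /\ vanishes_on U (G22 W).
Proof.
intros nz0 HR.
cut (forall x y, U (x, y) ->
  G11 W x y = 0 /\ G12 W x y = 0 /\ G21 W x y = 0 /\ G22 W x y = 0).
{ intros HG; split; [| split; [| split]]; intros x y Uxy; now apply HG. }
intros x0 y0 U0; destruct (HR x0 y0 U0) as (s & Hs & Hind & _).
assert (N0 := nz0 x0 y0 U0).
(* After elimination of q every solution satisfies the reduced system, so the curvature matrix kills
   its (u, v); two independent such vectors force the matrix to be zero. *)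
assert (HC : forall la, abelian_relation_at (om W) x0 y0 la ->
  jet3 la 2 x0 y0
    = - (Defs.c1 W x0 y0 * jet3 la 1 x0 y0 + c2 W x0 y0 * jet3 la 0 x0 y0) / c0 W x0 y0 /\
  G11 W x0 y0 * jet3 la 0 x0 y0 + G12 W x0 y0 * jet3 la 1 x0 y0 = 0 /\
  G21 W x0 y0 * jet3 la 0 x0 y0 + G22 W x0 y0 * jet3 la 1 x0 y0 = 0).
{ intros la HA; destruct (abelian_jet la x0 y0 U0 HA) as (r1 & Hr1 & VU & Hsm & HJ).
  assert (C := abelian_relation_c la x0 y0 U0 HA).
  assert (B := locally_2d_on_open _ _ x0 y0 (open_box x0 y0 r1) (box_center _ _ _ Hr1)
    (fun u v H => conj (HJ u v H) H)).
  assert (H := locally_2d_and _ _ _ _ C B); clear C B.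
  apply box_locally_2d in H; destruct H as (rho & Hr & H).
  set (V := box x0 y0 rho) in *.
  assert (oV : open V) by apply open_box.
  assert (V0 : V (x0, y0)) by now apply box_center.
  assert (VU' : forall z, V z -> U z) by (intros [x y] Hz; now apply VU, (H x y)).
  assert (Hq : forall x y, V (x, y) -> jet3 la 2 x y
    = - (Defs.c1 W x y * jet3 la 1 x y + c2 W x y * jet3 la 0 x y) / c0 W x y).
  { intros x y Hxy; assert (N := nz0 x y (VU' _ Hxy)).
    destruct (H x y Hxy) as [E _].
    apply Rmult_eq_reg_l with (c0 W x y); [| exact N].
    replace (c0 W x y * jet3 la 2 x y) with
      (- (Defs.c1 W x y * jet3 la 1 x y + c2 W x y * jet3 la 0 x y)) by lra.
    field; exact N. }
  split; [now apply Hq |].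
  assert (HS : forall x y, V (x, y) ->
            cov_solves_at W 1 (fun _ => 1) sys2_1 sys2_2 (jet3 la) x y).
  { intros x y Hxy; assert (N := nz0 x y (VU' _ Hxy)).
    destruct (H x y Hxy) as [_ [(_ & _ & S) _]].
    destruct (S 0%nat ltac:(lia)) as [S1 S2].
    destruct (S 1%nat ltac:(lia)) as [S3 S4].
    unfold lin, at_pt in S1, S2, S3, S4; cbn -[jet3] in S1, S2, S3, S4.
    rewrite (Hq x y Hxy) in S1, S2, S3, S4.
    intros j Hj; unfold lin, at_pt; destruct j as [| [| j]]; [| | lia]; cbn -[jet3].
    - rewrite S1, S2; split; field; exact N.
    - rewrite S3, S4; split; field; exact N. }
  assert (HY : forall j, (j <= 1)%nat -> smooth_on V (jet3 la j)).
  { intros j _; apply jet3_smooth; auto.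
    intros i; apply smooth_on_subset with (2 := Hsm i).
    intros [x y] Hz; now apply (H x y). }
  assert (K : forall j, (j <= 1)%nat -> (if Nat.eqb j 0
     then G11 W x0 y0 * jet3 la 0 x0 y0 + G12 W x0 y0 * jet3 la 1 x0 y0
     else G21 W x0 y0 * jet3 la 0 x0 y0 + G22 W x0 y0 * jet3 la 1 x0 y0) = 0).
  { intros j Hj.
    assert (C1 := sys2_curvature V (jet3 la) x0 y0 VU' V0 N0 HY (HS x0 y0 V0) j Hj).
    rewrite (cov_solves_commutator V 1 (fun _ => 1) sys2_1 sys2_2 (jet3 la) x0 y0 j)
      in C1 by auto.
    match type of C1 with _ = _ + ?g / _ => set (G := g) in * end.
    assert (P : G / c0 W x0 y0 ^ 2 = 0) by lra.
    apply Rmult_integral in P; destruct P as [P | P]; [exact P |].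
    now apply Rinv_neq_0_compat in P; [| apply pow_nonzero]. }
  split; [exact (K 0%nat ltac:(lia)) | exact (K 1%nat ltac:(lia))]. }
assert (A0 := Hs 0%nat ltac:(lia)); assert (A1 := Hs 1%nat ltac:(lia)).
destruct (HC _ A0) as (Q0 & P0 & P0'); destruct (HC _ A1) as (Q1 & P1 & P1').
set (u0 := jet3 (s 0%nat) 0 x0 y0) in *; set (v0 := jet3 (s 0%nat) 1 x0 y0) in *.
set (u1 := jet3 (s 1%nat) 0 x0 y0) in *; set (v1 := jet3 (s 1%nat) 1 x0 y0) in *.
(* Since q is a linear function of (u, v) at the point, a combination with u = v = 0 has zero
   jet. *)
assert (ND : forall al be, al * u0 + be * u1 = 0 -> al * v0 + be * v1 = 0 ->
                           al = 0 /\ be = 0).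
{ intros al be E1 E2; apply (rank2_independent s x0 y0 al be U0 Hs Hind).
  intros [| [| [| j]]] Hj; [exact E1 | exact E2 | | lia].
  rewrite Q0, Q1.
  replace (al * _ + be * _) with
    (- (Defs.c1 W x0 y0 * (al * v0 + be * v1) + c2 W x0 y0 * (al * u0 + be * u1))
     / c0 W x0 y0) by (field; exact N0).
  rewrite E1, E2; field; exact N0. }
assert (D : u0 * v1 - u1 * v0 <> 0).
{ intros D.
  (* If the determinant vanishes, (v1, - v0) and (u1, - u0) are linear dependencies, so all four
     entries are 0 and (1, 0) is a dependency too. *)
  destruct (ND v1 (- v0)) as [Z1 Z2]; [lra | ring |].
  destruct (ND u1 (- u0)) as [Z3 Z4]; [ring | lra |].
  destruct (ND 1 0) as [Z5 _]; [| | lra].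
  - replace u0 with 0 by lra; ring.
  - replace v0 with 0 by lra; ring. }
assert (cramer : forall g h, g * u0 + h * v0 = 0 ->
  g * u1 + h * v1 = 0 -> g = 0 /\ h = 0).
{ intros g h E1 E2; split; apply Rmult_eq_reg_r with (2 := D).
  - replace (g * (u0 * v1 - u1 * v0))
      with (v1 * (g * u0 + h * v0) - v0 * (g * u1 + h * v1)) by ring.
    rewrite E1, E2; ring.
  - replace (h * (u0 * v1 - u1 * v0))
      with (u0 * (g * u1 + h * v1) - u1 * (g * u0 + h * v0)) by ring.
    rewrite E1, E2; ring. }
destruct (cramer _ _ P0 P1); destruct (cramer _ _ P0' P1'); auto.
Qed.

(* When c_0 = 0, a nonzero relation c_1 v + c_2 u = 0 at a point would, together with
   its two derivatives, leave at most one dimension; if it is trivial everywhere, the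
   system in (u, v, q) is flat and there are three dimensions. *)
Lemma rank2_c0 :
  (exists z, U z) -> vanishes_on U (c0 W) -> ~ has_rank U (om W) 2.
Proof.
intros [[x1 y1] U1] c00 HR.
assert (HC : forall x0 y0, U (x0, y0) -> Defs.c1 W x0 y0 = 0 /\ c2 W x0 y0 = 0).
{ intros x0 y0 U0; destruct (HR x0 y0 U0) as (s & Hs & Hind & _).
  destruct (inv_a_neq x0 y0 U0) as [nz nz1].
  assert (A0 := Hs 0%nat ltac:(lia)); assert (A1 := Hs 1%nat ltac:(lia)).
  assert (Hrel : forall la, abelian_relation_at (om W) x0 y0 la ->
    Defs.c1 W x0 y0 * jet3 la 1 x0 y0 + c2 W x0 y0 * jet3 la 0 x0 y0 = 0 /\
    (jet3 la 0 x0 y0 = 0 -> jet3 la 1 x0 y0 = 0 -> jet3 la 2 x0 y0 <> 0 ->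
     Defs.c1 W x0 y0 = 0 /\ c2 W x0 y0 = 0)).
  { intros la HA; destruct (abelian_jet la x0 y0 U0 HA) as (r1 & Hr1 & VU & Hsm & HJ).
    assert (V0 := box_center x0 y0 r1 Hr1).
    assert (C := abelian_relation_c la x0 y0 U0 HA).
    assert (C' : locally_2d (fun x y =>
      0 = Defs.c1 W x y * la i4 x y + c2 W x y * la i3 x y) x0 y0).
    { apply locally_2d_impl with (2 := locally_2d_and _ _ _ _ C
        (open_locally_2d U x0 y0 oU U0)), locally_2d_forall.
      intros x y [E Uxy]; rewrite (c00 x y Uxy) in E; simpl in E; lra. }
    split; [symmetry; exact (locally_2d_singleton _ _ _ C') |].
    (* Where u = v = 0, the two derivatives of c_1 v + c_2 u = 0 read a q (c_1 - c_2) = 0 and q (c_1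
       - a c_2) = 0; with q <> 0 and a <> 0, 1 both coefficients vanish. *)
    intros Z0 Z1 Nq.
    assert (Dc1 := smooth_cder W U 3 _ x0 y0 c1_smooth U0).
    assert (Dc2 := smooth_cder W U 3 _ x0 y0 c2_smooth U0).
    assert (Du := smooth_cder W _ 1 _ x0 y0 (Hsm i3) V0).
    assert (Dv := smooth_cder W _ 1 _ x0 y0 (Hsm i4) V0).
    destruct (HJ x0 y0 V0) as (_ & _ & S).
    destruct (S 0%nat ltac:(lia)) as [S1 S2].
    destruct (S 1%nat ltac:(lia)) as [S3 S4].
    unfold lin, at_pt in S1, S2, S3, S4; cbn -[jet3] in S1, S2, S3, S4.
    rewrite Z0, Z1 in S1, S2, S3, S4.
    change (jet3 la 0) with (la i3) in S1, S2, Z0.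
    change (jet3 la 1) with (la i4) in S3, S4, Z1.
    rewrite S1, S2 in Du; rewrite S3, S4 in Dv.
    eassert (D : cder W 4 (fun x y => Defs.c1 W x y * la i4 x y + c2 W x y * la i3 x y)
             x0 y0 _ _) by cder_solve.
    destruct (cder_ext_loc W 4 _ _ x0 y0 _ _ C' (cder_zero W 4 x0 y0))
      as (_ & F1 & F2).
    rewrite (proj1 (proj2 D)) in F1; rewrite (proj2 (proj2 D)) in F2.
    rewrite Z0, Z1 in F1, F2.
    assert (G1 : inv_a W x0 y0 * jet3 la 2 x0 y0 * (Defs.c1 W x0 y0 - c2 W x0 y0) = 0)
      by lra.
    assert (G2 : jet3 la 2 x0 y0 * (Defs.c1 W x0 y0 - inv_a W x0 y0 * c2 W x0 y0) = 0)
      by lra.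
    apply Rmult_integral in G2; destruct G2 as [G2 | G2]; [contradiction |].
    apply Rmult_integral in G1; destruct G1 as [G1 | G1].
    { apply Rmult_integral in G1; destruct G1; contradiction. }
    assert (G3 : (1 - inv_a W x0 y0) * c2 W x0 y0 = 0) by lra.
    apply Rmult_integral in G3; destruct G3 as [G3 | G3]; [contradiction | lra]. }
  destruct (Req_dec (Defs.c1 W x0 y0) 0) as [c10 | c1n];
    [destruct (Req_dec (c2 W x0 y0) 0) as [c20 | c2n]; [now split |] |]; exfalso.
  (* Hence (u, v) is injective on combinations of the two basis germs, while c_1 v + c_2 u = 0
     confines it to a line. *)
  all: assert (ND : forall al be,
    al * jet3 (s 0%nat) 0 x0 y0 + be * jet3 (s 1%nat) 0 x0 y0 = 0 ->
    al * jet3 (s 0%nat) 1 x0 y0 + be * jet3 (s 1%nat) 1 x0 y0 = 0 -> al = 0 /\ be = 0).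
  1, 3: intros al be E1 E2; apply (rank2_independent s x0 y0 al be U0 Hs Hind);
    assert (Ac := abelian_comb al be _ _ x0 y0 U0 A0 A1);
    assert (JE := fun j => jet3_comb al be _ _ x0 y0 j U0 A0 A1);
    intros [| [| [| j]]] Hj; [exact E1 | exact E2 | | lia];
    destruct (Req_dec (jet3 (comb al be (s 0%nat) (s 1%nat)) 2 x0 y0) 0) as [E | NE];
    [now rewrite <- JE |];
    destruct (proj2 (Hrel _ Ac)) as [? ?];
    [now rewrite JE | now rewrite JE | exact NE | contradiction].
  all: assert (R0 := proj1 (Hrel _ A0)); assert (R1 := proj1 (Hrel _ A1));
    set (u0 := jet3 (s 0%nat) 0 x0 y0) in *; set (v0 := jet3 (s 0%nat) 1 x0 y0) in *;
    set (u1 := jet3 (s 1%nat) 0 x0 y0) in *; set (v1 := jet3 (s 1%nat) 1 x0 y0) in *.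
  - assert (Hu : u0 = 0 /\ u1 = 0).
    { rewrite c10 in R0, R1.
      split; apply Rmult_eq_reg_l with (2 := c2n); lra. }
    destruct Hu as [Hu0 Hu1]; rewrite Hu0, Hu1 in ND.
    destruct (ND v1 (- v0)) as [Z1 Z2]; [ring | ring |].
    destruct (ND 1 0) as [Z3 _]; [ring | | lra].
    replace v0 with 0 by lra; ring.
  - assert (Hv : forall al be, al * u0 + be * u1 = 0 -> al * v0 + be * v1 = 0).
    { intros al be E; apply Rmult_eq_reg_l with (2 := c1n).
      replace (Defs.c1 W x0 y0 * (al * v0 + be * v1)) with
        (al * (Defs.c1 W x0 y0 * v0 + c2 W x0 y0 * u0)
         + be * (Defs.c1 W x0 y0 * v1 + c2 W x0 y0 * u1)
         - c2 W x0 y0 * (al * u0 + be * u1)) by ring.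
      rewrite R0, R1, E; ring. }
    destruct (ND u1 (- u0)) as [Z1 Z2]; [ring | apply Hv; ring |].
    destruct (ND 1 0) as [Z3 _]; [| apply Hv | lra]; replace u0 with 0 by lra; lra. }
assert (HF : cov_flat W U 2 weight3 sys3_1 sys3_2).
{ intros Y x y Uxy HY HS j Hj.
  rewrite (sys3_curvature U Y x y (fun z Hz => Hz) Uxy HY HS j Hj).
  destruct (HC x y Uxy) as [E1 E2]; rewrite E1, E2, (c00 x y Uxy).
  destruct (Nat.eqb j 2); ring. }
destruct (HR x1 y1 U1) as (s & Hs & _ & Hspan).
assert (A0 := Hs 0%nat ltac:(lia)); assert (A1 := Hs 1%nat ltac:(lia)).
(* By flatness every vector is the jet of a relation, hence a combination of two fixed jets; three
   unit vectors contradict this. *)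
assert (Hsol : forall eta : nat -> R, exists al be, forall j, (j <= 2)%nat ->
  al * jet3 (s 0%nat) j x1 y1 + be * jet3 (s 1%nat) j x1 y1 = eta j).
{ intros eta; destruct (abelian_of_sys3 eta x1 y1 U1 HF) as (la & HA & HJ).
  destruct (Hspan la HA) as [c Hc]; exists (c 0%nat), (c 1%nat); intros j Hj.
  rewrite <- (HJ j Hj), <- (jet3_comb _ _ _ _ x1 y1 j U1 A0 A1).
  symmetry; apply jet3_local.
  apply locally_2d_impl with (2 := Hc), locally_2d_forall.
  intros x y E i; rewrite <- lincomb2; apply E. }
destruct (Hsol (fun j => if Nat.eqb j 0 then 1 else 0)) as (p0 & q0 & E0).
destruct (Hsol (fun j => if Nat.eqb j 1 then 1 else 0)) as (p1 & q1 & E1).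
destruct (Hsol (fun j => if Nat.eqb j 2 then 1 else 0)) as (p2 & q2 & E2).
assert (B := fun j => conj (E0 j) (conj (E1 j) (E2 j))).
destruct (B 0%nat) as (X0 & X1 & X2); destruct (B 1%nat) as (X3 & X4 & X5);
  destruct (B 2%nat) as (X6 & X7 & X8).
specialize (X0 ltac:(lia)); specialize (X1 ltac:(lia)); specialize (X2 ltac:(lia)).
specialize (X3 ltac:(lia)); specialize (X4 ltac:(lia)); specialize (X5 ltac:(lia)).
specialize (X6 ltac:(lia)); specialize (X7 ltac:(lia)); specialize (X8 ltac:(lia)).
simpl Nat.eqb in *; cbv iota in *.
set (u0 := jet3 (s 0%nat) 0 x1 y1) in *; set (v0 := jet3 (s 0%nat) 1 x1 y1) in *.
set (u1 := jet3 (s 1%nat) 0 x1 y1) in *; set (v1 := jet3 (s 1%nat) 1 x1 y1) in *.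
set (w0 := jet3 (s 0%nat) 2 x1 y1) in *; set (w1 := jet3 (s 1%nat) 2 x1 y1) in *.
(* The identity matrix would be a product of a 3x2 and a 2x3 matrix. *)
assert (D : (p0 * u0 + q0 * u1) * ((p1 * v0 + q1 * v1) * (p2 * w0 + q2 * w1)
                                   - (p1 * w0 + q1 * w1) * (p2 * v0 + q2 * v1))
  - (p0 * v0 + q0 * v1) * ((p1 * u0 + q1 * u1) * (p2 * w0 + q2 * w1)
                           - (p1 * w0 + q1 * w1) * (p2 * u0 + q2 * u1))
  + (p0 * w0 + q0 * w1) * ((p1 * u0 + q1 * u1) * (p2 * v0 + q2 * v1)
                           - (p1 * v0 + q1 * v1) * (p2 * u0 + q2 * u1)) = 0) by ring.
rewrite X0, X1, X2, X3, X4, X5, X6, X7, X8 in D; lra.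
Qed.

End Web.

Theorem theorem5 :
  forall (U : R * R -> Prop) (W : web_data),
    plane_domain U ->
    planar_4web U (om W) ->
    normalized U W ->
    chern_connection U W ->
    curvature_function U W ->
    (nonvanishing_on U (c0 W) \/ vanishes_on U (c0 W)) ->
    (has_rank U (om W) 2 <->
     (nonvanishing_on U (c0 W) /\
      vanishes_on U (G11 W) /\ vanishes_on U (G12 W) /\
      vanishes_on U (G21 W) /\ vanishes_on U (G22 W))).
Proof.
intros U W (oU & ne & _) web norm chern curv H0; split.
- intros HR; destruct H0 as [nz0 | c00].
  + split; [exact nz0 |].
    exact (rank2_G U W oU web norm chern curv nz0 HR).
  + exfalso; exact (rank2_c0 U W oU web norm chern curv ne c00 HR).
- intros (nz0 & H11 & H12 & H21 & H22).
  exact (rank2_of_G U W oU web norm chern curv nz0 H11 H12 H21 H22).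
Qed.
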